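(* Let $(\mathcal{A},\gamma,\mathbb{T})$ be a full $C^*$-dynamical system with $\mathcal{A}$ unital and $\mathcal{A}^0$ exact. Let $\sigma_{\{x_i\}}$ and $\ell_{\{x_i\}}$ be the unital completely positive map and the one-sided subshift associated to a finite set $\{x_i\}\subset\mathcal{A}^1$ satisfying $\sum_ix_ix_i^*=I$. Then for any finite subset $\omega\subset\mathcal{A}^0$ and any $n_0\in\mathbb{N}_0$, $$\mathrm{ht}(\sigma_{\{x_i\}},F(\omega,n_0))\le h_{\mathrm{top}}(\sigma|_{\ell_{\{x_i\}}})+\mathrm{ht}_2(\{\phi_{x_i,x_j}\},\omega),$$ where $F(\omega,n_0)=\{x_\gamma T:T\in\omega,\ |\gamma|\le n_0\}$.
   Context: $\gamma$ is a (strongly continuous) action of $\mathbb{T}$ on $\mathcal{A}$ by $*$-automorphisms; $\mathcal{A}^k=\{a:\gamma_z(a)=z^ka\ \forall z\in\mathbb{T}\}$; full means that for every $k\in\mathbb{Z}$ the closed linear span of $\mathcal{A}^k\mathcal{A}^{-k}$ equals $\mathcal{A}^0$. $\sigma_{\{x_i\}}(T)=\sum_ix_iTx_i^*$, $T\in\mathcal{A}$. $\ell_{\{x_i\}}$ is the one-sided subshift of all sequences $(\lambda_r)_{r\in\mathbb{N}}$ of indices with $x_{\lambda_1}\cdots x_{\lambda_r}\neq0$ for all $r$; $\sigma$ is the left shift, $h_{\mathrm{top}}$ is topological entropy; $\ell^r$ is the set of words of length $r$ occurring in $\ell_{\{x_i\}}$, $\theta_r$ its cardinality ($\theta_0=1$).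 For a word $\mu=(i_1,\dots,i_r)\in\ell^r$, $x_\mu=x_{i_1}\cdots x_{i_r}$, $|\mu|=r$, and $x_\emptyset=I$. For words with $|\alpha|=|\beta|$, $q_{\alpha,\beta}=x_\alpha^*x_\beta\in\mathcal{A}^0$. $\phi_{x_i,x_j}$ is the map $T\in\mathcal{A}^0\mapsto x_i^*Tx_j$. For an exact $C^*$-algebra $\mathcal{C}$ faithfully represented on a Hilbert space $H$, a finite subset $\Omega\subset\mathcal{C}$ and $\delta>0$, $\mathrm{rcp}(\Omega,\delta)$ is the smallest rank (dimension of a maximal abelian subalgebra) of a finite-dimensional $C^*$-algebra $B$ for which there are contractive completely positive maps $\varphi:\mathcal{C}\to B$, $\psi:B\to\mathcal{B}(H)$ with $\|\psi\varphi(a)-a\|<\delta$ for all $a\in\Omega$ (independent of the faithful representation). For a ucp map $\rho$ of $\mathcal{C}$: $\mathrm{ht}(\rho,\Omega)=\sup_{\delta>0}\limsup_n\frac1n\log\mathrm{rcp}(\Omega\cup\rho(\Omega)\cup\dots\cup\rho^{n-1}(\Omega),\delta)$. (Here $\mathcal{A}$ is exact because $\mathcal{A}^0$ is, and $\mathrm{ht}(\sigma_{\{x_i\}},\cdot)$ is computed in $\mathcal{A}$.) For a finite $\omega\subset\mathcal{A}^0$ and $n\in\mathbb{N}$ let $\omega^{(n)}=\{x_\mu^*q_{\delta,\delta'}Tq_{\epsilon,\epsilon'}x_\nu:T\in\omega,\ |\mu|=|\nu|\le n-1,\ |\delta|=|\delta'|\le n-1,\ |\epsilon|=|\epsilon'|\le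 n-1\}$. For $a>0$, $\mathrm{ht}_a(\{\phi_{x_i,x_j}\},\omega)=\sup_{\delta>0}\limsup_n\frac1n\log\mathrm{rcp}\big(\omega^{(n)},\delta/\theta_{n-1}^{\,a}\big)$, with $\mathrm{rcp}$ computed in $\mathcal{A}^0$. *)

(* Defs.v *)
From HB Require Import structures.
From mathcomp Require Import all_boot all_order all_algebra.
From mathcomp Require Import complex sesquilinear falgebra.
From mathcomp Require Import all_classical all_reals all_analysis.

Set Implicit Arguments.
Unset Strict Implicit.
Unset Printing Implicit Defensive.

Import Order.TTheory GRing.Theory Num.Theory.
Import numFieldNormedType.Exports.

Local Open Scope classical_set_scope.
Local Open Scope ring_scope.
Local Open Scope complex_scope.

(* Unital C*-algebras.  The norm is real-valued and completeness is stated for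
   Cauchy sequences: the hierarchy has no join of [algType] and [normedModType]
   (a [normedModType R[i]] has its norm in R[i]).  [algType] forces 1 != 0. *)
HB.mixin Record isCStarAlgebra (R : realType) A & GRing.Algebra R[i] A := {
  cnorm : A -> R;
  star : A -> A;
  cnorm_eq0 : forall a, cnorm a = 0 -> a = 0;
  ler_cnormD : forall a b, cnorm (a + b) <= cnorm a + cnorm b;
  cnormZ : forall (c : R[i]) a, (cnorm (c *: a))%:C = `|c| * (cnorm a)%:C;
  ler_cnormM : forall a b, cnorm (a * b) <= cnorm a * cnorm b;
  cnorm_complete : forall u : nat -> A,
    (forall e : R, 0 < e -> exists N : nat, forall m n : nat,
       (N <= m)%N -> (N <= n)%N -> cnorm (u m - u n) < e) ->
    exists l : A, forall e : R, 0 < e -> exists N : nat, forall n : nat,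
      (N <= n)%N -> cnorm (u n - l) < e;
  starK : forall a, star (star a) = a;
  starD : forall a b, star (a + b) = star a + star b;
  starZ : forall (c : R[i]) a, star (c *: a) = Num.conj c *: star a;
  starM : forall a b, star (a * b) = star b * star a;
  cnorm_starM : forall a, cnorm (star a * a) = cnorm a ^+ 2
}.

#[short(type="cstarAlgType")]
HB.structure Definition CStarAlgebra (R : realType) :=
  {A of GRing.Algebra R[i] A & isCStarAlgebra R A}.

#[short(type="fdCstarAlgType")]
HB.structure Definition FDCStarAlgebra (R : realType) :=
  {B of Falgebra R[i] B & isCStarAlgebra R B}.

(* [inner] is linear in its first argument. *)
Record hilbertType (R : realType) := Hilbert {
  hilbert_sort :> completeNormedModType R[i];
  inner : {dot hilbert_sort for Num.conj};
  inner_norm : forall u : hilbert_sort, `|u| ^+ 2 = inner u u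
}.

(* B(H) *)
Record bop (R : realType) (H : hilbertType R) := Bop {
  bop_fun :> {linear H -> H};
  bop_bounded : exists M : R, forall u : H, `|bop_fun u| <= M%:C * `|u|
}.

Definition opnorm (R : realType) (H : hilbertType R) (T : H -> H) : \bar R :=
  ereal_sup [set (complex.Re `|T u|)%:E | u in [set u : H | `|u| <= 1]].

Section MaximalAbelian.
Variables (R : realType) (B : fdCstarAlgType R).

Definition abelian_star_subalgebra (D : {aspace B}) : Prop :=
  (forall a, a \in D -> star a \in D) /\
  (forall a b, a \in D -> b \in D -> a * b = b * a).

Definition maximal_abelian (D : {aspace B}) : Prop :=
  abelian_star_subalgebra D /\
  forall D' : {aspace B}, abelian_star_subalgebra D' ->
    (D <= D')%VS -> (D' <= D)%VS.
End MaximalAbelian.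

(* A C*-subalgebra of A is given by its carrier [S : set A]; a map defined on
   it is a map on A of which only the values on S are constrained. *)
Section CompletelyPositive.
Variable (R : realType).

Definition star_mx (A : cstarAlgType R) n (M : 'M[A]_n) : 'M[A]_n :=
  \matrix_(i, j) star (M j i).

Definition positive_mx (A : cstarAlgType R) (S : set A) n (M : 'M[A]_n) : Prop :=
  exists2 N : 'M[A]_n, (forall i j, S (N i j)) & M = star_mx N *m N.

Definition contractive_cp (A B : cstarAlgType R) (S : set A) (phi : A -> B) : Prop :=
  [/\ forall (c : R[i]) a b, S a -> S b -> phi (c *: a + b) = c *: phi a + phi b,
      forall n (M : 'M[A]_n), positive_mx S M -> positive_mx setT (map_mx phi M)
    & forall a, S a -> cnorm (phi a) <= cnorm a].

(* A matrix of operators is positive when it is a positive operator on H^n. *)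
Definition contractive_cp_op (B : cstarAlgType R) (H : hilbertType R)
    (psi : B -> bop H) : Prop :=
  [/\ forall (c : R[i]) a b (u : H), psi (c *: a + b) u = c *: psi a u + psi b u,
      forall n (M : 'M[B]_n), positive_mx setT M -> forall u : 'I_n -> H,
        0 <= \sum_i \sum_j inner H (psi (M i j) (u j)) (u i)
    & forall a, (opnorm (psi a) <= (cnorm a)%:E)%E].

Record faithful_rep (A : cstarAlgType R) (S : set A) (H : hilbertType R)
    (pi : A -> bop H) : Prop := FaithfulRep {
  rep_linear : forall (c : R[i]) a b (u : H), S a -> S b ->
    pi (c *: a + b) u = c *: pi a u + pi b u;
  rep_mul : forall a b (u : H), S a -> S b -> pi (a * b) u = pi a (pi b u);
  rep_star : forall a (u v : H), S a ->
    inner H (pi a u) v = inner H u (pi (star a) v);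
  rep_faithful : forall a, S a -> (forall u : H, pi a u = 0) -> a = 0
}.
End CompletelyPositive.

Section Rcp.
Variables (R : realType) (A : cstarAlgType R) (S : set A).
Variables (H : hilbertType R) (pi : A -> bop H).

Definition cp_approx (Omega : set A) (delta : R) (r : nat) : Prop :=
  exists (B : fdCstarAlgType R) (D : {aspace B}) (phi : A -> B) (psi : B -> bop H),
    [/\ maximal_abelian D, \dim D = r,
        contractive_cp S phi, contractive_cp_op psi
      & forall a, Omega a ->
          (opnorm (fun u : H => psi (phi a) u - pi a u)%R < delta%:E)%E].

(* The smallest r with [cp_approx Omega delta r], or +oo if there is none. *)
Definition rcp (Omega : set A) (delta : R) : \bar R :=
  ereal_inf [set (r%:R : R)%:E | r in cp_approx Omega delta].
End Rcp.

(* Exactness in the form of nuclear embeddability (Kirchberg; Brown-Ozawa,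
   Definition 2.3.2): some faithful representation is a nuclear map. *)
Definition exact_cstar (R : realType) (A : cstarAlgType R) (S : set A) : Prop :=
  exists (H : hilbertType R) (pi : A -> bop H), faithful_rep S pi /\
    forall (Omega : set A) (delta : R), finite_set Omega -> Omega `<=` S ->
      0 < delta -> exists r, cp_approx S pi Omega delta r.

Section Dynamics.
Variables (R : realType) (A : cstarAlgType R).

(* Strongly continuous actions of the circle; only gamma z with |z| = 1 matters.
   Each gamma z is bijective by [act1] and [actM]. *)
Record circle_action (gamma : R[i] -> A -> A) : Prop := CircleAction {
  act_linear : forall (z c : R[i]) a b, `|z| = 1 ->
    gamma z (c *: a + b) = c *: gamma z a + gamma z b;
  act_mul : forall (z : R[i]) a b, `|z| = 1 -> gamma z (a * b) = gamma z a * gamma z b;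
  act_star : forall (z : R[i]) a, `|z| = 1 -> gamma z (star a) = star (gamma z a);
  act1 : forall a, gamma 1 a = a;
  actM : forall (z w : R[i]) a, `|z| = 1 -> `|w| = 1 ->
    gamma (z * w) a = gamma z (gamma w a);
  act_continuous : forall a (z : R[i]) (e : R), `|z| = 1 -> 0 < e ->
    exists2 d : R, 0 < d & forall w : R[i], `|w| = 1 -> `|w - z| < d%:C ->
      cnorm (gamma w a - gamma z a) < e
}.

Definition spectral (gamma : R[i] -> A -> A) (k : int) : set A :=
  [set a | forall z : R[i], `|z| = 1 -> gamma z a = z ^ k *: a].

Definition linear_span (E : set A) : set A :=
  [set a | exists (n : nat) (c : 'I_n -> R[i]) (s : 'I_n -> A),
     (forall i, E (s i)) /\ a = \sum_i c i *: s i].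

Definition closed_linear_span (E : set A) : set A :=
  [set a | forall e : R, 0 < e -> exists2 b, linear_span E b & cnorm (a - b) < e].

Definition full_action (gamma : R[i] -> A -> A) : Prop :=
  forall k : int,
    closed_linear_span [set a * b | a in spectral gamma k & b in spectral gamma (- k)]
    = spectral gamma 0.
End Dynamics.

(* Adler-Konheim-McAndrew entropy of T restricted to Y, with covers of the
   subspace Y written as covers of Y by open sets of X. *)
Section TopologicalEntropy.
Variables (R : realType) (X : topologicalType) (T : X -> X) (Y : set X).

Definition open_cover_of (U : set (set X)) : Prop :=
  (forall V, U V -> open V) /\ Y `<=` \bigcup_(V in U) V.

Definition dynamical_join (U : set (set X)) (n : nat) : set (set X) :=
  [set \bigcap_(k in `I_n) (iter k T @^-1` V k) | V in
    [set V : nat -> set X | forall k, U (V k)]].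

Definition cover_number (U : set (set X)) : \bar R :=
  ereal_inf [set (m%:R : R)%:E | m in [set m : nat |
    exists W : 'I_m -> set X, (forall i, U (W i)) /\ Y `<=` \bigcup_i W i]].

(* The sequence converges by subadditivity, so its limsup is its limit. *)
Definition cover_entropy (U : set (set X)) : \bar R :=
  limn_esup (fun n => ((n%:R^-1 : R)%:E * lne (cover_number (dynamical_join U n)))%E).

Definition htop : \bar R :=
  ereal_sup [set cover_entropy U | U in open_cover_of].
End TopologicalEntropy.
Arguments htop R {X} T Y.

Section Subshift.
Variables (R : realType) (A : cstarAlgType R) (d : nat) (x : 'I_d -> A).

Definition full_shift : topologicalType :=
  prod_topology (fun _ : nat => discrete_topology 'I_d).

Definition left_shift (l : full_shift) : full_shift := fun n => l n.+1.

Definition subshift : set full_shift :=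
  [set l | forall r : nat, \prod_(0 <= i < r) x (l i) != 0].

Definition in_language (w : seq 'I_d) : Prop :=
  exists (l : full_shift) (k : nat),
    subshift l /\ w = mkseq (fun j => l (k + j)%N) (size w).

Definition card_words (r : nat) : nat :=
  #|[pred w : r.-tuple 'I_d | `[< in_language w >]]|.

Definition xw (w : seq 'I_d) : A := \prod_(i <- w) x i.

Definition qel (alpha beta : seq 'I_d) : A := star (xw alpha) * xw beta.

Definition sum_map (T : A) : A := \sum_i x i * T * star (x i).

Definition F_set (omega : set A) (n0 : nat) : set A :=
  [set a | exists w T, [/\ in_language w, (size w <= n0)%N, omega T & a = xw w * T]].

Definition word_pair (n : nat) (w w' : seq 'I_d) : Prop :=
  [/\ in_language w, in_language w', size w = size w' & (size w <= n)%N].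

Definition omega_upto (omega : set A) (n : nat) : set A :=
  [set a | exists (T : A) (mu nu del del' eps eps' : seq 'I_d),
     [/\ omega T, word_pair n.-1 mu nu, word_pair n.-1 del del',
         word_pair n.-1 eps eps'
       & a = star (xw mu) * qel del del' * T * qel eps eps' * xw nu]].
End Subshift.

(* rcp does not depend on the representation, which is therefore a parameter;
   for a C*-subalgebra of A the restriction of that of A is used. *)
Section Entropies.
Variables (R : realType) (A : cstarAlgType R).
Variables (H : hilbertType R) (pi : A -> bop H).

Definition ht (rho : A -> A) (Omega : set A) : \bar R :=
  ereal_sup [set
    limn_esup (fun n => ((n%:R^-1 : R)%:E *
      lne (rcp setT pi (\bigcup_(k in `I_n) (iter k rho @` Omega)) delta))%E)
  | delta in [set delta : R | 0 < delta]].

Definition ht_phi (A0 : set A) (d : nat) (x : 'I_d -> A) (a : R) (omega : set A) : \bar R :=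
  ereal_sup [set
    limn_esup (fun n => ((n%:R^-1 : R)%:E *
      lne (rcp A0 pi (omega_upto x omega n) (delta / (card_words x n.-1)%:R `^ a)))%E)
  | delta in [set delta : R | 0 < delta]].
End Entropies.

(* Main.v *)
Require Import Defs.
From HB Require Import structures.
From mathcomp Require Import all_boot all_order all_algebra.
From mathcomp Require Import complex sesquilinear falgebra.
From mathcomp Require Import all_classical all_reals all_analysis.
From mathcomp Require Import ring lra zify.

Set Implicit Arguments.
Unset Strict Implicit.
Unset Printing Implicit Defensive.

Import Order.TTheory GRing.Theory Num.Theory.
Import numFieldNormedType.Exports.

Local Open Scope classical_set_scope.
Local Open Scope ring_scope.
Local Open Scope complex_scope.

(** Write N for a large integer, m = n + n0 + N and let J be the set of words w of the
    language with n + n0 <= |w| < m.  If E is the conditional expectation of A onto A^0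
    given by averaging over the circle, then a |-> (E(x_v^* a x_w))_{v,w in J} is
    completely positive into M_J(A^0); composing with M |-> N^-1 sum_{v,w} x_v M_{vw} x_w^*
    multiplies an element of degree g by its Fejer coefficient 1 - g/N, because
    sum_{|w| = i} x_w x_w^* = 1 for every i.  On sigma^k(x_gamma T) with k < n the matrix
    entries are sums of at most theta_k elements of omega^(m), so that
    an approximation of omega^(m) through B up to delta / theta_{m-1}^2 gives one of
    sigma^k(F), k < n, through M_J(B), whose rank is |J| <= N theta_{m-1} times that of B.

    The structure theory of B is not needed: the C*-norm of M_J(B) is defined through
    the regular representation of B on the pre-Hilbert space given by the trace of left
    multiplications.  Completeness of such an operator norm on a matrix algebra
    rests on the fact that injective representations are isometric. *)

(** * C*-norm, limits and square roots *)

(** The elements [x_gamma T] have nonzero degree in general, so [E] alone would kill them, while the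
    given approximations live on [A^0] only. Compressing by words of different lengths cures both:
    the difference of lengths cancels the degree. The price is the Fejer loss, at most [n0 / N]
    times a norm bound. It does not depend on [n], so [N] is fixed once and disappears after
    division by [n]. Lengths start at [n + n0] to leave room for matching a word [mu] of length
    [k < n], and [mu gamma], with initial segments of [w] and [v]; this produces the factors [q].
    The exponent 2 is one [theta] for the number of words [mu] in an entry and one for the size of
    the matrix, by which entrywise errors are multiplied. The rank costs another [theta], whose
    growth is bounded by the topological entropy. Positivity has to pass between Gram matrices,
    which define complete positivity, and quadratic forms, in which the estimates are made. The
    bridge is a square root inside a given closed subalgebra, so that Gram factors over [A^0] keep
    their entries in [A^0]. *)

Lemma normc_real (R : realType) (r : R) : `|r%:C| = `|r|%:C.
Proof. by rewrite normc_def /= expr0n addr0 sqrtr_sqr. Qed.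

Lemma conjC_real (R : realType) (r : R) : Num.conj (r%:C) = r%:C.
Proof. by apply/CrealP; rewrite complex_real. Qed.

Section CStarBasics.
Variables (R : realType) (A : cstarAlgType R).
Implicit Types a b : A.

Lemma cnormZr (r : R) a : cnorm (r%:C *: a) = `|r| * cnorm a.
Proof. by apply: (@complexI R); rewrite cnormZ normc_real rmorphM. Qed.

Lemma cnormZ1 (c : R[i]) a : `|c| = 1 -> cnorm (c *: a) = cnorm a.
Proof. by move=> c1; apply: (@complexI R); rewrite cnormZ c1 mul1r. Qed.

Lemma cnorm0 : cnorm (0 : A) = 0.
Proof. by have := cnormZr 0 0; rewrite scaler0 normr0 mul0r. Qed.

Lemma cnormN a : cnorm (- a) = cnorm a.
Proof. by rewrite -scaleN1r cnormZ1 // normrN1. Qed.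

Lemma cdistC a b : cnorm (a - b) = cnorm (b - a).
Proof. by rewrite -opprB cnormN. Qed.

Lemma cnorm_ge0 a : 0 <= cnorm a.
Proof. have := ler_cnormD a (- a); rewrite subrr cnorm0 cnormN; lra. Qed.

Lemma star0 : star (0 : A) = 0.
Proof. by rewrite -[in LHS](scale0r (0 : A)) starZ conjC0 scale0r. Qed.

Lemma starN a : star (- a) = - star a.
Proof. by rewrite -scaleN1r starZ rmorphN rmorph1 scaleN1r. Qed.

Lemma starB a b : star (a - b) = star a - star b.
Proof. by rewrite starD starN. Qed.

Lemma star1 : star (1 : A) = 1.
Proof. by have := starM (star 1 : A) 1; rewrite mulr1 !starK mulr1 => <-. Qed.

Lemma starZr (r : R) a : star (r%:C *: a) = r%:C *: star a.
Proof. by rewrite starZ conjC_real. Qed.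

Lemma star_sum (I : Type) (r : seq I) (P : pred I) (F : I -> A) :
  star (\sum_(i <- r | P i) F i) = \sum_(i <- r | P i) star (F i).
Proof. exact: (big_morph _ starD star0). Qed.

Lemma cnorm_sum (I : Type) (r : seq I) (P : pred I) (F : I -> A) :
  cnorm (\sum_(i <- r | P i) F i) <= \sum_(i <- r | P i) cnorm (F i).
Proof.
elim/big_rec2: _ => [|i y x _ h]; first by rewrite cnorm0.
by apply: (le_trans (ler_cnormD _ _)); rewrite lerD2l.
Qed.

Lemma cnorm_star a : cnorm (star a) = cnorm a.
Proof.
suff H b : cnorm b <= cnorm (star b).
  by apply/le_anti; rewrite H -{2}(starK a) H.
have [->|b0] := eqVneq (cnorm b) 0; first exact: cnorm_ge0.
have bp : 0 < cnorm b by rewrite lt_def b0 cnorm_ge0.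
by rewrite -(ler_pM2r bp) -expr2 -cnorm_starM ler_cnormM.
Qed.

Lemma cnorm1 : cnorm (1 : A) = 1.
Proof.
have n1 : cnorm (1 : A) != 0.
  by apply/eqP => /cnorm_eq0/eqP; rewrite oner_eq0.
have := cnorm_starM (1 : A); rewrite star1 mulr1 expr2.
by move=> h; apply: (mulfI n1); rewrite mulr1 -h.
Qed.

(** Encoded as a real limit, so that limit theorems for real sequences apply. *)
Definition ccvg (u : nat -> A) (l : A) : Prop :=
  (fun n => cnorm (u n - l)) @ \oo --> (0 : R).

Lemma ccvgP u l : ccvg u l <->
  (forall e : R, 0 < e -> exists N : nat, forall n : nat, (N <= n)%N -> cnorm (u n - l) < e).
Proof.
split=> [/cvgrPdist_lt h e e0|h].
  have [N _ hN] := h e e0; exists N => n Nn.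
  by have := hN n Nn; rewrite /= sub0r normrN ger0_norm // cnorm_ge0.
apply/cvgrPdist_lt => e e0; have [N hN] := h e e0; exists N => // n Nn /=.
by rewrite sub0r normrN ger0_norm ?cnorm_ge0 // hN.
Qed.

Lemma ccvg_le u l (t : nat -> R) : (forall n, cnorm (u n - l) <= t n) ->
  t @ \oo --> (0 : R) -> ccvg u l.
Proof.
move=> h ht; apply: (squeeze_cvgr _ (cvg_cst 0) ht).
by apply: nearW => n; rewrite cnorm_ge0 h.
Qed.

Lemma ccvg_unique u l m : ccvg u l -> ccvg u m -> l = m.
Proof.
move=> hl hm; apply/eqP; rewrite -subr_eq0; apply/eqP/cnorm_eq0.
have h : (fun n => cnorm (u n - l) + cnorm (u n - m)) @ \oo --> (0 : R).
  by rewrite -[0 in X in _ --> X]addr0; apply: cvgD.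
apply/le_anti; rewrite cnorm_ge0 andbT.
apply: (cvgr_to_ge h); apply: nearW => n; rewrite (cdistC (u n) l).
by apply: le_trans (ler_cnormD _ _); rewrite addrA subrK.
Qed.

Lemma ccvg_cst a : ccvg (fun=> a) a.
Proof. by apply: (@ccvg_le _ _ (fun=> 0)); [move=> n; rewrite subrr cnorm0|exact: cvg_cst]. Qed.

Lemma ccvgD u v l m : ccvg u l -> ccvg v m -> ccvg (fun n => u n + v n) (l + m).
Proof.
move=> hl hm; apply: (@ccvg_le _ _ (fun n => cnorm (u n - l) + cnorm (v n - m))).
  by move=> n; rewrite opprD addrACA; exact: ler_cnormD.
by rewrite -[0 in X in _ --> X]addr0; apply: cvgD.
Qed.

Lemma ccvgM u v l m : ccvg u l -> ccvg v m -> ccvg (fun n => u n * v n) (l * m).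
Proof.
move=> hl hm.
apply: (@ccvg_le _ _ (fun n => cnorm (u n - l) * cnorm (v n - m) +
  cnorm (u n - l) * cnorm m + cnorm l * cnorm (v n - m))).
  move=> n.
  have -> : u n * v n - l * m = (u n - l) * (v n - m) + (u n - l) * m + l * (v n - m).
    by rewrite -mulrDr subrK mulrBl mulrBr addrA subrK.
  apply: (le_trans (ler_cnormD _ _)); apply: lerD (ler_cnormM _ _).
  by apply: (le_trans (ler_cnormD _ _)); apply: lerD; exact: ler_cnormM.
have e0 : 0 * 0 + 0 * cnorm m + cnorm l * 0 = 0 :> R by rewrite !mulr0 mul0r !addr0.
rewrite -[0 in X in _ --> X]e0; apply: cvgD; [apply: cvgD|]; apply: cvgM => //; exact: cvg_cst.
Qed.

Lemma ccvgZ c u l : ccvg u l -> ccvg (fun n => c *: u n) (c *: l).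
Proof.
move=> h; have := ccvgM (ccvg_cst (c *: 1)) h; rewrite -scalerAl mul1r.
by congr (ccvg _ _); apply/funext => n; rewrite -scalerAl mul1r.
Qed.

Lemma ccvg_star u l : ccvg u l -> ccvg (fun n => star (u n)) (star l).
Proof.
move=> h; apply: (@ccvg_le _ _ (fun n => cnorm (u n - l))) => // n.
by rewrite -starB cnorm_star.
Qed.

Lemma ccvgS u l : ccvg u l -> ccvg (fun n => u n.+1) l.
Proof. by rewrite /ccvg (@cvg_shiftS _ (fun n => cnorm (u n - l))). Qed.

Lemma ccvg_bound u l (t : R) : ccvg u l -> (forall n, cnorm (u n) <= t) -> cnorm l <= t.
Proof.
move=> h ht.
have h' : (fun n => cnorm (u n - l) + t) @ \oo --> (0 + t : R) by apply: cvgD => //; exact: cvg_cst.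
rewrite -[t]add0r; apply: (cvgr_to_ge h'); apply: nearW => n; rewrite cdistC -[in X in X <= _](subrK (u n) l).
by apply: (le_trans (ler_cnormD _ _)); rewrite lerD2l.
Qed.

(** Majorant criterion: increments dominated by those of a convergent real sequence. *)
Lemma ccvg_cauchy u (t : nat -> R) :
  (forall m n, (m <= n)%N -> cnorm (u n - u m) <= t n - t m) -> cvgn t ->
  exists l, ccvg u l.
Proof.
move=> h /cvg_cauchy/cauchyP ct.
have [|l hl] := @cnorm_complete R A u; last by exists l; apply/ccvgP.
move=> e e0; have [x [N _ hN]] := ct (e / 2) ltac:(by lra).
exists N.
suff H m n : (N <= m)%N -> (m <= n)%N -> cnorm (u n - u m) < e.
  move=> m n Nm Nn; have [mn|/ltnW nm] := leqP m n; last exact: H.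
  by rewrite cdistC; exact: H.
move=> Nm mn; apply: (le_lt_trans (h _ _ mn)).
have := hN m Nm; have := hN n (leq_trans Nm mn).
rewrite /ball /= ltr_norml ltr_norml => /andP[? ?] /andP[? ?]; lra.
Qed.

(** Closure under [star] is left out on purpose: the commutant of one element must qualify, besides
    [A^0], the whole algebra and matrices over [S]. *)
Record closed_subalg (S : set A) : Prop := ClosedSubalg {
  csub1 : S 1;
  csub_lin : forall c a b, S a -> S b -> S (c *: a + b);
  csubM : forall a b, S a -> S b -> S (a * b);
  csub_lim : forall u l, (forall n, S (u n)) -> ccvg u l -> S l }.

Lemma closed_subalgT : closed_subalg setT. Proof. by []. Qed.

Lemma commutant_closed a : closed_subalg [set b | a * b = b * a].
Proof.
split=> /=; first by rewrite mulr1 mul1r.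
- by move=> c b b' h h'; rewrite mulrDr mulrDl -scalerAr -scalerAl h h'.
- by move=> b b' h h'; rewrite mulrA h -mulrA h' mulrA.
- move=> u l h hl; apply: (@ccvg_unique (fun n => a * u n)).
    exact: (ccvgM (ccvg_cst _) hl).
  have -> : (fun n => a * u n) = (fun n => u n * a) by apply/funext.
  exact: (ccvgM hl (ccvg_cst _)).
Qed.

End CStarBasics.

(** * Square root of [1 - h] by iteration *)

Section SquareRoot.
Variables (R : realType) (A : cstarAlgType R) (h : A).

Fixpoint sqrt_iter (n : nat) : A :=
  if n is m.+1 then (2^-1 : R)%:C *: (h + sqrt_iter m * sqrt_iter m) else 0.

Fixpoint sqrt_majorant (n : nat) : R :=
  if n is m.+1 then (1 + sqrt_majorant m ^+ 2) / 2 else 0.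

Local Notation y := sqrt_iter.
Local Notation t := sqrt_majorant.

Let t01 n : 0 <= t n <= 1.
Proof. by elim: n => [|n /andP[h0 h1]] /=; [lra | nra]. Qed.

Let tS n : t n <= t n.+1.
Proof. by have := sqr_ge0 (1 - t n); rewrite /=; nra. Qed.

Let t_cvg : cvgn t.
Proof.
apply: nondecreasing_is_cvgn; first by apply/nondecreasing_seqP.
by exists 1 => _ [n _ <-]; case/andP: (t01 n).
Qed.

Hypothesis h1 : cnorm h <= 1.

Let y_norm n : cnorm (y n) <= t n.
Proof.
elim: n => [|n ih] /=; first by rewrite cnorm0.
rewrite cnormZr ger0_norm; last lra.
have : cnorm (y n * y n) <= t n ^+ 2.
  by apply: (le_trans (ler_cnormM _ _)); rewrite expr2; apply: ler_pM; rewrite ?cnorm_ge0.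
have := ler_cnormD h (y n * y n); move: h1; lra.
Qed.

Let y_step n : cnorm (y n.+1 - y n) <= t n.+1 - t n.
Proof.
elim: n => [|n ih].
  by rewrite /= subr0 mulr0 addr0 cnormZr ger0_norm; move: h1; lra.
rewrite -[y n.+2]/((2^-1 : R)%:C *: (h + y n.+1 * y n.+1)).
rewrite -[y n.+1 in X in _ - X]/((2^-1 : R)%:C *: (h + y n * y n)).
rewrite -scalerBr cnormZr ger0_norm; last lra.
(* A difference of squares without commutation; for scalar bounds [c], [d] of the two iterates its
   norm is at most [(c + d) (c - d)], the increment of the majorant up to the factor 1/2. *)
have -> : h + y n.+1 * y n.+1 - (h + y n * y n) =
          y n.+1 * (y n.+1 - y n) + (y n.+1 - y n) * y n.
  by rewrite opprD addrACA subrr add0r mulrBr mulrBl addrA subrK.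
rewrite -[t n.+2]/((1 + t n.+1 ^+ 2) / 2).
have tn : t n.+1 = (1 + t n ^+ 2) / 2 by [].
have := ler_cnormD (y n.+1 * (y n.+1 - y n)) ((y n.+1 - y n) * y n).
have := ler_cnormM (y n.+1) (y n.+1 - y n); have := ler_cnormM (y n.+1 - y n) (y n).
have := y_norm n.+1; have := y_norm n; have := cnorm_ge0 (y n); have := cnorm_ge0 (y n.+1).
have := cnorm_ge0 (y n.+1 - y n).
move: (cnorm (_ * (_ - _))) (cnorm ((_ - _) * _)) (cnorm (_ + _)) (cnorm (_ - _)) ih tn.
move: (cnorm _) (cnorm _) (t n.+1) (t n) => a b c d e f g k cdk tn.
move=> k0 b0 a0 ad bc hf he hg.
have : e <= c * (c - d) by apply: (le_trans he); apply: ler_pM.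
have : f <= (c - d) * d by apply: (le_trans hf); apply: ler_pM.
rewrite mulrBr mulrBl -!expr2; lra.
Qed.

Let y_cauchy m n : (m <= n)%N -> cnorm (y n - y m) <= t n - t m.
Proof.
move=> /subnK <-; elim: (n - m)%N => [|k ih]; first by rewrite !subrr cnorm0.
rewrite addSn -[y _.+1](subrK (y (k + m)%N)) -addrA.
apply: (le_trans (ler_cnormD _ _)).
have := y_step (k + m); lra.
Qed.

(* The iteration y := (h + y^2)/2 solves (1 - y)^2 = 1 - h; its increments are
   dominated by those of the scalar iteration for h = 1. *)
Lemma sqrt_one_sub (S : set A) : closed_subalg S -> S h -> star h = h ->
  exists k, [/\ S k, star k = k, cnorm (1 - k) <= 1 & 1 - h = k * k].
Proof.
move=> hS Sh sh.
have S0 : S 0 by have := csub_lin hS (-1) (csub1 hS) (csub1 hS); rewrite scaleN1r addNr.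
have [l hl] := ccvg_cauchy y_cauchy t_cvg.
have Sy n : S (y n).
  elim: n => [//|n ih] /=; rewrite -[X in S X]addr0; apply: (csub_lin hS) => //.
  by rewrite -[h]scale1r; apply: (csub_lin hS) => //; exact: (csubM hS).
have sy n : star (y n) = y n.
  by elim: n => [|n ih] /=; rewrite ?star0 // starZr starD starM ih sh.
have El : l = (2^-1 : R)%:C *: (h + l * l).
  apply: (ccvg_unique (ccvgS hl)).
  by apply: ccvgZ; apply: ccvgD; [exact: ccvg_cst | exact: ccvgM].
have sl : star l = l.
  apply: (@ccvg_unique _ _ (fun n => star (y n))); first exact: ccvg_star.
  by rewrite (_ : (fun _ => _) = y) //; apply/funext.
exists (1 - l); split.
- by rewrite addrC -scaleN1r; apply: (csub_lin hS) (csub1 hS); exact: (csub_lim hS _ hl).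
- by rewrite starB star1 sl.
- rewrite opprB addrC subrK; apply: (ccvg_bound hl) => n.
  by apply: (le_trans (y_norm n)); case/andP: (t01 n).
- have : l + l = h + l * l.
    rewrite {1 2}El -scalerDl -rmorphD.
    by rewrite (_ : 2^-1 + 2^-1 = 1 :> R) ?scale1r //; lra.
  move=> e; have -> : h = l + (l - l * l) by rewrite addrA e addrK.
  by rewrite mulrBl mul1r mulrBr mulr1 opprD addrA.
Qed.

End SquareRoot.

(** * Pre-Hilbert spaces and representations *)

(** Neither definite nor complete, so that Hilbert spaces, the trace space of a finite-dimensional
    algebra and finite powers of these are treated alike. *)
Record preHilbert (R : realType) := PreHilbert {
  ph_sort :> lmodType R[i];
  ip : ph_sort -> ph_sort -> R[i];
  ip_lin : forall (c : R[i]) u v w, ip (c *: u + v) w = c * ip u w + ip v w;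
  ipC : forall u v, ip v u = Num.conj (ip u v);
  ip_ge0 : forall u, 0 <= ip u u
}.
Arguments ip {R p}.

Lemma Re_conj (R : realType) (z : R[i]) : complex.Re (Num.conj z) = complex.Re z.
Proof. by case: z => a b; rewrite -[Num.conj _]/(conjc _). Qed.

Lemma ReD (R : realType) (z w : R[i]) : complex.Re (z + w) = complex.Re z + complex.Re w.
Proof. by case: z w => a b [c e]. Qed.

Lemma ReMr (R : realType) (r : R) (z : R[i]) : complex.Re (r%:C * z) = r * complex.Re z.
Proof. by case: z => a b /=; rewrite mul0r subr0. Qed.

Lemma Re_ge0 (R : realType) (z : R[i]) : 0 <= z -> 0 <= complex.Re z.
Proof. by rewrite lecE => /andP[]. Qed.

Lemma Re_sum (R : realType) (I : Type) (r : seq I) (P : pred I) (F : I -> R[i]) :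
  complex.Re (\sum_(i <- r | P i) F i) = \sum_(i <- r | P i) complex.Re (F i).
Proof. exact: (big_morph _ (@ReD R) erefl). Qed.

Lemma real_of_Re (R : realType) (z : R[i]) : 0 <= z -> z = (complex.Re z)%:C.
Proof. by case: z => a b; rewrite lecE => /andP[/eqP/= -> _]. Qed.

Lemma ge0_ReE (R : realType) (z : R[i]) : Num.conj z = z -> (0 <= z) = (0 <= complex.Re z).
Proof.
case: z => a b; rewrite -[Num.conj _]/(conjc _) => -[e].
rewrite lecE /= eq_sym; suff -> : b = 0 by rewrite eqxx.
by lra.
Qed.

Section PreHilbertTheory.
Variables (R : realType) (V : preHilbert R).
Implicit Types u v w : V.

Definition rip u v : R := complex.Re (ip u v).
Definition hq u : R := rip u u.
Definition hn u : R := Num.sqrt (hq u).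

Lemma ipDl u v w : ip (u + v) w = ip u w + ip v w.
Proof. by rewrite -[u]scale1r ip_lin mul1r scale1r. Qed.

Lemma ip0l w : ip 0 w = 0.
Proof. by apply: (addrI (ip 0 w)); rewrite -ipDl !addr0. Qed.

Lemma ipZl c u w : ip (c *: u) w = c * ip u w.
Proof. by rewrite -[c *: u]addr0 ip_lin ip0l addr0. Qed.

Lemma ipDr u v w : ip u (v + w) = ip u v + ip u w.
Proof. by rewrite (ipC (v + w)) ipDl rmorphD (ipC v) (ipC w). Qed.

Lemma ipZr c u w : ip u (c *: w) = Num.conj c * ip u w.
Proof. by rewrite (ipC (c *: w)) ipZl rmorphM (ipC w). Qed.

Lemma ip0r w : ip w 0 = 0. Proof. by rewrite ipC ip0l rmorph0. Qed.

Lemma ip_suml (I : Type) (r : seq I) (P : pred I) (F : I -> V) w :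
  ip (\sum_(i <- r | P i) F i) w = \sum_(i <- r | P i) ip (F i) w.
Proof. by apply: (big_morph (fun x => ip x w)) => [x y|]; rewrite ?ipDl ?ip0l. Qed.

Lemma ip_sumr (I : Type) (r : seq I) (P : pred I) (F : I -> V) w :
  ip w (\sum_(i <- r | P i) F i) = \sum_(i <- r | P i) ip w (F i).
Proof. by apply: (big_morph (fun x => ip w x)) => [x y|]; rewrite ?ipDr ?ip0r. Qed.

Lemma ripC u v : rip u v = rip v u.
Proof. by rewrite /rip ipC Re_conj. Qed.

Lemma ripDl u v w : rip (u + v) w = rip u w + rip v w.
Proof. by rewrite /rip ipDl ReD. Qed.

Lemma ripDr u v w : rip u (v + w) = rip u v + rip u w.
Proof. by rewrite /rip ipDr ReD. Qed.

Lemma ripZl (r : R) u v : rip (r%:C *: u) v = r * rip u v.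
Proof. by rewrite /rip ipZl ReMr. Qed.

Lemma ripZr (r : R) u v : rip u (r%:C *: v) = r * rip u v.
Proof. by rewrite ripC ripZl ripC. Qed.

Lemma ripNl u v : rip (- u) v = - rip u v.
Proof. by rewrite -[- u]scaleN1r -[-1](rmorphN1 (real_complex R)) ripZl mulN1r. Qed.

Lemma ripNr u v : rip u (- v) = - rip u v.
Proof. by rewrite ripC ripNl ripC. Qed.

Lemma rip_suml (I : Type) (r : seq I) (P : pred I) (F : I -> V) w :
  rip (\sum_(i <- r | P i) F i) w = \sum_(i <- r | P i) rip (F i) w.
Proof. by rewrite /rip ip_suml Re_sum. Qed.

Lemma rip_sumr (I : Type) (r : seq I) (P : pred I) (F : I -> V) w :
  rip w (\sum_(i <- r | P i) F i) = \sum_(i <- r | P i) rip w (F i).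
Proof. by rewrite /rip ip_sumr Re_sum. Qed.

Lemma ipE u : ip u u = (hq u)%:C.
Proof. exact/real_of_Re/ip_ge0. Qed.

Lemma hq_ge0 u : 0 <= hq u. Proof. exact/Re_ge0/ip_ge0. Qed.

Lemma hn_ge0 u : 0 <= hn u. Proof. exact: sqrtr_ge0. Qed.

Lemma hn2 u : hn u ^+ 2 = hq u. Proof. by rewrite sqr_sqrtr // hq_ge0. Qed.

Lemma hn0 : hn 0 = 0. Proof. by rewrite /hn /hq /rip ip0l sqrtr0. Qed.

Lemma hqD u v : hq (u + v) = hq u + 2 * rip u v + hq v.
Proof. rewrite /hq ripDl !ripDr (ripC v u); lra. Qed.

Lemma hqN u : hq (- u) = hq u. Proof. by rewrite /hq ripNl ripNr opprK. Qed.

Lemma hqB u v : hq (u - v) = hq u - 2 * rip u v + hq v.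
Proof. rewrite hqD hqN ripNr; lra. Qed.

Lemma hqZr (r : R) u : hq (r%:C *: u) = r ^+ 2 * hq u.
Proof. by rewrite /hq ripZl ripZr mulrA. Qed.

Lemma hqZ c u : (hq (c *: u))%:C = `|c| ^+ 2 * (hq u)%:C.
Proof. by rewrite -!ipE ipZl ipZr mulrA normCK. Qed.

Lemma hnC2 u : (hn u)%:C ^+ 2 = (hq u)%:C.
Proof. by rewrite -hn2 rmorphXn. Qed.

Lemma hnZ c u : (hn (c *: u))%:C = `|c| * (hn u)%:C.
Proof.
apply/eqP; rewrite -(@eqrXn2 _ 2) // ?mulr_ge0 // ?ler0c ?hn_ge0 //.
  by rewrite exprMn !hnC2 hqZ.
Qed.

Lemma hnN u : hn (- u) = hn u. Proof. by rewrite /hn hqN. Qed.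

Lemma rip_le u v : rip u v <= hn u * hn v.
Proof.
have H x y : 0 <= x ^+ 2 * hq u + y ^+ 2 * hq v - 2 * x * y * rip u v.
  have := hq_ge0 (x%:C *: u - y%:C *: v).
  by rewrite hqB !hqZr ripZl ripZr; lra.
have [u0|u0] := eqVneq (hn u) 0.
  rewrite u0 mul0r leNgt; apply/negP => p.
  (* With [hn u = 0] the term in [x ^+ 2] vanishes, and this [x] makes the linear term exceed [hq v]
     by 1, a contradiction. The case [hn v = 0] is symmetric. *)
  have := H ((hq v + 1) / (2 * rip u v)) 1; rewrite -(hn2 u) u0.
  have -> : 2 * ((hq v + 1) / (2 * rip u v)) * 1 * rip u v = hq v + 1.
    by field; rewrite gt_eqF.
  by rewrite expr0n /=; lra.
have [v0|v0] := eqVneq (hn v) 0.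
  rewrite v0 mulr0 leNgt; apply/negP => p.
  have := H 1 ((hq u + 1) / (2 * rip u v)); rewrite -(hn2 v) v0.
  have -> : 2 * 1 * ((hq u + 1) / (2 * rip u v)) * rip u v = hq u + 1.
    by field; rewrite gt_eqF.
  by rewrite expr0n /=; lra.
have up : 0 < hn u by rewrite lt_def u0 hn_ge0.
have vp : 0 < hn v by rewrite lt_def v0 hn_ge0.
have := H (hn v) (hn u); rewrite -!hn2 => h.
have : 0 <= 2 * (hn u * hn v) * (hn u * hn v - rip u v).
  by rewrite (le_trans h) // le_eqVlt; apply/orP; left; apply/eqP; ring.
by rewrite pmulr_rge0 ?mulr_gt0 // subr_ge0.
Qed.

Lemma hnD u v : hn (u + v) <= hn u + hn v.
Proof.
rewrite -(@ler_pXn2r _ 2) ?nnegrE ?addr_ge0 ?hn_ge0 // hn2 hqD -!hn2.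
have := rip_le u v; nra.
Qed.

Lemma hn_sum (I : Type) (r : seq I) (P : pred I) (F : I -> V) :
  hn (\sum_(i <- r | P i) F i) <= \sum_(i <- r | P i) hn (F i).
Proof.
elim/big_rec2: _ => [|i y x _ h]; first by rewrite hn0.
by apply: (le_trans (hnD _ _)); rewrite lerD2l.
Qed.

Lemma hn_le_dual u (c : R) : 0 <= c -> (forall v, rip u v <= c * hn v) -> hn u <= c.
Proof.
move=> c0 /(_ u); rewrite -/(hq u) -hn2 expr2.
have := hn_ge0 u; rewrite le_eqVlt => /predU1P[<- //|u0].
by rewrite ler_pM2r.
Qed.

Lemma hn_le_sq u (c : R) : 0 <= c -> hq u <= c ^+ 2 -> hn u <= c.
Proof. by move=> c0 h; rewrite -(ger0_norm c0) -sqrtr_sqr ler_wsqrtr. Qed.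

Definition obound (T : V -> V) (s : R) : Prop := forall u, hn (T u) <= s * hn u.

Definition onorm (T : V -> V) : R := inf [set s | 0 <= s /\ obound T s].

Lemma onorm_ge0 T s : 0 <= s -> obound T s -> 0 <= onorm T.
Proof. by move=> s0 h; apply: lb_le_inf; [exists s | move=> x []]. Qed.

Lemma onorm_le T s : 0 <= s -> obound T s -> onorm T <= s.
Proof. by move=> s0 h; apply: ge_inf; [exists 0 => x [] | split]. Qed.

Lemma onorm_bound T s : 0 <= s -> obound T s -> obound T (onorm T).
Proof.
move=> s0 h u; have := hn_ge0 u; rewrite le_eqVlt => /predU1P[u0|u0].
  by rewrite -u0 mulr0; have := h u; rewrite -u0 mulr0.
rewrite -ler_pdivrMr //; apply: lb_le_inf; first by exists s.
by move=> x [x0 hx]; rewrite ler_pdivrMr.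
Qed.

End PreHilbertTheory.

Section Power.
Variables (R : realType) (V : preHilbert R) (m : nat).

Definition ph_pow_ip (f g : {ffun 'I_m -> V}) : R[i] := \sum_i ip (f i) (g i).

Fact ph_pow_lin c u v w : ph_pow_ip (c *: u + v) w = c * ph_pow_ip u w + ph_pow_ip v w.
Proof.
rewrite /ph_pow_ip big_distrr -big_split; apply: eq_bigr => i _ /=.
by rewrite !ffunE ip_lin.
Qed.

Fact ph_powC u v : ph_pow_ip v u = Num.conj (ph_pow_ip u v).
Proof. by rewrite /ph_pow_ip rmorph_sum; apply: eq_bigr => i _; exact: ipC. Qed.

Fact ph_pow_ge0 u : 0 <= ph_pow_ip u u.
Proof. by apply: sumr_ge0 => i _; exact: ip_ge0. Qed.

Definition ph_pow : preHilbert R := PreHilbert ph_pow_lin ph_powC ph_pow_ge0.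

Lemma rip_pow (u v : ph_pow) : rip u v = \sum_i rip (u i) (v i).
Proof. by rewrite /rip Re_sum. Qed.

Lemma hq_pow (u : ph_pow) : hq u = \sum_i hq (u i).
Proof. exact: rip_pow. Qed.

Lemma hn_pow_coord (u : ph_pow) i : hn (u i) <= hn u.
Proof.
rewrite ler_wsqrtr // hq_pow (bigD1 i) //= lerDl sumr_ge0 // => j _.
exact: hq_ge0.
Qed.

Lemma hn_pow_le (u : ph_pow) : hn u <= \sum_i hn (u i).
Proof.
have s0 : 0 <= \sum_i hn (u i) by rewrite sumr_ge0 // => i _; exact: hn_ge0.
rewrite -(@ler_pXn2r _ 2) ?nnegrE ?hn_ge0 // hn2 hq_pow expr2 mulr_suml.
apply: ler_sum => i _; rewrite -hn2 expr2 ler_wpM2l ?hn_ge0 //.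
by rewrite (bigD1 i) //= lerDl sumr_ge0 // => j _; exact: hn_ge0.
Qed.

Definition ph_single (i : 'I_m) (v : V) : ph_pow :=
  [ffun j => if j == i then v else 0].

Lemma hn_single i v : hn (ph_single i v) = hn v.
Proof.
rewrite /hn hq_pow (bigD1 i) //= big1 => [|j ji]; first by rewrite ffunE eqxx addr0.
by rewrite ffunE (negPf ji) /hq /rip ip0l.
Qed.

End Power.

(** Boundedness is not a field: [crep_contr] derives it. Injectivity is understood modulo vectors of
    seminorm 0, as the form may be degenerate. *)
Record crep (R : realType) (A : cstarAlgType R) (V : preHilbert R) := CRep {
  crep_fun :> A -> V -> V;
  crep_linl : forall c a b u, crep_fun (c *: a + b) u = c *: crep_fun a u + crep_fun b u;
  crep_linr : forall a c u v, crep_fun a (c *: u + v) = c *: crep_fun a u + crep_fun a v;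
  crepM : forall a b u, crep_fun (a * b) u = crep_fun a (crep_fun b u);
  crep_adj : forall a u v, ip (crep_fun a u) v = ip u (crep_fun (star a) v);
  crep_inj : forall a, (forall u, hq (crep_fun a u) = 0) -> a = 0 }.

Section CRepTheory.
Variables (R : realType) (A : cstarAlgType R) (V : preHilbert R) (r : crep A V).
Implicit Types (a b : A) (u v : V).

Lemma crepDl a b u : r (a + b) u = r a u + r b u.
Proof. by rewrite -[a]scale1r crep_linl !scale1r. Qed.

Lemma crep0l u : r 0 u = 0.
Proof. by apply: (addrI (r 0 u)); rewrite -crepDl !addr0. Qed.

Lemma crepZl c a u : r (c *: a) u = c *: r a u.
Proof. by rewrite -[c *: a]addr0 crep_linl crep0l addr0. Qed.

Lemma crepNl a u : r (- a) u = - r a u.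
Proof. by apply: (addrI (r a u)); rewrite -crepDl !subrr crep0l. Qed.

Lemma crepBl a b u : r (a - b) u = r a u - r b u.
Proof. by rewrite crepDl crepNl. Qed.

Lemma crepDr a u v : r a (u + v) = r a u + r a v.
Proof. by rewrite -[u]scale1r crep_linr !scale1r. Qed.

Lemma crep0r a : r a 0 = 0.
Proof. by apply: (addrI (r a 0)); rewrite -crepDr !addr0. Qed.

Lemma crepZr c a u : r a (c *: u) = c *: r a u.
Proof. by rewrite -[c *: u]addr0 crep_linr crep0r addr0. Qed.

Lemma crepNr a u : r a (- u) = - r a u.
Proof. by rewrite -scaleN1r crepZr scaleN1r. Qed.

Lemma crep_suml (I : Type) (s : seq I) (P : pred I) (F : I -> A) u :
  r (\sum_(i <- s | P i) F i) u = \sum_(i <- s | P i) r (F i) u.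
Proof. by apply: (big_morph (fun x => r x u)) => [x y|]; rewrite ?crepDl ?crep0l. Qed.

Lemma crep_sumr (I : Type) (s : seq I) (P : pred I) a (F : I -> V) :
  r a (\sum_(i <- s | P i) F i) = \sum_(i <- s | P i) r a (F i).
Proof. by apply: (big_morph (r a)) => [x y|]; rewrite ?crepDr ?crep0r. Qed.

Lemma crep_rip a u v : rip (r a u) v = rip u (r (star a) v).
Proof. by rewrite /rip crep_adj. Qed.

Lemma crep_rip_star a u v : rip (r (star a) u) v = rip u (r a v).
Proof. by rewrite crep_rip starK. Qed.

Lemma crep_hq a u : hq (r a u) = rip (r (star a * a) u) u.
Proof. by rewrite crepM crep_rip_star. Qed.

(* [r 1] is only a projection: representations may be degenerate. *)
Lemma crep_1rip u : rip (r 1 u) u = hq (r 1 u).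
Proof. by rewrite crep_hq star1 mulr1. Qed.

Lemma crep_1le u : hq (r 1 u) <= hq u.
Proof. have := hq_ge0 (u - r 1 u); rewrite hqB ripC crep_1rip; lra. Qed.

(** For [s = cnorm a] the element [1 - s^-2 a^* a] is a square [k k] with [k] self-adjoint, and the
    claim is [hq (r k u) >= 0] written out. *)
Lemma crep_contr a : obound (r a) (cnorm a).
Proof.
move=> u; have := cnorm_ge0 a; rewrite le_eqVlt => /predU1P[a0|a0].
  by rewrite (cnorm_eq0 _ (esym a0)) crep0l hn0 cnorm0 mul0r.
set s := cnorm a in a0 *.
have h1 : cnorm ((s ^- 2)%:C *: (star a * a)) <= 1.
  rewrite cnormZr cnorm_starM -/s ger0_norm ?invr_ge0 ?sqr_ge0 //.
  by rewrite mulVf // expf_neq0 // gt_eqF.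
have [|k [_ sk _ e]] := sqrt_one_sub h1 (@closed_subalgT _ _) I.
  by rewrite starZr starM starK.
rewrite -(@ler_pXn2r _ 2) ?nnegrE ?mulr_ge0 ?hn_ge0 ?(ltW a0) // exprMn !hn2.
have := hq_ge0 (r k u); rewrite crep_hq sk -e crepBl crepZl ripDl ripNl ripZl.
rewrite crep_1rip -crep_hq subr_ge0 => h.
rewrite mulrC -ler_pdivrMr ?exprn_gt0 // mulrC.
exact: le_trans h (crep_1le u).
Qed.

End CRepTheory.

(** The commuting elements [a] and [b] are the real and imaginary parts of [u = a + i b], and
    [u^* u = a^2 + b^2] gives [cnorm u = t]. *)
Lemma cnorm_sum_squares (R : realType) (A : cstarAlgType R) (a b : A) (t : R) :
  star a = a -> star b = b -> a * b = b * a -> 0 <= t ->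
  a * a + b * b = (t ^+ 2)%:C *: 1 -> cnorm a <= t /\ cnorm b <= t.
Proof.
move=> sa sb ab t0 e; pose u : A := a + 'i%R *: b.
have su : star u = a - 'i%R *: b by rewrite starD starZ sa sb conjCi scaleNr.
have nu : cnorm u = t.
  apply/eqP; rewrite -(@eqrXn2 _ 2) ?cnorm_ge0 // -cnorm_starM su /u.
  rewrite mulrBl !mulrDr -!scalerAl -!scalerAr scalerA -(expr2 'i%R) sqrCi scaleN1r ab opprD opprK.
  by rewrite addrA addrK e cnormZr cnorm1 mulr1 ger0_norm ?sqr_ge0.
have h1 : (2 : R)%:C *: a = u + star u.
  by rewrite su /u addrACA subrr addr0 rmorph_nat scaler_nat mulr2n.
have h2 : ((2 : R)%:C * 'i%R) *: b = u - star u.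
  by rewrite su /u opprB (addrC a) addrACA subrr addr0 -scalerA rmorph_nat scaler_nat mulr2n.
have := ler_cnormD u (star u); have := ler_cnormD u (- star u).
rewrite -h1 -h2 cnormN cnorm_star nu -scalerA !cnormZr cnormZ1 ?normCi //.
rewrite ger0_norm //; lra.
Qed.

(** The root [l] of [1 - k k] is found in the commutant of [k], so [k k + l l = 1] puts [l] under
    [cnorm_sum_squares]. Positivity of [k k] thus enters without spectral theory. *)
Lemma cnorm_one_sub_square (R : realType) (A : cstarAlgType R) (k : A) :
  star k = k -> cnorm k <= 1 -> cnorm (1 - k * k) <= 1.
Proof.
move=> sk k1.
have kk1 : cnorm (k * k) <= 1.
  by rewrite -{1}sk cnorm_starM expr_le1 ?cnorm_ge0.
have [//||l [kl sl _ e]] := sqrt_one_sub kk1 (commutant_closed k); first by rewrite /= mulrA.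
  by rewrite starM sk.
have [_ l1] : cnorm k <= 1 /\ cnorm l <= 1.
  by apply: cnorm_sum_squares => //; rewrite -e addrC subrK expr1n scale1r.
by rewrite e -{1}sl cnorm_starM expr_le1 ?cnorm_ge0.
Qed.

(** * Injective representations are isometric *)

Section Isometry.
Variables (R : realType) (A : cstarAlgType R) (V : preHilbert R) (r : crep A V).

(* With k = (a^2 - c^2)/s nonpositive in the representation, m = |k| satisfies
   m = - k already in A, so that a^2 + s m = c^2 in A. *)
Lemma crep_iso_sa (a : A) (c : R) : star a = a -> 0 <= c -> obound (r a) c -> cnorm a <= c.
Proof.
move=> sa c0 hc; pose k0 := a * a - (c ^+ 2)%:C *: 1.
pose s := cnorm k0 + 1; have s0 : 0 < s by rewrite /s; have := cnorm_ge0 k0; lra.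
pose k := (s^-1)%:C *: k0.
have hS := commutant_closed a; set S := [set _ | _] in hS.
have comk b : a * b = b * a -> k * b = b * k.
  move=> ab; rewrite /k /k0 -scalerAl -scalerAr mulrBl mulrBr -scalerAl -scalerAr mul1r mulr1.
  by rewrite -mulrA ab mulrA ab mulrA.
have sk0 : star k0 = k0 by rewrite /k0 starB starM sa starZr star1.
have sk : star k = k by rewrite /k starZr sk0.
have k1 : cnorm k <= 1.
  by rewrite cnormZr ger0_norm ?invr_ge0 ?(ltW s0) // ler_pdivrMl // mulr1 /s lerDl.
have ak : a * k = k * a by rewrite [RHS]comk.
(* This bound allows a root [m] of [k k = 1 - (1 - k k)] in the commutant of [a]; [m] acts as the
   absolute value of [k]. *)
have h1 := cnorm_one_sub_square sk k1.
have [||m [am sm m1 em]] := sqrt_one_sub h1 hS; rewrite /S /=.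
- by rewrite mulrBl mulrBr mulr1 mul1r mulrA ak -mulrA ak mulrA.
- by rewrite starB star1 starM sk.
have {}em : k * k = m * m by rewrite -em opprB addrC subrK.
(* The bound on [1 - m] supplied with the first root permits a second one: [m = n n], so [m] is
   positive in the representation. *)
have [||n [an sn _ en]] := sqrt_one_sub m1 hS; rewrite /S /=.
- by rewrite mulrBl mulrBr mulr1 mul1r am.
- by rewrite starB star1 sm.
have {}en : m = n * n by rewrite -en opprB addrC subrK.
have km := comk _ am.
(* Since [m m = k k] and [m], [k] commute, [m - k] vanishes on every [w] in the range of [m + k].
   There the forms of [m] (nonnegative) and of [k] (nonpositive by [hc]) agree, so both are 0 and
   [n] kills [w]. *)
have nd : n * (m + k) = 0.
  apply: (@crep_inj _ _ _ r) => u; rewrite crepM; set w := r (m + k) u.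
  have h2 : rip (r (m - k) w) w = 0.
    rewrite /w -crepM mulrDr !mulrBl em km addrA subrK subrr.
    by rewrite crep0l /rip ip0l.
  have h3 : rip (r m w) w = hq (r n w) by rewrite crep_hq sn -en.
  have h4 : rip (r k w) w <= 0.
    rewrite /k crepZl ripZl pmulr_rle0 ?invr_gt0 // crepBl ripDl ripNl crepZl ripZl.
    rewrite crep_1rip -{1}sa -crep_hq subr_le0 -!hn2 -exprMn.
    rewrite ler_pXn2r ?nnegrE ?mulr_ge0 ?hn_ge0 //.
    by rewrite -{1}[a]mulr1 crepM; exact: hc.
  move: h2; rewrite crepBl ripDl ripNl h3; have := hq_ge0 (r n w); lra.
have md : m * (m + k) = 0 by rewrite {1}en -mulrA nd mulr0.
have dd : (m + k) * (m + k) = 0.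
  by rewrite mulrDl md add0r mulrDr km em -mulrDr addrC md.
have d0 : m + k = 0.
  apply/cnorm_eq0/eqP; rewrite -sqrf_eq0 -cnorm_starM starD sm sk dd.
  by rewrite cnorm0.
have sn' : star ((Num.sqrt s)%:C *: n) = (Num.sqrt s)%:C *: n by rewrite starZr sn.
have [] // := cnorm_sum_squares sa sn' _ c0.
  by rewrite -scalerAr an scalerAl.
rewrite -scalerAl -scalerAr scalerA -rmorphM -(expr2 (Num.sqrt s)) sqr_sqrtr ?(ltW s0) // -en.
move/eqP: d0; rewrite addr_eq0 => /eqP ->.
rewrite /k scalerN scalerA -rmorphM mulfV ?gt_eqF // scale1r /k0.
by rewrite opprB addrC subrK.
Qed.

(** The C*-identity passes to the self-adjoint [star a * a], for which the bound on [star a] is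
    obtained by duality. With [crep_contr] this makes [r] isometric. *)
Lemma crep_iso (a : A) (c : R) : 0 <= c -> obound (r a) c -> cnorm a <= c.
Proof.
move=> c0 hc.
rewrite -(@ler_pXn2r _ 2) ?nnegrE ?cnorm_ge0 // -cnorm_starM.
apply: crep_iso_sa; rewrite ?sqr_ge0 ?starM ?starK // => u.
suff H v : hn (r (star a) v) <= c * hn v.
  rewrite crepM; apply: (le_trans (H _)).
  by rewrite expr2 -mulrA ler_wpM2l.
apply: hn_le_dual; first by rewrite mulr_ge0 ?hn_ge0.
move=> w; rewrite crep_rip_star; apply: (le_trans (rip_le _ _)).
by rewrite [_ * hn v]mulrC -mulrA ler_wpM2l ?hn_ge0.
Qed.

End Isometry.

(** * Matrix algebras over a C*-algebra *)

Lemma cvgr_sum (R : realType) (I : Type) (s : seq I) (u : I -> nat -> R) (l : I -> R) :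
  (forall i, u i @ \oo --> l i) ->
  (fun n => \sum_(i <- s) u i n) @ \oo --> \sum_(i <- s) l i.
Proof.
move=> h; elim: s => [|i s ih].
  by rewrite big_nil; under eq_fun do rewrite big_nil; exact: cvg_cst.
by rewrite big_cons; under eq_fun do rewrite big_cons; apply: cvgD.
Qed.

(* The alias carries an algebra structure over R[i], where 'M[A] only has one over A;
   r selects the norm, namely the operator norm on V^(m+1). *)
Definition mxalg (R : realType) (A : cstarAlgType R) (V : preHilbert R)
  (r : crep A V) (m : nat) : Type := 'M[A]_m.+1.

Section MxAlgRing.
Variables (R : realType) (A : cstarAlgType R) (V : preHilbert R) (r : crep A V) (m : nat).
Local Notation M := (mxalg r m).

HB.instance Definition _ := GRing.NzRing.copy M 'M[A]_m.+1.

Definition mxalg_scale (c : R[i]) (X : M) : M := \matrix_(i, j) (c *: (X : 'M[A]_m.+1) i j).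

Fact mxalg_scalerA a b (X : M) : mxalg_scale a (mxalg_scale b X) = mxalg_scale (a * b) X.
Proof. by apply/matrixP => i j; rewrite !mxE scalerA. Qed.
Fact mxalg_scale1r : left_id 1 mxalg_scale.
Proof. by move=> X; apply/matrixP => i j; rewrite !mxE scale1r. Qed.
Fact mxalg_scalerDr : right_distributive mxalg_scale +%R.
Proof. by move=> a X Y; apply/matrixP => i j; rewrite !mxE scalerDr. Qed.
Fact mxalg_scalerDl (X : M) : {morph mxalg_scale^~ X : a b / a + b}.
Proof. by move=> a b; apply/matrixP => i j; rewrite !mxE scalerDl. Qed.

HB.instance Definition _ := GRing.Zmodule_isLmodule.Build R[i] M
  mxalg_scalerA mxalg_scale1r mxalg_scalerDr mxalg_scalerDl.

Fact mxalg_scalerAl (a : R[i]) (X Y : M) : a *: (X * Y) = (a *: X) * Y.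
Proof.
apply/matrixP => i j; rewrite !mxE scaler_sumr; apply: eq_bigr => k _.
by rewrite !mxE scalerAl.
Qed.

HB.instance Definition _ := GRing.Lmodule_isLalgebra.Build R[i] M mxalg_scalerAl.

Fact mxalg_scalerAr (a : R[i]) (X Y : M) : a *: (X * Y) = X * (a *: Y).
Proof.
apply/matrixP => i j; rewrite !mxE scaler_sumr; apply: eq_bigr => k _.
by rewrite !mxE scalerAr.
Qed.

HB.instance Definition _ := GRing.Lalgebra_isAlgebra.Build R[i] M mxalg_scalerAr.

Implicit Types (X Y : 'M[A]_m.+1) (f g : ph_pow V m.+1).

Lemma mxalg_scaleE (c : R[i]) (X : M) i j : (c *: X : M) i j = c *: X i j.
Proof. by rewrite mxE. Qed.

Definition mxrep_fun X f : ph_pow V m.+1 := [ffun i => \sum_j r (X i j) (f j)].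

Lemma mxrep_linl c (X Y : M) f :
  mxrep_fun (c *: X + Y) f = c *: mxrep_fun X f + mxrep_fun Y f.
Proof.
apply/ffunP => i; rewrite !ffunE scaler_sumr -big_split; apply: eq_bigr => j _.
by rewrite mxE mxalg_scaleE crep_linl.
Qed.

Lemma mxrep_linr X c f g : mxrep_fun X (c *: f + g) = c *: mxrep_fun X f + mxrep_fun X g.
Proof.
apply/ffunP => i; rewrite !ffunE scaler_sumr -big_split; apply: eq_bigr => j _.
by rewrite !ffunE crep_linr.
Qed.

Lemma mxrepM X Y f : mxrep_fun (X *m Y) f = mxrep_fun X (mxrep_fun Y f).
Proof.
apply/ffunP => i; rewrite !ffunE.
under eq_bigr do rewrite mxE crep_suml.
rewrite exchange_big; apply: eq_bigr => j _; rewrite !ffunE crep_sumr.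
by apply: eq_bigr => k _; rewrite crepM.
Qed.

Lemma mxrep_adj X f g : ip (mxrep_fun X f) g = ip f (mxrep_fun (star_mx X) g).
Proof.
rewrite /= /ph_pow_ip; under eq_bigr do rewrite ffunE ip_suml.
under [RHS]eq_bigr do rewrite ffunE ip_sumr.
rewrite exchange_big; apply: eq_bigr => j _; apply: eq_bigr => i _.
by rewrite mxE crep_adj.
Qed.

Lemma mxrep_single X i j v : mxrep_fun X (ph_single j v) i = r (X i j) v.
Proof.
rewrite ffunE (bigD1 j) //= big1 => [|k kj]; first by rewrite ffunE eqxx addr0.
by rewrite ffunE (negPf kj) crep0r.
Qed.

Lemma mxrep_inj X : (forall f, hq (mxrep_fun X f) = 0) -> X = 0.
Proof.
move=> h; apply/matrixP => i j; rewrite mxE; apply: (@crep_inj _ _ _ r) => u.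
apply/le_anti; rewrite hq_ge0 andbT -(h (ph_single j u)) hq_pow.
rewrite (bigD1 i) //= mxrep_single lerDl sumr_ge0 // => k _; exact: hq_ge0.
Qed.

(** A crude majorant: it makes the operator norm finite and turns entrywise convergence into norm
    convergence. *)
Definition mx_entry_norm X : R := \sum_i \sum_j cnorm (X i j).

Lemma mx_entry_norm_ge0 X : 0 <= mx_entry_norm X.
Proof. by do 2![apply: sumr_ge0 => ? _]; exact: cnorm_ge0. Qed.

Lemma mxrep_bound X : obound (mxrep_fun X) (mx_entry_norm X).
Proof.
move=> f; apply: (le_trans (hn_pow_le _)); rewrite /mx_entry_norm mulr_suml.
apply: ler_sum => i _; rewrite ffunE mulr_suml.
apply: (le_trans (hn_sum _ _ _)); apply: ler_sum => j _.
apply: (le_trans (crep_contr _ _ _)).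
by rewrite ler_wpM2l ?cnorm_ge0 ?hn_pow_coord.
Qed.

Definition mxnorm X : R := onorm (mxrep_fun X).

Lemma mxnorm_ge0 X : 0 <= mxnorm X.
Proof. exact: (onorm_ge0 (mx_entry_norm_ge0 X) (@mxrep_bound X)). Qed.

Lemma mxnorm_bound X : obound (mxrep_fun X) (mxnorm X).
Proof. exact: (onorm_bound (mx_entry_norm_ge0 X) (@mxrep_bound X)). Qed.

Lemma mxnorm_le X s : 0 <= s -> obound (mxrep_fun X) s -> mxnorm X <= s.
Proof. exact: onorm_le. Qed.

Lemma mxnorm_entries X : mxnorm X <= mx_entry_norm X.
Proof. by apply: mxnorm_le; [exact: mx_entry_norm_ge0|exact: mxrep_bound]. Qed.

(** Isometry of [r] is used here: the representation bounds the operator [r (X i j)] only.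
    Definiteness and completeness of [mxnorm] both rest on this. *)
Lemma entry_le_mxnorm X i j : cnorm (X i j) <= mxnorm X.
Proof.
apply: (crep_iso (r := r)); first exact: mxnorm_ge0.
move=> u; rewrite -(hn_single j u) -mxrep_single.
exact: (le_trans (hn_pow_coord _ _) (mxnorm_bound _ _)).
Qed.

Lemma mxnorm_eq0 X : mxnorm X = 0 -> X = 0.
Proof.
move=> h; apply/matrixP => i j; rewrite mxE; apply: cnorm_eq0.
by apply/le_anti; rewrite cnorm_ge0 andbT -h entry_le_mxnorm.
Qed.

Lemma mxnormD (X Y : M) : mxnorm (X + Y) <= mxnorm X + mxnorm Y.
Proof.
apply: mxnorm_le; first by rewrite addr_ge0 ?mxnorm_ge0.
move=> f; rewrite -[X in mxrep_fun (X + _)]scale1r mxrep_linl scale1r.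
by rewrite mulrDl; apply: (le_trans (hnD _ _)); apply: lerD; exact: mxnorm_bound.
Qed.

Lemma mxnormM (X Y : M) : mxnorm (X * Y) <= mxnorm X * mxnorm Y.
Proof.
apply: mxnorm_le; first by rewrite mulr_ge0 ?mxnorm_ge0.
move=> f; rewrite mxrepM -mulrA; apply: (le_trans (mxnorm_bound _ _)).
by rewrite ler_wpM2l ?mxnorm_ge0 // mxnorm_bound.
Qed.

Lemma mxnormZ (c : R[i]) (X : M) : (mxnorm (c *: X))%:C = `|c| * (mxnorm X)%:C.
Proof.
pose t (z : R[i]) : R := complex.Re `|z|.
have tE z : `|z| = (t z)%:C by apply: real_of_Re.
have t0 z : 0 <= t z by rewrite -ler0c -tE normr_ge0.
have H z (Y : M) : mxnorm (z *: Y) <= t z * mxnorm Y.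
  apply: mxnorm_le; first by rewrite mulr_ge0 ?mxnorm_ge0.
  move=> f; rewrite -lecR -[z *: Y]addr0 mxrep_linl.
  have -> : mxrep_fun 0 f = 0.
    by apply/ffunP => i; rewrite !ffunE big1 // => j _; rewrite mxE crep0l.
  rewrite addr0 hnZ tE -rmorphM lecR -mulrA ler_wpM2l //.
  exact: mxnorm_bound.
rewrite tE -rmorphM; congr (_%:C); apply/le_anti; rewrite H /=.
have [->|c0] := eqVneq c 0.
  by rewrite /t normr0 mul0r mxnorm_ge0.
have tc : 0 < t c by rewrite -ltcR -tE normr_gt0.
rewrite -ler_pdivlMl // -[X in mxnorm X <= _]scale1r -(mulVf c0) -scalerA.
apply: (le_trans (H _ _)); rewrite ler_wpM2r ?mxnorm_ge0 //.
by rewrite -lecR -tE normfV tE -fmorphV.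
Qed.

Lemma star_mxK : involutive (@star_mx R A m.+1).
Proof. by move=> X; apply/matrixP => i j; rewrite !mxE starK. Qed.

Lemma star_mxD (X Y : M) : star_mx (X + Y) = star_mx X + star_mx Y :> M.
Proof. by apply/matrixP => i j; rewrite !mxE starD. Qed.

Lemma star_mxZ (c : R[i]) (X : M) : star_mx (c *: X) = Num.conj c *: (star_mx X : M).
Proof. by apply/matrixP => i j; rewrite !mxE starZ. Qed.

Lemma star_mxM (X Y : M) : star_mx (X * Y) = (star_mx Y : M) * (star_mx X : M).
Proof.
apply/matrixP => i j; rewrite !mxE star_sum; apply: eq_bigr => k _.
by rewrite !mxE starM.
Qed.

Lemma mxnorm_starM_ge X : mxnorm X ^+ 2 <= mxnorm (star_mx X *m X).
Proof.
have n0 := mxnorm_ge0 (star_mx X *m X).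
rewrite -(sqr_sqrtr n0) ler_pXn2r ?nnegrE ?mxnorm_ge0 ?sqrtr_ge0 //.
apply: mxnorm_le; first exact: sqrtr_ge0.
move=> f; apply: hn_le_sq; first by rewrite mulr_ge0 ?hn_ge0 ?sqrtr_ge0.
rewrite exprMn sqr_sqrtr // {1}/hq /rip mxrep_adj -mxrepM.
rewrite -/(rip f _) ripC (le_trans (rip_le _ _)) // expr2 mulrA.
by rewrite ler_wpM2r ?hn_ge0 // mxnorm_bound.
Qed.

Lemma mxnorm_star X : mxnorm (star_mx X) = mxnorm X.
Proof.
suff H Y : mxnorm Y <= mxnorm (star_mx Y).
  by apply/le_anti; rewrite H -{2}(star_mxK X) H.
have [->|b0] := eqVneq (mxnorm Y) 0; first exact: mxnorm_ge0.
have bp : 0 < mxnorm Y by rewrite lt_def b0 mxnorm_ge0.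
by rewrite -(ler_pM2r bp) -expr2 (le_trans (mxnorm_starM_ge Y)) // mxnormM.
Qed.

Lemma mxnorm_starM X : mxnorm (star_mx X *m X) = mxnorm X ^+ 2.
Proof.
apply/le_anti; rewrite mxnorm_starM_ge andbT.
by rewrite (le_trans (mxnormM _ _)) // mxnorm_star expr2.
Qed.

Lemma mxnorm_complete (u : nat -> M) :
  (forall e : R, 0 < e -> exists N : nat, forall k n : nat,
     (N <= k)%N -> (N <= n)%N -> mxnorm (u k - u n) < e) ->
  exists l : M, forall e : R, 0 < e -> exists N : nat, forall n : nat,
    (N <= n)%N -> mxnorm (u n - l) < e.
Proof.
move=> hu.
have [l hl] : exists l : 'I_m.+1 -> 'I_m.+1 -> A,
    forall i j, ccvg (fun n => (u n : 'M[A]_m.+1) i j) (l i j).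
  suff H i j : exists l, ccvg (fun n => (u n : 'M[A]_m.+1) i j) l.
    exists (fun i j => sval (cid (H i j))) => i j; exact: svalP (cid (H i j)).
  have [|l hl] := @cnorm_complete R A (fun n => (u n : 'M[A]_m.+1) i j).
    move=> e e0; have [N hN] := hu e e0; exists N => k n Nk Nn.
    apply: le_lt_trans (hN k n Nk Nn).
    by have := entry_le_mxnorm (u k - u n) i j; rewrite !mxE.
  by exists l; apply/ccvgP.
pose L : M := \matrix_(i, j) l i j; exists L => e e0.
have h : (fun n => mx_entry_norm (u n - L)) @ \oo --> (0 : R).
  have -> : (0 : R) = \sum_(i < m.+1) \sum_(j < m.+1) 0 by rewrite big1 // => i _; rewrite big1.
  apply: cvgr_sum => i; apply: cvgr_sum => j.
  have -> : (fun n => cnorm ((u n - L) i j)) = (fun n => cnorm ((u n : 'M[A]_m.+1) i j - l i j)).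
    by apply/funext => n; rewrite !mxE.
  exact: hl.
move/cvgrPdist_lt: h => /(_ e e0) [N _ hN]; exists N => n Nn.
apply: le_lt_trans (mxnorm_entries _) _.
by have := hN n Nn; rewrite /= sub0r normrN ger0_norm ?mx_entry_norm_ge0.
Qed.

HB.instance Definition _ := isCStarAlgebra.Build R M mxnorm_eq0 mxnormD mxnormZ mxnormM
  mxnorm_complete star_mxK star_mxD star_mxZ star_mxM mxnorm_starM.

Definition mxrep : crep (M : cstarAlgType R) (ph_pow V m.+1) :=
  @CRep R M (ph_pow V m.+1) mxrep_fun mxrep_linl mxrep_linr mxrepM mxrep_adj mxrep_inj.

End MxAlgRing.

(** * Positivity in matrix algebras *)

Section PositiveRoot.
Variables (R : realType) (A : cstarAlgType R) (V : preHilbert R) (r : crep A V).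

(** Polarization at [u + v] and [u + i v] with [v = r a u] yields [2 hq v = 0]. *)
Lemma crep_form0 (a : A) : (forall u, ip (r a u) u = 0) -> a = 0.
Proof.
move=> h; apply: (@crep_inj _ _ _ r) => u; set v := r a u.
have h1 := h (u + v); have h2 := h (u + 'i%R *: v).
move: h1 h2; rewrite !crepDr !ipDl !ipDr crepZr !ipZl !ipZr !h conjCi !mulr0 !addr0 !add0r.
move=> h1 h2; have e : ip v v = ip (r a v) u.
  by move: h2; rewrite mulNr addrC => /eqP; rewrite subr_eq0 => /eqP/(mulfI (neq0Ci _)).
have : (hq v)%:C *+ 2 = 0 by rewrite -ipE mulr2n {2}e.
by move/eqP; rewrite mulrn_eq0 /= => /eqP/complexI.
Qed.

Lemma crep_real_sa (a : A) : (forall u, 0 <= ip (r a u) u) -> star a = a.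
Proof.
move=> h; apply/eqP; rewrite eq_sym -subr_eq0; apply/eqP/crep_form0 => u.
rewrite crepBl ipDl -scaleN1r ipZl mulN1r [ip (r (star a) u) u]crep_adj starK (ipC (r a u)).
by rewrite (real_of_Re (h u)) conjC_real subrr.
Qed.

(** After scaling, [h = 1 - a / s] has its form between 0 and 1, hence norm at most 1, and
    [sqrt_one_sub] extracts the root of [1 - h = a / s] inside [S]. *)
Lemma crep_pos_sqrt (S : set A) (a : A) : closed_subalg S -> S a ->
  (forall u, 0 <= ip (r a u) u) -> exists k, [/\ S k, star k = k & a = k * k].
Proof.
move=> hS Sa pa; have sa := crep_real_sa pa.
pose s := cnorm a + 1; have s0 : 0 < s by rewrite /s; have := cnorm_ge0 a; lra.
pose h := 1 - (s^-1)%:C *: a.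
have Sh : S h by rewrite /h addrC -scaleNr; apply: (csub_lin hS) => //; exact: (csub1 hS).
have sh : star h = h by rewrite /h starB star1 starZr sa.
have ha u : rip (r h u) u = hq (r 1 u) - s^-1 * rip (r a u) u.
  by rewrite /h crepBl crepZl ripDl ripNl ripZl crep_1rip.
have ra u : 0 <= rip (r a u) u by exact: Re_ge0.
have hle u : rip (r h u) u <= hq u.
  rewrite ha (le_trans _ (crep_1le r u)) // gerBl mulr_ge0 ?invr_ge0 ?(ltW s0) //.
have hge u : 0 <= rip (r h u) u.
  rewrite ha subr_ge0 ler_pdivrMl //.
  have -> : rip (r a u) u = rip (r a (r 1 u)) (r 1 u).
    by rewrite -crepM mulr1 ripC crep_rip sa -crepM mulr1 ripC.
  apply: (le_trans (rip_le _ _)); rewrite -hn2 expr2 mulrA ler_wpM2r ?hn_ge0 //.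
  apply: (le_trans (crep_contr _ _ _)); rewrite ler_wpM2r ?hn_ge0 // /s; lra.
(* With [w = h u], nonnegativity of the form of [h] at [u - w] and its upper bound at [w] give
   [hq w <= rip w u], which is at most [hq u]. *)
have h1 : cnorm h <= 1.
  apply: (crep_iso (r := r)) => // u; rewrite mul1r ler_wsqrtr // (le_trans _ (hle u)) //.
  have := hge (u - r h u); have := hle (r h u); set w := r h u.
  rewrite crepDr crepNr -/w !(ripDl, ripDr) !(ripNl, ripNr).
  rewrite (crep_rip r h w u) sh -/w -/(hq w) -/(hq w); lra.
have [k [Sk sk _ ek]] := sqrt_one_sub h1 hS Sh sh.
exists ((Num.sqrt s)%:C *: k); split.
- rewrite -[_ *: k]addr0; apply: (csub_lin hS) => //.
  by have := csub_lin hS (-1) Sk Sk; rewrite scaleN1r addNr.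
- by rewrite starZr sk.
rewrite -scalerAl -scalerAr scalerA -rmorphM -(expr2 (Num.sqrt s)) sqr_sqrtr ?(ltW s0) //.
rewrite -ek /h opprB addrC subrK scalerA -rmorphM mulfV ?gt_eqF //.
by rewrite scale1r.
Qed.

End PositiveRoot.

Section GramMatrices.
Variables (R : realType) (A : cstarAlgType R) (V : preHilbert R) (r : crep A V).

(** Positivity as a quadratic form. [positive_mx_oppos] and [oppos_positive_mx] identify it with the
    Gram form, the latter keeping the factor inside [S]. *)
Definition oppos n (X : 'M[A]_n) : Prop :=
  forall u : 'I_n -> V, 0 <= \sum_i \sum_j ip (r (X i j) (u j)) (u i).

Lemma gram_oppos (I J : finType) (N : I -> J -> A) (u : J -> V) :
  0 <= \sum_i \sum_j ip (r (\sum_l star (N l i) * N l j) (u j)) (u i).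
Proof.
have -> : \sum_i \sum_j ip (r (\sum_l star (N l i) * N l j) (u j)) (u i) =
    \sum_l ip (\sum_j r (N l j) (u j)) (\sum_j r (N l j) (u j)).
  under eq_bigr do under eq_bigr do rewrite crep_suml ip_suml.
  under eq_bigr do rewrite exchange_big.
  rewrite exchange_big; apply: eq_bigr => l _.
  rewrite exchange_big ip_suml; apply: eq_bigr => j _.
  rewrite ip_sumr; apply: eq_bigr => i _.
  by rewrite crepM crep_adj starK.
by apply: sumr_ge0 => l _; exact: ip_ge0.
Qed.

Lemma positive_mx_oppos (S : set A) n (X : 'M[A]_n) : positive_mx S X -> oppos X.
Proof.
move=> [N _ ->] u; have := gram_oppos (fun i j => N i j) u.
congr (_ <= _); apply: eq_bigr => i _; apply: eq_bigr => j _.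
by rewrite mxE; congr (ip (r _ _) _); apply: eq_bigr => l _; rewrite mxE.
Qed.

Lemma mx_closed_subalg (S : set A) (m : nat) : closed_subalg S ->
  closed_subalg [set X : mxalg r m | forall i j, S ((X : 'M[A]_m.+1) i j)].
Proof.
move=> hS.
have S0 : S 0 by have := csub_lin hS (-1) (csub1 hS) (csub1 hS); rewrite scaleN1r addNr.
have SD a b : S a -> S b -> S (a + b).
  by move=> ha hb; rewrite -[a]scale1r; exact: (csub_lin hS).
split=> /=.
- by move=> i j; rewrite mxE; case: eqP => _ //; exact: (csub1 hS).
- by move=> c X Y hX hY i j; rewrite !mxE; apply: (csub_lin hS).
- move=> X Y hX hY i j; rewrite mxE; elim/big_rec: _ => // k y _.
  by apply: SD; exact: (csubM hS).
- move=> u l hu hl i j; apply: (csub_lim hS (u := fun n => (u n : 'M[A]_m.+1) i j)).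
    by move=> n; exact: hu.
  apply: (ccvg_le _ hl) => n.
  by have := entry_le_mxnorm r (u n - l) i j; rewrite !mxE.
Qed.

(** The root is taken in [mxalg r m] within the closed subalgebra of matrices over [S]. Having
    entries in [S] is essential, since [phi] is completely positive on [A^0] only. *)
Lemma oppos_positive_mx (S : set A) n (X : 'M[A]_n) : closed_subalg S ->
  (forall i j, S (X i j)) -> oppos X -> positive_mx S X.
Proof.
case: n X => [|m] X hS SX pX; first by exists X; [case | apply/matrixP; case].
have [||k [Sk sk ek]] := crep_pos_sqrt (r := mxrep r m) (mx_closed_subalg m hS) (a := X : mxalg r m) => //.
  move=> u; have := pX u; rewrite /= /ph_pow_ip; congr (_ <= _).
  by apply: eq_bigr => i _; rewrite ffunE ip_suml.
by exists k => //; rewrite -[star_mx k]/(star (k : mxalg r m)) sk.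
Qed.

End GramMatrices.

(** * Norm bounds for completely positive maps *)

Section ContractiveCP.
Variables (R : realType) (A : cstarAlgType R) (V : preHilbert R) (T : A -> V -> V).
Hypothesis Tl : forall c a b u, T (c *: a + b) u = c *: T a u + T b u.
Hypothesis Tr : forall a c u, T a (c *: u) = c *: T a u.
Hypothesis Tpos : forall M : 'M[A]_2, positive_mx setT M ->
  forall u : 'I_2 -> V, 0 <= \sum_i \sum_j ip (T (M i j) (u j)) (u i).
Hypothesis T1 : forall u, rip (T 1 u) u <= hq u.

(* For |b| <= 1 the matrix [1, b; b^*, 1] is a Gram matrix. *)
Lemma cp_contractive a u : hn (T a u) <= cnorm a * hn u.
Proof.
have T0 v : T 0 v = 0.
  by have := Tl (-1) 0 0 v; rewrite scaler0 addr0 scaleN1r addNr.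
have TZ c b v : T (c *: b) v = c *: T b v by rewrite -[c *: b]addr0 Tl T0 addr0.
have := cnorm_ge0 a; rewrite le_eqVlt => /predU1P[a0|a0].
  by rewrite (cnorm_eq0 _ (esym a0)) T0 hn0 cnorm0 mul0r.
set s := cnorm a in a0 *; pose b := (s^-1)%:C *: a.
suff H : hn (T b u) <= hn u.
  have -> : a = s%:C *: b by rewrite /b scalerA -rmorphM mulfV ?gt_eqF // scale1r.
  rewrite TZ -lecR hnZ normc_real ger0_norm ?(ltW a0) // -rmorphM lecR.
  by rewrite ler_wpM2l // ltW.
have b1 : cnorm (star b * b) <= 1.
  by rewrite cnorm_starM cnormZr ger0_norm ?invr_ge0 ?(ltW a0) // mulVf ?expr1n // gt_eqF.
have [|k [_ sk _ ek]] := sqrt_one_sub b1 (@closed_subalgT _ _) I; first by rewrite starM starK.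
have P v w : 0 <= ip (T 1 v) v + ip (T b w) v + ip (T (star b) v) w + ip (T 1 w) w.
  (* The factor with rows [(1, b)] and [(0, k)]; its Gram matrix is the required one because
     [star b * b + k * k = 1]. *)
  pose N : 'M[A]_2 := \matrix_(i, j)
    if i == 0 then (if j == 0 then 1 else b) else (if j == 0 then 0 else k).
  have pN : positive_mx setT (star_mx N *m N) by exists N.
  have := Tpos pN (fun i => if i == 0 then v else w).
  rewrite !big_ord_recl !big_ord0 !mxE !big_ord_recl !big_ord0 !mxE /=.
  have e : star b * b + k * k = 1 by rewrite -ek addrC subrK.
  by rewrite star1 star0 sk !mul1r !mulr1 !mul0r !mulr0 !addr0 e addrA.
(* [T] is not assumed to respect adjoints. A nonnegative complex number has imaginary part 0;
   comparing imaginary parts at [(v, w)] and [(i v, w)] gives this symmetry. *)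
have Re v w : rip (T (star b) v) w = rip (T b w) v.
  have h1 := P v w; have h2 := P ('i%R *: v) w.
  have Tv0 c : T c 0 = 0 by rewrite -(scale0r (0 : V)) Tr !scale0r.
  have h3 := P v 0; have h4 := P 0 w.
  move: h1 h2 h3 h4; rewrite !Tv0 !Tr !ip0l !ip0r !addr0 !add0r !ipZl !ipZr conjCi -complexiE /rip.
  move: (ip _ _) (ip _ _) (ip _ _) (ip _ _) => [a1 a2] [p1 p2] [q1 q2] [d1 d2].
  rewrite !lecE /= => /andP[/eqP h1 _] /andP[/eqP h2 _] /andP[/eqP h3 _] /andP[/eqP h4 _].
  move: h1 h2 h3 h4; lra.
(* At the vector [(- w, u)] positivity reads [0 <= hq w - 2 hq w + hq u], once [T1] bounds the
   diagonal terms. *)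
set w := T b u.
have := Re_ge0 (P (- w) u); rewrite !ReD -!/(rip _ _) Re !ripNr -/w -/(hq w).
have := T1 (- w); have := T1 u; rewrite hqN !ripNr /hn => h1 h2 h3.
by rewrite ler_wsqrtr //; lra.
Qed.
End ContractiveCP.

(** * A faithful trace on a finite-dimensional C*-algebra *)

(** Schur's theorem makes [M] triangular with its real eigenvalues on the diagonal, so the trace is
    the sum of their squares. If it vanishes, the characteristic polynomial is a power of ['X] and
    Cayley-Hamilton gives nilpotency. *)
Lemma trace_square_real (R : realType) n (M : 'M[R[i]]_n.+1) :
  (forall a, eigenvalue M a -> a \is Num.real) ->
  0 <= \tr (M * M) /\ (\tr (M * M) = 0 -> M ^+ n.+1 = 0).
Proof.
move=> hM; have [P Pu /=] := Schur M (ltn0Sn n).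
have Pn : P \in unitmx by exact: unitarymx_unit.
rewrite /similar_to /= conjumx // -[invmx P]/(P^-1).
set T := _ *m _ *m _ => Ttrig; have TE : T = P * M * P^-1 by [].
have Tk k : T ^+ k = P * M ^+ k * P^-1.
  elim: k => [|k ih]; first by rewrite !expr0 mulr1 mulrV.
  by rewrite !exprS ih TE !mulrA mulrVK.
have Tr i : T i i \is Num.real.
  apply: hM.
  have : eigenvalue T (T i i).
    rewrite eigenvalue_root_char char_poly_trig // rootE horner_prod (bigD1 i) //=.
    by rewrite hornerXsubC subrr mul0r.
  move=> /eigenvalueP[v vT v0]; apply/eigenvalueP; exists (v *m P).
    have : v *m T *m P = T i i *: v *m P by rewrite vT.
    by rewrite TE -scalemxAl -!mulmxE !mulmxA mulmxKV.
  by apply: contra v0 => /eqP e; rewrite -(mulmxK Pn v) e mul0mx.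
have trE : \tr (M * M) = \sum_i T i i ^+ 2.
  have -> : \tr (M * M) = \tr (T * T).
    have trP X : \tr (P * X * P^-1) = \tr X by rewrite -!mulmxE mxtrace_mulC mulKmx.
    by rewrite -expr2 -[T * T]expr2 Tk trP.
  rewrite /mxtrace; apply: eq_bigr => i _; rewrite -mulmxE mxE (bigD1 i) //= big1.
    by rewrite addr0 expr2.
  move=> j ji; move/is_trig_mxP: Ttrig => h.
  case: (ltngtP j i) => [lt|gt|/val_inj e].
  - by rewrite [X in _ * X]h // mulr0.
  - by rewrite h // mul0r.
  - by rewrite e eqxx in ji.
split; first by rewrite trE; apply: sumr_ge0 => i _; rewrite real_exprn_even_ge0.
rewrite trE => /eqP; rewrite psumr_eq0; last by move=> i _; rewrite real_exprn_even_ge0.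
move=> /allP T0; have Tii i : T i i = 0.
  by have := T0 i (mem_index_enum i); rewrite /= sqrf_eq0 => /eqP.
have TN : T ^+ n.+1 = 0.
  have := Cayley_Hamilton T; rewrite char_poly_trig //.
  rewrite (eq_bigr (fun=> 'X)) => [|i _]; last by rewrite Tii subr0.
  by rewrite prodr_const card_ord rmorphXn /= horner_mx_X.
have PX0 (X : 'M[R[i]]_n.+1) : P *m X *m invmx P = 0 -> X = 0.
  by move=> e; rewrite -[X](mulKmx Pn) -[P *m X](mulmxKV Pn) e mul0mx mulmx0.
by apply: PX0; rewrite -TN Tk.
Qed.

Lemma cartesian_decomposition (R : realType) (A : cstarAlgType R) (b : A) :
  exists s t : A, [/\ star s = s, star t = t & b = s + 'i%R *: t].
Proof.
exists ((2^-1 : R)%:C *: (b + star b)), ((2^-1 : R)%:C *: ('i%R *: (star b - b))).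
split; first by rewrite starZr starD starK addrC.
  by rewrite starZr starZ conjCi starB starK scaleNr -scalerN opprB.
have -> : 'i%R *: ((2^-1 : R)%:C *: ('i%R *: (star b - b))) = (2^-1 : R)%:C *: (b - star b).
  rewrite scalerA mulrC -scalerA; congr (_ *: _).
  by rewrite scalerA -(expr2 'i%R) sqrCi scaleN1r opprB.
rewrite -scalerDr addrACA subrr addr0 -mulr2n -(scaler_nat _ b) scalerA.
by rewrite -(rmorph_nat (real_complex R) 2) -rmorphM mulVf ?scale1r.
Qed.

Section RegularTrace.
Import VectorInternalTheory.
Variables (R : realType) (B : fdCstarAlgType R).
Local Notation n := (dim B).

Definition lmulv (b : B) (v : 'rV[R[i]]_n) : 'rV[R[i]]_n := v2r (b * r2v v).

Fact lmulv_linear (b : B) : linear (lmulv b).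
Proof. by move=> c u v; rewrite /lmulv linearP /= mulrDr -scalerAr linearP. Qed.

HB.instance Definition _ (b : B) :=
  GRing.isLinear.Build R[i] 'rV[R[i]]_n 'rV[R[i]]_n _ (lmulv b) (lmulv_linear b).

Definition lmulmx (b : B) : 'M[R[i]]_n := lin1_mx (lmulv b).

Lemma mul_lmulmx (b : B) v : v *m lmulmx b = v2r (b * r2v v).
Proof. exact: mul_rV_lin1. Qed.

Lemma eq_lmulmx (X Y : 'M[R[i]]_n) : (forall v : 'rV_n, v *m X = v *m Y) -> X = Y.
Proof. by move=> h; apply/row_matrixP => i; rewrite !rowE. Qed.

Lemma lmulmxM (a b : B) : lmulmx (a * b) = lmulmx b *m lmulmx a.
Proof. by apply: eq_lmulmx => v; rewrite mulmxA !mul_lmulmx v2rK mulrA. Qed.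

Lemma lmulmx_linear : linear lmulmx.
Proof.
move=> c a b; apply: eq_lmulmx => v.
by rewrite mulmxDr -scalemxAr !mul_lmulmx mulrDl -scalerAl linearP.
Qed.

Definition regtr (b : B) : R[i] := \tr (lmulmx b).

Lemma regtr_linear c a b : regtr (c *: a + b) = c * regtr a + regtr b.
Proof. by rewrite /regtr lmulmx_linear mxtraceD mxtraceZ. Qed.

Lemma regtrD a b : regtr (a + b) = regtr a + regtr b.
Proof. by rewrite -[a]scale1r regtr_linear mul1r scale1r. Qed.

Lemma regtrZ c a : regtr (c *: a) = c * regtr a.
Proof.
have r0 : regtr 0 = 0 by apply: (addrI (regtr 0)); rewrite -regtrD !addr0.
by rewrite -[c *: a]addr0 regtr_linear r0 addr0.
Qed.

Lemma regtrC a b : regtr (a * b) = regtr (b * a).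
Proof. by rewrite /regtr !lmulmxM mxtrace_mulC. Qed.

(** An eigenvector is an element [w] of [B] with [a w = c w]; computing [w^* a w] in two ways gives
    [c w^* w = conj c w^* w], and [w^* w] is nonzero by the C*-identity. *)
Lemma lmulmx_eigen_real (a : B) c : star a = a -> eigenvalue (lmulmx a) c -> c \is Num.real.
Proof.
move=> sa /eigenvalueP[v]; rewrite mul_lmulmx => e v0.
have {}e : a * r2v v = c *: r2v v by apply: v2r_inj; rewrite linearZ /= r2vK.
have w0 : r2v v != 0 by rewrite -(inj_eq (@v2r_inj _ B)) r2vK linear0.
set w := r2v v in e w0.
have h : (c - Num.conj c) *: (star w * w) = 0.
  by rewrite scalerBl scalerAr -e scalerAl -starZ -e starM sa mulrA subrr.
have : star w * w != 0.
  apply: contra w0 => /eqP e0; apply/eqP/cnorm_eq0/eqP.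
  by rewrite -sqrf_eq0 -cnorm_starM e0 cnorm0.
move/eqP: h; rewrite scaler_eq0 => /orP[|/eqP -> /eqP //].
by rewrite subr_eq0 => /eqP h _; apply/CrealP.
Qed.

Lemma dim_fd_gt0 : (0 < n)%N.
Proof.
case E : n => [|//]; have := oner_neq0 B; rewrite -(inj_eq (@v2r_inj _ B)) linear0.
by move: (v2r (1 : B)); rewrite E => x; rewrite thinmx0 eqxx.
Qed.

(** The C*-identity halves the exponent, as powers of [a] are self-adjoint. *)
Lemma star_pow2_eq0 (a : B) k : star a = a -> a ^+ (2 ^ k) = 0 -> a = 0.
Proof.
move=> sa; elim: k => [|k ih]; first by rewrite expr1.
have sak : star (a ^+ (2 ^ k)) = a ^+ (2 ^ k).
  by elim: (2 ^ k)%N => [|j jh]; rewrite ?expr0 ?star1 // exprS starM jh sa -exprSr -exprS.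
rewrite expnSr exprM => e; apply: ih; apply: cnorm_eq0; apply/eqP.
by rewrite -sqrf_eq0 -cnorm_starM sak -expr2 e cnorm0.
Qed.

Lemma regtr_square (a : B) : star a = a ->
  0 <= regtr (a * a) /\ (regtr (a * a) = 0 -> a = 0).
Proof.
move=> sa; rewrite /regtr lmulmxM.
have hr : forall c, eigenvalue (lmulmx a) c -> c \is Num.real.
  by move=> c; exact: lmulmx_eigen_real.
(* Powers are written with [iter] because the size [dim B] is turned into a successor only below. *)
have hk k : lmulmx (a ^+ k) = iter k (mulmx (lmulmx a)) 1%:M.
  elim: k => [|k ih]; first by apply: eq_lmulmx => v; rewrite mul_lmulmx expr0 mul1r r2vK mulmx1.
  by rewrite exprSr lmulmxM ih.
have h0 (b : B) : lmulmx b = 0 -> b = 0.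
  move=> e; have := mul_lmulmx b (v2r 1); rewrite e mulmx0 v2rK mulr1.
  by move/esym/eqP; rewrite -(linear0 v2r) => /eqP/v2r_inj.
have [m hm] : exists m, n = m.+1 by exists n.-1; rewrite prednK // dim_fd_gt0.
have [p1 p2] : 0 <= \tr (lmulmx a *m lmulmx a) /\
    (\tr (lmulmx a *m lmulmx a) = 0 -> iter n (mulmx (lmulmx a)) 1%:M = 0).
  move: (lmulmx a) hr; rewrite hm => M hr.
  have [q1 q2] := trace_square_real hr; split=> // /q2 e.
  have hi k : iter k (mulmx M) 1%:M = M ^+ k.
    by elim: k => [|k ih]; rewrite ?expr0 // exprS /= ih.
  by rewrite hi.
split=> // /p2; rewrite -hk => /h0 e; apply: (@star_pow2_eq0 a n) => //.
have le : (n <= 2 ^ n)%N by rewrite ltnW // ltn_expl.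
by rewrite -(subnK le) exprD e mulr0.
Qed.

(* With b = s + i t, traciality gives 2 tr(b^* b) = tr(b^* b + b b^* ) = 2 tr(s^2 + t^2). *)
Lemma regtr_pos (b : B) : 0 <= regtr (star b * b) /\ (regtr (star b * b) = 0 -> b = 0).
Proof.
have [s [t [ss st be]]] := cartesian_decomposition b.
have sb : star b = s - 'i%R *: t by rewrite be starD ss starZ st conjCi scaleNr.
have e : regtr (star b * b) = regtr (s * s) + regtr (t * t).
  rewrite sb {1}be mulrBl !mulrDr -!scalerAl -!scalerAr scalerA -(expr2 'i%R) sqrCi.
  rewrite scaleN1r opprD opprK -!scaleNr !regtrD !regtrZ (regtrC t s) addrA.
  by rewrite mulNr addrK.
have [s1 s2] := regtr_square ss; have [t1 t2] := regtr_square st.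
rewrite e; split; first exact: addr_ge0.
move/eqP; rewrite paddr_eq0 // => /andP[/eqP/s2 s0 /eqP/t2 t0].
by rewrite be s0 t0 scaler0 addr0.
Qed.

End RegularTrace.

(** * Finite-dimensional matrix algebras and diagonal masas *)

Section RegularRep.
Variables (R : realType) (B : fdCstarAlgType R).

(** A self-adjoint [s] is a real combination of [(s + 1)^2], [s^2] and 1, on which the trace is real
    by [regtr_square]; the general case follows from the cartesian decomposition. *)
Lemma regtr_star (b : B) : regtr (star b) = Num.conj (regtr b).
Proof.
have H (s : B) : star s = s -> Num.conj (regtr s) = regtr s.
  move=> ss; apply/CrealP.
  have r2 (y : B) : star y = y -> regtr (y * y) \is Num.real.
    by move=> sy; apply: ger0_real; case: (regtr_square sy).
  have -> : regtr s = 2^-1 * (regtr ((s + 1) * (s + 1)) - regtr (s * s) - regtr (1 * 1 : B)).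
    by rewrite mulrDl !mulrDr !mulr1 !mul1r !regtrD; field.
  by rewrite rpredM ?rpredB ?r2 ?starD ?ss ?star1 // rpredV realn.
have [s [t [ss st ->]]] := cartesian_decomposition b.
rewrite starD starZ ss st conjCi !regtrD !regtrZ rmorphD rmorphM /= (H _ ss) (H _ st).
by rewrite conjCi.
Qed.

Definition reg_ip (u v : B) : R[i] := regtr (star v * u).

Fact reg_ip_lin c u v w : reg_ip (c *: u + v) w = c * reg_ip u w + reg_ip v w.
Proof. by rewrite /reg_ip mulrDr -scalerAr regtr_linear. Qed.

Fact reg_ipC u v : reg_ip v u = Num.conj (reg_ip u v).
Proof. by rewrite /reg_ip -regtr_star starM starK. Qed.

Fact reg_ip_ge0 u : 0 <= reg_ip u u.
Proof. by case: (regtr_pos u). Qed.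

Definition reg_preHilbert : preHilbert R := PreHilbert reg_ip_lin reg_ipC reg_ip_ge0.

Fact reg_linl (c : R[i]) (a b u : B) : (c *: a + b) * u = c *: (a * u) + b * u.
Proof. by rewrite mulrDl scalerAl. Qed.

Fact reg_linr (a : B) (c : R[i]) (u v : B) : a * (c *: u + v) = c *: (a * u) + a * v.
Proof. by rewrite mulrDr scalerAr. Qed.

Fact reg_mul (a b u : B) : a * b * u = a * (b * u).
Proof. by rewrite mulrA. Qed.

Fact reg_adj (a u v : B) : reg_ip (a * u) v = reg_ip u (star a * v).
Proof. by rewrite /reg_ip starM starK mulrA. Qed.

Fact reg_inj (a : B) : (forall u : reg_preHilbert, hq (a * u : reg_preHilbert) = 0) -> a = 0.
Proof.
move=> /(_ 1); rewrite mulr1 => h; have [p] := regtr_pos a; apply.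
by rewrite (real_of_Re p) -[complex.Re _]/(@hq R reg_preHilbert a) h.
Qed.

Definition regrep : crep (B : cstarAlgType R) reg_preHilbert :=
  @CRep R B reg_preHilbert (fun a u => a * u) reg_linl reg_linr reg_mul reg_adj reg_inj.

End RegularRep.

Section FdMatrices.
Variables (R : realType) (B : fdCstarAlgType R) (V : preHilbert R) (r : crep B V) (m : nat).
Import VectorInternalTheory.
Local Notation M := (mxalg r m).

Definition mx_ffun (X : 'M[B]_m.+1) : {ffun 'I_m.+1 * 'I_m.+1 -> B} :=
  [ffun p => X p.1 p.2].

Fact mxalg_vect_iso : Vector.axiom (dim {ffun 'I_m.+1 * 'I_m.+1 -> B}) M.
Proof.
exists (fun X : M => v2r (mx_ffun X)).
  move=> c X Y; rewrite -linearP; congr v2r; apply/ffunP => p.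
  by rewrite !ffunE mxE mxalg_scaleE.
exists (fun v => \matrix_(i, j) (r2v v : {ffun 'I_m.+1 * 'I_m.+1 -> B}) (i, j)) => [X|v].
  by rewrite v2rK; apply/matrixP => i j; rewrite mxE ffunE.
rewrite -[RHS]r2vK; congr v2r; apply/ffunP => -[i j]; by rewrite ffunE mxE.
Qed.

HB.instance Definition _ := Lmodule_hasFinDim.Build R[i] M mxalg_vect_iso.
HB.instance Definition _ := Algebra_isFalgebra.Build R[i] M.

End FdMatrices.

(** The identity of an [{aspace B}] may differ from that of [B]. Here adjoining the scalars to [D]
    keeps it abelian and star-closed, so maximality puts them in [D]. *)
Lemma maximal_abelian_1 (R : realType) (B : fdCstarAlgType R) (D : {aspace B}) :
  maximal_abelian D -> 1 \in D.
Proof.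
move=> [[Dstar Dcom] Dmax]; pose U := (D + <[1]>)%VS.
have U1 : 1 \in U by rewrite (subvP (addvSr _ _)) // memv_line.
have DU : (D <= U)%VS by exact: addvSl.
have UP u : u \in U -> exists2 a, a \in D & exists c : R[i], u = a + c *: 1.
  by move=> /memv_addP[a aD [b /vlineP[c ->] ->]]; exists a => //; exists c.
have Um a (c : R[i]) : a \in D -> a + c *: 1 \in U.
  by move=> aD; rewrite memv_add // memvZ // memv_line.
have Ua : is_aspace U.
  rewrite /is_aspace has_algid1 //=; apply/prodvP => u v /UP[a aD [c ->]] /UP[b bD [e ->]].
  rewrite mulrDl !mulrDr -!scalerAl -!scalerAr !mul1r !mulr1 scalerA addrA.
  apply: Um; rewrite -addrA; apply: rpredD; last by rewrite rpredD ?rpredZ.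
  by rewrite (subvP (asubv D)) // memv_mul.
have UA : abelian_star_subalgebra (ASpace Ua).
  split => /= [u /UP[a aD [c ->]]|u v /UP[a aD [c ->]] /UP[b bD [e ->]]].
    by rewrite starD starZ star1; apply: Um; exact: Dstar.
  rewrite !(mulrDl, mulrDr) -!scalerAl -!scalerAr !mul1r !mulr1 (Dcom _ _ aD bD) !scalerA (mulrC e).
  by rewrite -!addrA; congr (_ + _); rewrite addrCA.
by have /subvP := Dmax _ UA DU; apply.
Qed.

Section DiagonalMasa.
Variables (R : realType) (B : fdCstarAlgType R) (V : preHilbert R) (r : crep B V) (m : nat).
Variable D : {aspace B}.
Hypothesis Dmax : maximal_abelian D.
Local Notation M := (mxalg r m : fdCstarAlgType R).

Definition diag_embed (f : {ffun 'I_m.+1 -> subvs_of D}) : M :=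
  \matrix_(i, j) (if i == j then vsval (f i) else 0).

Fact diag_embed_linear : linear diag_embed.
Proof.
move=> c f g; apply/matrixP => i j; rewrite !mxE; case: eqP => _.
  by rewrite !ffunE linearP.
by rewrite scaler0 addr0.
Qed.

HB.instance Definition _ :=
  GRing.isLinear.Build R[i] {ffun 'I_m.+1 -> subvs_of D} M _ diag_embed diag_embed_linear.

Definition diag_space : {vspace M} := (linfun diag_embed @: fullv)%VS.

Lemma diag_spaceP (X : M) : reflect
  ((forall i j, i != j -> (X : 'M[B]_m.+1) i j = 0) /\
   forall i, (X : 'M[B]_m.+1) i i \in D) (X \in diag_space).
Proof.
apply: (iffP idP) => [/memv_imgP[f _ ->]|[Xoff Xd]].
  rewrite lfunE; split=> [i j ij|i]; rewrite mxE; first by rewrite (negPf ij).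
  by rewrite eqxx subvsP.
apply/memv_imgP; exists [ffun i => vsproj D ((X : 'M[B]_m.+1) i i)]; first exact: memvf.
rewrite lfunE; apply/matrixP => i j; rewrite mxE; case: eqP => [<-|/eqP ij].
  by rewrite ffunE vsprojK.
exact: Xoff.
Qed.

Lemma dim_diag_space : \dim diag_space = (m.+1 * \dim D)%N.
Proof.
rewrite /diag_space limg_dim_eq.
  by rewrite dimvf /dim /= card_ord.
apply/eqP; rewrite capfv; apply/lker0P => f g; rewrite !lfunE => /matrixP h.
by apply/ffunP => i; apply: subvs_inj; have := h i i; rewrite !mxE eqxx.
Qed.

Lemma diag_space_aspace : is_aspace diag_space.
Proof.
have D1 := maximal_abelian_1 Dmax.
rewrite /is_aspace has_algid1 /=.
  apply/prodvP => X Y /diag_spaceP[X0 XD] /diag_spaceP[Y0 YD]; apply/diag_spaceP; split=> [i j ij|i].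
    rewrite mxE big1 // => k _; have [ik|ik] := eqVneq i k.
      by rewrite [X in _ * X]Y0 ?mulr0 // -ik.
    by rewrite X0 // mul0r.
  rewrite mxE rpred_sum // => k _; have [<-|ik] := eqVneq i k.
    by rewrite (subvP (asubv D)) // memv_mul.
  by rewrite X0 // mul0r mem0v.
apply/diag_spaceP; split=> [i j ij|i]; rewrite mxE ?(negPf ij) //.
by rewrite eqxx.
Qed.

Definition diag_masa : {aspace M} := ASpace diag_space_aspace.

(** A larger abelian [E] commutes with the diagonal matrix units, which lie in [diag_masa] because
    [1 \in D]; so [E] is diagonal. Then each diagonal entry is multiplicative on [E] and has as
    image an abelian star-subalgebra containing [D], hence equal to [D]. *)
Lemma diag_masa_maximal : maximal_abelian diag_masa.
Proof.
have D1 := maximal_abelian_1 Dmax; case: (Dmax) => [[Dstar Dcom] Dm].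
split.
  split=> [X /diag_spaceP[X0 XD]|X Y /diag_spaceP[X0 XD] /diag_spaceP[Y0 YD]].
    apply/diag_spaceP; split=> [i j ij|i]; rewrite mxE; last exact: Dstar.
    by rewrite X0 ?star0 // eq_sym.
  apply/matrixP => i j; rewrite !mxE (bigD1 i) //= [RHS](bigD1 i) //= !big1 => [|k ki|k ki].
  - rewrite !addr0; have [<-|ij] := eqVneq i j; first exact: Dcom.
    by rewrite (Y0 i j) // (X0 i j) // !mulr0.
  - by rewrite Y0 ?mul0r // eq_sym.
  - by rewrite X0 ?mul0r // eq_sym.
move=> E [Estar Ecom] sub.
pose unit_at i (b : B) : M := \matrix_(k, l) (if (k == i) && (l == i) then b else 0).
have unitE i b : b \in D -> unit_at i b \in E.
  move=> bD; apply: (subvP sub); apply/diag_spaceP; split=> [k l kl|k]; rewrite mxE.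
    by case: ifP => // /andP[/eqP ki /eqP li]; rewrite ki li eqxx in kl.
  by case: ifP => // _; exact: mem0v.
have off (X : M) : X \in E -> forall i j, i != j -> (X : 'M[B]_m.+1) i j = 0.
  move=> XE i j ij; have /matrixP/(_ i j) := Ecom _ _ XE (unitE j 1 D1).
  rewrite !mxE (bigD1 j) //= !mxE !eqxx mulr1 big1 => [|k kj]; last first.
    by rewrite mxE (negPf kj) mulr0.
  rewrite addr0 => ->; apply: big1 => k _.
  by rewrite mxE (negPf ij) mul0r.
apply/subvP => X XE; apply/diag_spaceP; split; first exact: off.
move=> i; pose ev (Y : M) : B := (Y : 'M[B]_m.+1) i i.
have evl : linear ev by move=> c Y Z; rewrite /ev mxE mxalg_scaleE.
pose evL := GRing.isLinear.Build R[i] M B _ ev evl.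
pose evH : {linear M -> B} := HB.pack ev evL.
have evM (Y Z : M) : Y \in E -> ev (Y * Z) = ev Y * ev Z.
  move=> YE; rewrite /ev mxE (bigD1 i) //= big1 ?addr0 // => k ki.
  by rewrite (off _ YE) ?mul0r // eq_sym.
pose U := (linfun evH @: E)%VS.
have UP b : b \in U -> exists2 Y, Y \in E & b = ev Y.
  by move=> /memv_imgP[Y YE ->]; exists Y => //; rewrite lfunE.
have Um Y : Y \in E -> ev Y \in U.
  by move=> YE; rewrite -[ev Y]/(evH Y) -(lfunE evH) memv_img.
have DU b : b \in D -> b \in U.
  move=> bD; have -> : b = ev (unit_at i b) by rewrite /ev mxE !eqxx.
  exact/Um/unitE.
have Ua : is_aspace U.
  rewrite /is_aspace has_algid1 ?DU //=; apply/prodvP => u v /UP[Y YE ->] /UP[Z ZE ->].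
  by rewrite -evM //; apply: Um; rewrite (subvP (asubv E)) // memv_mul.
have UA : abelian_star_subalgebra (ASpace Ua).
  split => /= [u /UP[Y YE ->]|u v /UP[Y YE ->] /UP[Z ZE ->]].
    have -> : star (ev Y) = ev (star Y) by rewrite /ev mxE.
    exact/Um/Estar.
  by rewrite -!evM // Ecom.
have /subvP := Dm _ UA (introT subvP DU); apply; exact: Um.
Qed.

End DiagonalMasa.

(** * The conditional expectation onto the fixed-point algebra *)

Section CircleArc.
Variable R : realType.
Implicit Types s t : R.

Definition arc_pt (t : R) : R[i] := cos t +i* sin t.

Lemma arc_pt0 : arc_pt 0 = 1. Proof. by rewrite /arc_pt cos0 sin0. Qed.

Lemma arc_ptD s t : arc_pt (s + t) = arc_pt s * arc_pt t.
Proof. by apply/eqP; rewrite eq_complex /= cosD sinD eqxx addrC eqxx. Qed.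

Lemma norm_arc_pt t : `|arc_pt t| = 1.
Proof. by rewrite normc_def /= cos2Dsin2 sqrtr1. Qed.

Lemma arc_ptMn t n : arc_pt (t *+ n) = arc_pt t ^+ n.
Proof. by elim: n => [|n ih]; rewrite ?mulr0n ?arc_pt0 // mulrS arc_ptD ih exprS. Qed.

Lemma arc_pt_pi : arc_pt pi = -1.
Proof. by apply/eqP; rewrite eq_complex /= cospi sinpi oppr0 !eqxx. Qed.

Lemma arc_pt_2pi : arc_pt (pi *+ 2) = 1.
Proof. by rewrite arc_ptMn arc_pt_pi sqrrN expr1n. Qed.

Lemma arc_pt_surj (z : R[i]) : `|z| = 1 -> exists2 t, 0 <= t & z = arc_pt t.
Proof.
case: z => x y; rewrite normc_def /= => /complexI h.
have e : x ^+ 2 + y ^+ 2 = 1.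
  by rewrite -[LHS]sqr_sqrtr ?h ?expr1n // addr_ge0 ?sqr_ge0.
have x1 : -1 <= x <= 1 by have := sqr_ge0 y; rewrite -ler_norml -(@expr_le1 _ 2) // real_normK ?num_real //; lra.
have ax0 := acos_ge0 x1; have axpi := acos_lepi x1; have pi0 := pi_ge0 R.
have cx : cos (acos x) = x by rewrite acosK // in_itv.
have sx : sin (acos x) = `|y|.
  by rewrite sin_acos // (_ : 1 - x ^+ 2 = y ^+ 2) ?sqrtr_sqr //; lra.
have [y0|y0] := leP 0 y.
  by exists (acos x) => //; rewrite /arc_pt cx sx ger0_norm.
exists (pi *+ 2 - acos x); first by rewrite mulr2n; lra.
by rewrite arc_ptD arc_pt_2pi mul1r /arc_pt cosN sinN cx sx ltr0_norm // opprK.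
Qed.

Lemma arc_pt_near1 (d : R) : 0 < d ->
  exists2 h, 0 < h & forall t, `|t| < h -> `|arc_pt t - 1| < d%:C.
Proof.
move=> d0; have d2 : 0 < d / 2 by lra.
have /cvgrPdist_lt/(_ _ d2)/nbhs_ballP[a /= a0 ha] := @continuous_cos R 0.
have /cvgrPdist_lt/(_ _ d2)/nbhs_ballP[b /= b0 hb] := @continuous_sin R 0.
exists (Num.min a b) => [|t]; first by rewrite lt_min a0.
rewrite lt_min => /andP[ta tb].
have := ha t; have := hb t; rewrite /ball /= !sub0r !normrN => /(_ tb) hs /(_ ta) hc.
rewrite cos0 in hc; rewrite sin0 sub0r normrN in hs.
have -> : arc_pt t - 1 = (cos t - 1)%:C + 'i%R * (sin t)%:C.
  by rewrite [LHS]complexE -complexiE /= subr0.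
apply: (le_lt_trans (ler_normD _ _)); rewrite normrM normCi mul1r !normc_real.
rewrite -rmorphD ltcR distrC; lra.
Qed.

End CircleArc.

Lemma crep_rip_cvg (R : realType) (A : cstarAlgType R) (V : preHilbert R) (r : crep A V)
    (a : nat -> A) (l : A) (u v : V) :
  ccvg a l -> (fun m => rip (r (a m) u) v) @ \oo --> rip (r l u) v.
Proof.
move=> hl; apply/cvgrPdist_le => e e0.
have c0 : 0 < hn u * hn v + 1 by rewrite ltr_wpDl ?mulr_ge0 ?hn_ge0.
have [N hN] := (ccvgP _ _).1 hl _ (divr_gt0 e0 c0).
exists N => // m Nm /=; have {hN} := hN m Nm.
rewrite ltr_pdivlMr // => h; apply/ltW/(le_lt_trans _ h).
have H w : rip (r (a m - l) u) w <= cnorm (a m - l) * (hn u * hn w).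
  apply: (le_trans (rip_le _ _)); rewrite mulrA ler_wpM2r ?hn_ge0 //.
  exact: crep_contr.
have := H v; have := H (- v); rewrite hnN crepBl !ripDl !ripNl !ripNr ler_norml.
have := cnorm_ge0 (a m - l); lra.
Qed.

Lemma circle_uniform (R : realType) (A : cstarAlgType R) (gamma : R[i] -> A -> A)
    (hg : circle_action gamma) (a : A) (e : R) : 0 < e ->
  exists2 h, 0 < h & forall t, `|t| < h -> cnorm (gamma (arc_pt t) a - a) < e.
Proof.
move=> e0; have [|d d0 hd] := act_continuous hg a _ e0 (z := 1); first exact: normr1.
have [h h0 hh] := arc_pt_near1 d0; exists h => // t th.
by have := hd _ (norm_arc_pt t) (hh t th); rewrite (act1 hg).
Qed.

Section Expectation.
Variables (R : realType) (A : cstarAlgType R) (gamma : R[i] -> A -> A).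
Hypothesis hg : circle_action gamma.
Variables (V : preHilbert R) (r : crep A V).

Lemma actD z a b : `|z| = 1 -> gamma z (a + b) = gamma z a + gamma z b.
Proof. by move=> z1; rewrite -[a]scale1r act_linear // !scale1r. Qed.

Lemma act0 z : `|z| = 1 -> gamma z 0 = 0.
Proof. by move=> z1; apply: (addrI (gamma z 0)); rewrite -actD // !addr0. Qed.

Lemma actZ z c a : `|z| = 1 -> gamma z (c *: a) = c *: gamma z a.
Proof. by move=> z1; rewrite -[c *: a]addr0 act_linear // act0 // addr0. Qed.

Lemma actB z a b : `|z| = 1 -> gamma z (a - b) = gamma z a - gamma z b.
Proof. by move=> z1; rewrite actD // -(scaleN1r b) actZ // scaleN1r. Qed.

Lemma act_sum z (I : Type) (s : seq I) (P : pred I) (F : I -> A) : `|z| = 1 ->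
  gamma z (\sum_(i <- s | P i) F i) = \sum_(i <- s | P i) gamma z (F i).
Proof. by move=> z1; apply: (big_morph (gamma z)) => [x y|]; rewrite ?actD ?act0. Qed.

Lemma act_inv z a : `|z| = 1 -> gamma z (gamma z^-1 a) = a.
Proof.
move=> z1; have z0 : z != 0 by rewrite -normr_eq0 z1 oner_eq0.
by rewrite -(actM hg) ?normfV ?z1 ?invr1 // mulfV // (act1 hg).
Qed.

Lemma act_one z : `|z| = 1 -> gamma z 1 = 1.
Proof.
by move=> z1; rewrite -[LHS]mulr1 -{2}(act_inv 1 z1) -(act_mul hg) // mul1r act_inv.
Qed.

Lemma act_injective z : `|z| = 1 -> injective (gamma z).
Proof.
move=> z1; have zV : `|z^-1| = 1 by rewrite normfV z1 invr1.
by move=> a b h; rewrite -(act_inv a zV) -(act_inv b zV) invrK h.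
Qed.

(** Twisting by an automorphism gives a second injective representation; comparing it with [r] shows
    in [act_cnorm] that [gamma z] is isometric. It is transparent so that the two unify. *)
Definition act_rep_def (z : R[i]) (z1 : `|z| = 1) : crep A V.
Proof.
apply: (@CRep R A V (fun a => r (gamma z a))).
- by move=> c a b u; rewrite act_linear // crep_linl.
- by move=> a c u v; rewrite crep_linr.
- by move=> a b u; rewrite (act_mul hg) // crepM.
- by move=> a u v; rewrite (act_star hg) // crep_adj.
- move=> a h; apply: (act_injective z1); rewrite act0 //.
  exact: (@crep_inj _ _ _ r).
Defined.

Lemma act_cnorm z a : `|z| = 1 -> cnorm (gamma z a) = cnorm a.
Proof.
move=> z1; apply/le_anti/andP; split.
  apply: (crep_iso (r := r)); first exact: cnorm_ge0.
  exact: (crep_contr (act_rep_def z1)).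
apply: (crep_iso (r := act_rep_def z1)); first exact: cnorm_ge0.
exact: (crep_contr r (gamma z a)).
Qed.

Definition root_angle (m : nat) : R := pi *+ 2 / (2 ^ m)%:R.
Definition unity_root (m : nat) : R[i] := arc_pt (root_angle m).

Lemma unity_root_norm m j : `|unity_root m ^+ j| = 1.
Proof. by rewrite normrX norm_arc_pt expr1n. Qed.

Lemma root_angle_add m k : root_angle (m + k) *+ 2 ^ k = root_angle m.
Proof.
rewrite /root_angle expnD natrM -mulr_natr.
by field; rewrite !pnatr_eq0 -!lt0n !expn_gt0.
Qed.

Lemma unity_root_expn m : unity_root m ^+ (2 ^ m) = 1.
Proof.
by rewrite /unity_root -arc_ptMn -[m in root_angle m]add0n root_angle_add /root_angle expn0 divr1 arc_pt_2pi.
Qed.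

(** Riemann sums of the Haar integral over the circle. Dyadic subdivisions are nested, so two of
    them are compared by refinement. *)
Definition circle_avg (m : nat) (a : A) : A :=
  (((2 ^ m)%:R : R)^-1)%:C *: \sum_(0 <= j < 2 ^ m) gamma (unity_root m ^+ j) a.

Lemma cnorm_avg (n : nat) (f : nat -> A) (c : R) : (0 < n)%N ->
  (forall j, (j < n)%N -> cnorm (f j) <= c) ->
  cnorm ((n%:R^-1)%:C *: \sum_(0 <= j < n) f j) <= c.
Proof.
move=> n0 h; rewrite cnormZr ger0_norm ?invr_ge0 ?ler0n //.
rewrite ler_pdivrMl ?ltr0n // big_mkord; apply: (le_trans (cnorm_sum _ _ _)).
apply: (le_trans (ler_sum _ (G := fun=> c) _)) => [j _|]; first exact: h.
by rewrite sumr_const card_ord mulr_natl.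
Qed.

Lemma circle_avg_le m a : cnorm (circle_avg m a) <= cnorm a.
Proof.
by apply: cnorm_avg => [|j _]; rewrite ?expn_gt0 // act_cnorm // unity_root_norm.
Qed.

Lemma circle_avg_lin m c a b : circle_avg m (c *: a + b) = c *: circle_avg m a + circle_avg m b.
Proof.
rewrite /circle_avg scalerA mulrC -scalerA -scalerDr; congr (_ *: _).
rewrite scaler_sumr -big_split; apply: eq_bigr => j _.
by rewrite act_linear // unity_root_norm.
Qed.

Lemma circle_avgB m a b : circle_avg m (a - b) = circle_avg m a - circle_avg m b.
Proof. by rewrite addrC -scaleN1r circle_avg_lin scaleN1r addrC. Qed.

Lemma circle_avg_refine m k a : circle_avg (m + k) a =
  circle_avg m ((((2 ^ k)%:R : R)^-1)%:C *: \sum_(0 <= j < 2 ^ k) gamma (unity_root (m + k) ^+ j) a).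
Proof.
rewrite /circle_avg expnD natrM invfM rmorphM -scalerA; congr (_ *: _).
rewrite big_nat_mul scaler_sumr; apply: eq_bigr => i _.
rewrite actZ ?unity_root_norm // act_sum ?unity_root_norm //; congr (_ *: _).
rewrite -{1}[(i * 2 ^ k)%N]add0n big_addn mulSn addnK; apply: eq_bigr => j _.
rewrite -(actM hg) ?unity_root_norm //; congr (gamma _ a).
rewrite exprD mulrC; congr (_ * _); rewrite mulnC exprM; congr (_ ^+ _).
by rewrite /unity_root -arc_ptMn root_angle_add.
Qed.

(** The finer mean is the coarse mean of an average over one arc of length [root_angle m], along
    which [a] moves by at most [c]; the coarse mean is contractive. *)
Lemma circle_avg_close m a (c : R) :
  (forall t, 0 <= t <= root_angle m -> cnorm (gamma (arc_pt t) a - a) <= c) ->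
  forall k, cnorm (circle_avg (m + k) a - circle_avg m a) <= c.
Proof.
move=> h k; rewrite circle_avg_refine -circle_avgB.
apply: (le_trans (circle_avg_le _ _)).
have n0 : ((2 ^ k)%:R : R) != 0 by rewrite pnatr_eq0 -lt0n expn_gt0.
have {2}-> : a = (((2 ^ k)%:R : R)^-1)%:C *: \sum_(0 <= j < 2 ^ k) a.
  rewrite sumr_const_nat subn0 -(scaler_nat _ a) scalerA.
  by rewrite -(rmorph_nat (real_complex R)) -rmorphM mulVf // scale1r.
rewrite -scalerBr -sumrB; apply: cnorm_avg => [|j jk]; first by rewrite expn_gt0.
rewrite /unity_root -arc_ptMn; apply: h.
have t0 : 0 <= root_angle (m + k).
  by rewrite divr_ge0 ?ler0n // mulrn_wge0 // pi_ge0.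
rewrite mulrn_wge0 //= -(root_angle_add m k).
by rewrite -[leLHS]mulr_natr -[leRHS]mulr_natr ler_wpM2l // ler_nat ltnW.
Qed.

Lemma root_angle_small (h : R) : 0 < h -> exists m, forall k, (m <= k)%N -> root_angle k < h.
Proof.
move=> h0; exists (Num.truncn (pi *+ 2 / h)).+1 => k mk.
rewrite /root_angle ltr_pdivrMr ?ltr0n ?expn_gt0 // -ltr_pdivrMl // mulrC.
apply: (lt_trans (truncnS_gt _)).
rewrite ltr_nat; exact: (leq_ltn_trans mk (ltn_expl _ _)).
Qed.

Lemma root_angle_gt0 m : 0 < root_angle m.
Proof. by rewrite divr_gt0 ?ltr0n ?expn_gt0 // mulr2n addr_gt0 ?pi_gt0. Qed.

Lemma circle_avg_cvg a : exists l, ccvg (fun m => circle_avg m a) l.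
Proof.
have [|l hl] := @cnorm_complete R A (fun m => circle_avg m a); last first.
  by exists l; apply/ccvgP.
move=> e e0; have e3 : 0 < e / 3 by lra.
have [h h0 hh] := circle_uniform hg a e3.
have [N hN] := root_angle_small h0; exists N.
have close k : (N <= k)%N -> cnorm (circle_avg k a - circle_avg N a) <= e / 3.
  move=> /subnKC <-; apply: circle_avg_close => t /andP[t0 t1].
  apply/ltW/hh; rewrite ger0_norm //; exact: le_lt_trans t1 (hN _ (leqnn _)).
move=> m n /close hm /close hn.
rewrite -[circle_avg m a](subrK (circle_avg N a)) -addrA.
apply: (le_lt_trans (ler_cnormD _ _)).
by rewrite [X in _ + X]cdistC; lra.
Qed.

Definition circle_expectation (a : A) : A := sval (cid (circle_avg_cvg a)).

Lemma expectation_cvg a : ccvg (fun m => circle_avg m a) (circle_expectation a).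
Proof. exact: svalP (cid (circle_avg_cvg a)). Qed.

Local Notation E := circle_expectation.

Lemma expectation_lin c a b : E (c *: a + b) = c *: E a + E b.
Proof.
apply: (ccvg_unique (expectation_cvg _)).
rewrite (_ : (fun m => _) = (fun m => c *: circle_avg m a + circle_avg m b)).
  by apply: ccvgD; [apply: ccvgZ|]; exact: expectation_cvg.
by apply/funext => m; rewrite circle_avg_lin.
Qed.

Lemma expectation0 : E 0 = 0.
Proof. by have := expectation_lin (-1) 0 0; rewrite scaler0 addr0 scaleN1r addNr. Qed.

Lemma circle_avg_star m a : circle_avg m (star a) = star (circle_avg m a).
Proof.
rewrite /circle_avg starZr star_sum; congr (_ *: _); apply: eq_bigr => j _.
by rewrite (act_star hg) // unity_root_norm.
Qed.

Lemma expectation_star a : E (star a) = star (E a).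
Proof.
apply: (ccvg_unique (expectation_cvg _)).
rewrite (_ : (fun m => _) = (fun m => star (circle_avg m a))).
  by apply: ccvg_star; exact: expectation_cvg.
by apply/funext => m; rewrite circle_avg_star.
Qed.

Lemma circle_avg_act m z a : `|z| = 1 -> circle_avg m (gamma z a) = gamma z (circle_avg m a).
Proof.
move=> z1; rewrite /circle_avg actZ // act_sum //; congr (_ *: _); apply: eq_bigr => j _.
by rewrite -!(actM hg) ?unity_root_norm // mulrC.
Qed.

Lemma circle_avg_root m i a : circle_avg m (gamma (unity_root m ^+ i) a) = circle_avg m a.
Proof.
elim: i => [|i ih]; first by rewrite expr0 (act1 hg).
rewrite exprS (actM hg) ?unity_root_norm ?norm_arc_pt // -[RHS]ih.
rewrite /circle_avg; congr (_ *: _); set b := gamma (_ ^+ i) a.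
have n0 : (0 < 2 ^ m)%N by rewrite expn_gt0.
rewrite -(prednK n0) [LHS]big_nat_recr // [RHS]big_nat_recl //= addrC; congr (_ + _).
  rewrite -(actM hg) ?norm_arc_pt ?unity_root_norm // -exprSr prednK //.
  by rewrite unity_root_expn expr0.
apply: eq_bigr => j _; rewrite -(actM hg) ?norm_arc_pt ?unity_root_norm //.
by rewrite -exprSr.
Qed.

(** For each [m], split [z] into a power of [unity_root m], under which [circle_avg m] is exactly
    invariant, and a remaining rotation by less than [root_angle m], which moves [a] little. *)
Lemma expectation_act z a : `|z| = 1 -> E (gamma z a) = E a.
Proof.
move=> z1; have [t t0 zE] := arc_pt_surj z1.
pose u m := circle_avg m (gamma z a) - circle_avg m a.
have hu : ccvg u 0.
  apply/ccvgP => e e0; have [h h0 hh] := circle_uniform hg a e0.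
  have [N hN] := root_angle_small h0; exists N => m Nm.
  pose i := Num.truncn (t / root_angle m).
  have th := root_angle_gt0 m.
  have /andP[l1 l2] : i%:R <= t / root_angle m < i.+1%:R.
    by apply: truncn_itv; rewrite divr_ge0 // ltW.
  rewrite ler_pdivlMr // in l1; rewrite ltr_pdivrMr // -natr1 mulrDl mul1r in l2.
  set t' := t - root_angle m *+ i.
  have t'E : t' = t - i%:R * root_angle m by rewrite mulr_natl.
  have zE' : z = unity_root m ^+ i * arc_pt t'.
    by rewrite /unity_root -arc_ptMn -arc_ptD zE addrC subrK.
  rewrite subr0 /u zE' (actM hg) ?unity_root_norm ?norm_arc_pt //.
  rewrite circle_avg_root -circle_avgB (le_lt_trans (circle_avg_le _ _)) //.
  apply: hh; rewrite ger0_norm; last by lra.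
  by have := hN m Nm; lra.
apply/eqP; rewrite -subr_eq0; apply/eqP; apply: ccvg_unique hu.
rewrite /u -scaleN1r addrC.
rewrite (_ : (fun m => _) = (fun m => (-1) *: circle_avg m a + circle_avg m (gamma z a))).
  by apply: ccvgD; [apply: ccvgZ|]; exact: expectation_cvg.
by apply/funext => m; rewrite scaleN1r addrC.
Qed.

Lemma act_expectation z a : `|z| = 1 -> gamma z (E a) = E a.
Proof.
move=> z1; rewrite -[RHS](expectation_act a z1).
apply: (@ccvg_unique _ _ (fun m => circle_avg m (gamma z a))); last exact: expectation_cvg.
apply: (@ccvg_le _ _ _ _ (fun m => cnorm (circle_avg m a - E a))); last exact: expectation_cvg.
by move=> m; rewrite circle_avg_act // -actB // act_cnorm.
Qed.

Lemma expectation_spectral a : spectral gamma 0 (E a).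
Proof. by move=> z z1; rewrite act_expectation // expr0z scale1r. Qed.

Lemma expectation_id a : spectral gamma 0 a -> E a = a.
Proof.
move=> ha; apply: (@ccvg_unique _ _ (fun m => circle_avg m a)); first exact: expectation_cvg.
rewrite (_ : (fun m => _) = (fun=> a)); first exact: ccvg_cst.
apply/funext => m; rewrite /circle_avg (eq_bigr (fun=> a)) => [|j _]; last first.
  by rewrite ha ?unity_root_norm // expr0z scale1r.
rewrite sumr_const_nat subn0 -(scaler_nat _ a) scalerA.
by rewrite -(rmorph_nat (real_complex R)) -rmorphM mulVf ?scale1r // pnatr_eq0 -lt0n expn_gt0.
Qed.

(** Rotation by [pi / |k|] multiplies [a] by -1, so invariance gives [E a = - E a]. *)
Lemma expectation_eq0 (k : int) a : k != 0 -> spectral gamma k a -> E a = 0.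
Proof.
move=> k0 ha; have n0 : (0 < absz k)%N by rewrite absz_gt0.
pose z : R[i] := arc_pt (pi / (absz k)%:R).
have zk : z ^ k = -1.
  have zn : z ^+ absz k = -1.
    by rewrite /z -arc_ptMn -(mulr_natr (pi / _)) divfK ?arc_pt_pi // pnatr_eq0 -lt0n.
  clearbody z; case: k zn {k0 ha n0} => k /= zn; first by rewrite -exprnP.
  by rewrite NegzE -exprnN /= zn invrN1.
have z1 : `|z| = 1 by exact: norm_arc_pt.
have := expectation_act a z1; rewrite ha // zk scaleN1r.
rewrite -scaleN1r -[_ *: a]addr0 expectation_lin expectation0 addr0 scaleN1r => h.
have : (2 : R)%:C *: E a = 0 by rewrite rmorph_nat scaler_nat mulr2n -{1}h addNr.
by move/eqP; rewrite scaler_eq0 => /orP[/eqP/complexI/eqP|/eqP //]; rewrite pnatr_eq0.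
Qed.

(** Complete positivity of [E]: automorphisms preserve Gram matrices, and nonnegativity survives
    averages and limits. The form is first shown real by hermitian symmetry, so that only real
    limits occur. *)
Lemma expectation_gram (I J : finType) (N : I -> J -> A) (u : J -> V) :
  0 <= \sum_i \sum_j ip (r (E (\sum_l star (N l i) * N l j)) (u j)) (u i).
Proof.
set X := fun i j => \sum_l star (N l i) * N l j.
have sX i j : star (X i j) = X j i.
  by rewrite star_sum; apply: eq_bigr => l _; rewrite starM starK.
rewrite -[X in 0 <= X]/(\sum_i \sum_j ip (r (E (X i j)) (u j)) (u i)) ge0_ReE; last first.
  rewrite rmorph_sum exchange_big; apply: eq_bigr => i _ /=.
  rewrite rmorph_sum; apply: eq_bigr => j _ /=.
  by rewrite [RHS]crep_adj -expectation_star sX; exact/esym/ipC.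
have h : (fun m => \sum_i \sum_j rip (r (circle_avg m (X i j)) (u j)) (u i)) @ \oo -->
    \sum_i \sum_j rip (r (E (X i j)) (u j)) (u i).
  apply: cvgr_sum => i; apply: cvgr_sum => j.
  exact/crep_rip_cvg/expectation_cvg.
rewrite Re_sum; under eq_bigr do rewrite Re_sum.
apply: (cvgr_to_ge h); apply: nearW => m; set c := (((2 ^ m)%:R : R)^-1).
have -> : \sum_i \sum_j rip (r (circle_avg m (X i j)) (u j)) (u i) =
    c * \sum_(0 <= k < 2 ^ m) \sum_i \sum_j
      rip (r (gamma (unity_root m ^+ k) (X i j)) (u j)) (u i).
  rewrite [in RHS]exchange_big mulr_sumr; apply: eq_bigr => i _ /=.
  rewrite [in RHS]exchange_big mulr_sumr; apply: eq_bigr => j _ /=.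
  by rewrite /circle_avg crepZl ripZl crep_suml rip_suml.
rewrite mulr_ge0 ?invr_ge0 ?ler0n //; apply: sumr_ge0 => k _.
have w1 := unity_root_norm m k; set w := _ ^+ k in w1 *.
have := Re_ge0 (gram_oppos r (fun l i => gamma w (N l i)) u).
rewrite Re_sum; congr (_ <= _); apply: eq_bigr => i _; rewrite Re_sum; apply: eq_bigr => j _.
congr (complex.Re (ip (r _ _) _)); rewrite act_sum //; apply: eq_bigr => l _.
by rewrite (act_mul hg) // (act_star hg).
Qed.

End Expectation.

(** * Compression by words *)

Section HilbertSpace.
Variables (R : realType) (H : hilbertType R).

Fact hilbert_lin (c : R[i]) (u v w : H) :
  inner H (c *: u + v) w = c * inner H u w + inner H v w.
Proof. exact: linearPl. Qed.

Fact hilbertC (u v : H) : inner H v u = Num.conj (inner H u v).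
Proof. by rewrite hermC expr0 mul1r. Qed.

Fact hilbert_ge0 (u : H) : 0 <= inner H u u.
Proof. by rewrite -inner_norm exprn_ge0. Qed.

Definition hilbert_ph : preHilbert R :=
  @PreHilbert R H (fun u v => inner H u v) hilbert_lin hilbertC hilbert_ge0.

Lemma hilbert_norm (u : H) : `|u| = (hn (u : hilbert_ph))%:C.
Proof.
apply/eqP; rewrite -(@eqrXn2 _ 2) // ?ler0c ?hn_ge0 //.
by rewrite hnC2 inner_norm -(ipE (u : hilbert_ph)).
Qed.

Lemma opnorm_le (T : H -> H) (c : R) : 0 <= c ->
  obound (T : hilbert_ph -> hilbert_ph) c -> (opnorm T <= c%:E)%E.
Proof.
move=> c0 h; apply: ge_ereal_sup => _ [u u1 <-]; rewrite lee_fin hilbert_norm /=.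
apply: (le_trans (h u)); rewrite -[leRHS]mulr1 ler_wpM2l //.
by rewrite -lecR -hilbert_norm.
Qed.

Lemma opnorm_bound (T : H -> H) (c : R) :
  (forall (k : R[i]) u, T (k *: u) = k *: T u) -> (opnorm T <= c%:E)%E ->
  obound (T : hilbert_ph -> hilbert_ph) c.
Proof.
move=> Tl h u.
have := hn_ge0 (u : hilbert_ph); rewrite le_eqVlt => /predU1P[u0|u0].
  have -> : u = 0 by apply/eqP; rewrite -normr_eq0 hilbert_norm -u0.
  by rewrite -[X in T X](scale0r (0 : H)) Tl scale0r hn0 mulr0.
set t := hn _ in u0 *; pose v := (t^-1)%:C *: u.
have v1 : `|v| <= 1.
  rewrite hilbert_norm -(rmorph1 (real_complex R)) lecR -lecR hnZ normc_real.
  by rewrite ger0_norm ?invr_ge0 ?(ltW u0) // -rmorphM lecR mulVf ?gt_eqF.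
have : ((complex.Re `|T v|)%:E <= c%:E)%E.
  by apply: le_trans h; apply: ereal_sup_ubound; exists v.
rewrite lee_fin hilbert_norm /= Tl -lecR hnZ normc_real ger0_norm ?invr_ge0 ?(ltW u0) //.
by rewrite -rmorphM lecR ler_pdivrMl // mulrC.
Qed.

Lemma crep_of_faithful (A : cstarAlgType R) (pi : A -> bop H) (hpi : faithful_rep setT pi) :
  {r : crep A hilbert_ph | forall a u, r a u = pi a u}.
Proof.
unshelve eexists; first apply: (@CRep R A hilbert_ph (fun a => pi a)); last by [].
- by move=> c a b u; apply: (rep_linear hpi).
- by move=> a c u v; exact: linearP.
- by move=> a b u; apply: (rep_mul hpi).
- by move=> a u v; apply: (rep_star hpi).
- move=> a h; apply: (rep_faithful hpi) => // u.
  apply/eqP; rewrite -normr_eq0 hilbert_norm /hn (h u) sqrtr0.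
  exact: eqxx.
Qed.

Definition hilbert_rep (A : cstarAlgType R) (pi : A -> bop H) (hpi : faithful_rep setT pi) :
  crep A hilbert_ph := sval (crep_of_faithful hpi).

Lemma hilbert_repE (A : cstarAlgType R) (pi : A -> bop H) (hpi : faithful_rep setT pi) a u :
  hilbert_rep hpi a u = pi a u.
Proof. exact: (svalP (crep_of_faithful hpi)). Qed.

Lemma bop_of (T : H -> H) (c : R) :
  linear T -> obound (T : hilbert_ph -> hilbert_ph) c -> {b : bop H | forall u, b u = T u}.
Proof.
move=> Tl Tb; pose Tm := GRing.isLinear.Build R[i] H H _ T Tl.
pose TL : {linear H -> H} := HB.pack T Tm.
have hb : exists M : R, forall u : H, `|TL u| <= M%:C * `|u|.
  by exists c => u; rewrite !hilbert_norm -rmorphM lecR; exact: Tb.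
by exists (Bop hb).
Qed.

End HilbertSpace.

Section Spectral.
Variables (R : realType) (A : cstarAlgType R) (gamma : R[i] -> A -> A).
Hypothesis hg : circle_action gamma.

Lemma spectralM (k l : int) a b :
  spectral gamma k a -> spectral gamma l b -> spectral gamma (k + l) (a * b).
Proof.
move=> ha hb z z1; rewrite (act_mul hg) // ha // hb // -scalerAl -scalerAr scalerA.
by rewrite -expfzDr // -normr_eq0 z1 oner_eq0.
Qed.

Lemma spectral_star (k : int) a : spectral gamma k a -> spectral gamma (- k) (star a).
Proof.
move=> ha z z1; rewrite (act_star hg) // ha // starZ; congr (_ *: _).
have y1 : `|z ^ k| = 1.
  by case: k {ha} => k; rewrite ?NegzE -?exprnP -?exprnN ?normfV normrX z1 expr1n ?invr1.
have y0 : z ^ k != 0 by rewrite -normr_eq0 y1 oner_eq0.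
by apply: (mulfI y0); rewrite -normCK y1 expr1n -invr_expz mulfV.
Qed.

Lemma spectral_lin (k : int) c a b :
  spectral gamma k a -> spectral gamma k b -> spectral gamma k (c *: a + b).
Proof.
move=> ha hb z z1; rewrite (act_linear hg) // ha // hb // scalerDr !scalerA.
by rewrite mulrC.
Qed.

Variables (V : preHilbert R) (r : crep A V).

Lemma spectral0_closed : closed_subalg (spectral gamma 0).
Proof.
split.
- by move=> z z1; rewrite (act_one hg) // expr0z scale1r.
- by move=> c a b; exact: spectral_lin.
- by move=> a b ha hb; rewrite -[0]addr0; exact: spectralM.
- move=> u l hu hl z z1; rewrite expr0z scale1r.
  apply: (@ccvg_unique _ _ u) => //.
  apply: (@ccvg_le _ _ _ _ (fun m => cnorm (u m - l))) => // m.
  rewrite -{1}[u m](_ : gamma z (u m) = _); last by rewrite hu // expr0z scale1r.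
  by rewrite -(actB hg) // (act_cnorm hg r).
Qed.

End Spectral.

Section Families.
Variables (R : realType) (A : cstarAlgType R) (V : preHilbert R) (r : crep A V) (J : finType).

Lemma family_form_ge0 (Z : J -> J -> A) (u : J -> V) :
  (forall i j, star (Z i j) = Z j i) ->
  0 <= \sum_i \sum_j rip (r (Z i j) (u j)) (u i) ->
  0 <= \sum_i \sum_j ip (r (Z i j) (u j)) (u i).
Proof.
move=> sZ h; rewrite ge0_ReE; first by rewrite Re_sum; under eq_bigr do rewrite Re_sum.
rewrite rmorph_sum exchange_big; apply: eq_bigr => i _ /=.
rewrite rmorph_sum; apply: eq_bigr => j _ /=.
by rewrite [RHS]crep_adj sZ; exact/esym/ipC.
Qed.

Lemma sum_enum_val (W : nmodType) (F : J -> W) :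
  \sum_p F p = \sum_(i < #|J|) F (enum_val i).
Proof. exact: (reindex _ (onW_bij _ (enum_val_bij J))). Qed.

(** Complete positivity for an arbitrary finite index type. It is applied to pairs [(i, al)], that
    is, to matrices whose entries are themselves matrices. *)
Lemma cp_family (S : set A) (Z : J -> J -> A) (W : preHilbert R) (T : A -> W -> W) :
  closed_subalg S -> (forall p q, S (Z p q)) ->
  (forall u : J -> V, 0 <= \sum_p \sum_q ip (r (Z p q) (u q)) (u p)) ->
  (forall n (M : 'M[A]_n), positive_mx S M ->
    forall u : 'I_n -> W, 0 <= \sum_i \sum_j ip (T (M i j) (u j)) (u i)) ->
  forall u : J -> W, 0 <= \sum_p \sum_q ip (T (Z p q) (u q)) (u p).
Proof.
move=> hS SZ pZ pT u; pose M : 'M[A]_#|J| := \matrix_(i, j) Z (enum_val i) (enum_val j).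
have pM : positive_mx S M.
  apply: (oppos_positive_mx (r := r)) => //; first by move=> i j; rewrite mxE.
  move=> v; have := pZ (fun p => v (enum_rank p)).
  rewrite sum_enum_val; congr (_ <= _); apply: eq_bigr => i _.
  rewrite sum_enum_val; apply: eq_bigr => j _.
  by rewrite mxE !enum_valK.
have := pT _ _ pM (fun i => u (enum_val i)).
rewrite sum_enum_val; congr (_ <= _); apply: eq_bigr => i _.
by rewrite sum_enum_val; apply: eq_bigr => j _; rewrite mxE.
Qed.

End Families.

Section Compression.
Variables (R : realType) (A : cstarAlgType R) (gamma : R[i] -> A -> A).
Hypothesis hg : circle_action gamma.
Variables (H : hilbertType R) (pi : A -> bop H).
Hypothesis hpi : faithful_rep setT pi.
Local Notation V := (hilbert_ph H).
Local Notation r := (hilbert_rep hpi).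
Local Notation S := (spectral gamma 0).
Local Notation E := (circle_expectation hg r).

Variables (B : fdCstarAlgType R) (phi : A -> B).
Hypothesis hphi : contractive_cp S phi.

Variables (K N M0 : nat) (X : 'I_K.+1 -> A) (deg : 'I_K.+1 -> 'I_N).
Hypothesis hX : forall al, spectral gamma (M0 + deg al)%:Z (X al).
Hypothesis hXX : forall k : 'I_N, \sum_(al | deg al == k) X al * star (X al) = 1.

Let hS : closed_subalg S := spectral0_closed hg r.

Lemma sum_XX : \sum_al X al * star (X al) = (N%:R : R)%:C *: 1.
Proof.
rewrite (partition_big deg xpredT) //= (eq_bigr (fun=> 1)) => [|k _]; last exact: hXX.
by rewrite sumr_const card_ord rmorph_nat scaler_nat.
Qed.

Definition entry al be (a : A) : A := E (star (X al) * a * X be).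

Lemma entry_lin al be c a b : entry al be (c *: a + b) = c *: entry al be a + entry al be b.
Proof. by rewrite /entry mulrDr mulrDl -scalerAr -scalerAl expectation_lin. Qed.

Lemma entry_spectral al be a : S (entry al be a).
Proof. exact: expectation_spectral. Qed.

(** The product [X_al^* a X_be] has degree [g + deg be - deg al], as [M0] cancels; [E] fixes degree
    0 and kills every other degree. *)
Lemma entry_degree al be (g : nat) a : spectral gamma g%:Z a ->
  entry al be a = if (deg al == g + deg be :> nat)%N then star (X al) * a * X be else 0.
Proof.
move=> ha.
have h := spectralM hg (spectralM hg (spectral_star hg (hX al)) ha) (hX be).
rewrite /entry; case: eqP => e.
  apply: expectation_id; move: h; rewrite e.
  by rewrite (_ : - _ + _ + _ = 0) //; lia.
by apply: expectation_eq0 h; lia.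
Qed.

Let phi_lin c a b : S a -> S b -> phi (c *: a + b) = c *: phi a + phi b.
Proof. by case: hphi => h _ _; exact: h. Qed.

Let S0 : S 0.
Proof. by have := csub_lin hS (-1) (csub1 hS) (csub1 hS); rewrite scaleN1r addNr. Qed.

Let phi0 : phi 0 = 0.
Proof. by have := phi_lin (-1) S0 S0; rewrite scaler0 addr0 scaleN1r addNr. Qed.

Let phi_pos n (M : 'M[A]_n) : positive_mx S M -> forall u : 'I_n -> reg_preHilbert B,
  0 <= \sum_i \sum_j ip (regrep B (phi (M i j)) (u j)) (u i).
Proof.
case: hphi => _ h _ /h /(positive_mx_oppos (regrep B)) pM u; have := pM u.
by congr (_ <= _); apply: eq_bigr => i _; apply: eq_bigr => j _; rewrite mxE.
Qed.

Local Notation C := (mxalg (regrep B) K : fdCstarAlgType R).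

Definition compress (a : A) : C := \matrix_(al, be) phi (entry al be a).

Lemma compress_lin c a b : compress (c *: a + b) = c *: compress a + compress b.
Proof.
apply/matrixP => al be; rewrite !mxE entry_lin phi_lin //; exact: entry_spectral.
Qed.

Lemma mxrep_form n (Y : 'I_n -> 'I_n -> C) (u : 'I_n -> ph_pow (reg_preHilbert B) K.+1) :
  \sum_i \sum_j ip (mxrep (regrep B) K (Y i j) (u j)) (u i) =
  \sum_(p : 'I_n * 'I_K.+1) \sum_(q : 'I_n * 'I_K.+1)
    ip (regrep B ((Y p.1 q.1 : 'M[B]_K.+1) p.2 q.2) (u q.1 q.2)) (u p.1 p.2).
Proof.
rewrite -(pair_bigA _ (fun i al => \sum_(q : 'I_n * 'I_K.+1)
    ip (regrep B ((Y i q.1 : 'M[B]_K.+1) al q.2) (u q.1 q.2)) (u i al))).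
apply: eq_bigr => i _ /=; rewrite exchange_big /=.
under [RHS]eq_bigr => al _ do rewrite -(pair_bigA _ (fun j be =>
    ip (regrep B ((Y i j : 'M[B]_K.+1) al be) (u j be)) (u i al))) /=.
apply: eq_bigr => al _; apply: eq_bigr => j _; rewrite ffunE.
exact: (@ip_suml R (reg_preHilbert B)).
Qed.

(** Indexed by pairs, the block matrix of entries of [P^* P] is [E] of the Gram matrix with factor
    [P l i * X al]. It is positive over [A^0], so [phi] can be applied to it. *)
Lemma compress_oppos n (M : 'M[A]_n) : positive_mx setT M ->
  oppos (mxrep (regrep B) K) (map_mx compress M).
Proof.
move=> [P _ ->] u; rewrite mxrep_form.
have := cp_family (r := r) hS (J := ('I_n * 'I_K.+1)%type)
  (Z := fun p q => entry p.2 q.2 ((star_mx P *m P) p.1 q.1))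
  (T := fun b => regrep B (phi b)) (fun p q => entry_spectral _ _ _) _ phi_pos.
move=> /(_ _ (fun p => u p.1 p.2)) h.
suff /h : forall v : 'I_n * 'I_K.+1 -> V, 0 <= \sum_p \sum_q
    ip (r (entry p.2 q.2 ((star_mx P *m P) p.1 q.1)) (v q)) (v p).
  congr (_ <= _); apply: eq_bigr => p _; apply: eq_bigr => q _.
  by rewrite [in RHS]mxE [in RHS]mxE.
move=> v {h}.
have := expectation_gram hg r (fun l (p : 'I_n * 'I_K.+1) => P l p.1 * X p.2) v.
congr (_ <= _); apply: eq_bigr => p _; apply: eq_bigr => q _.
congr (ip (r (E _) _) _); rewrite mxE mulr_sumr mulr_suml; apply: eq_bigr => l _.
by rewrite mxE starM !mulrA.
Qed.

Let hq_phi1 (f : reg_preHilbert B) : rip (regrep B (phi 1) f) f <= hq f.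
Proof.
apply: (le_trans (rip_le _ _)); rewrite -hn2 expr2 ler_wpM2r ?hn_ge0 //.
apply: (le_trans (crep_contr _ _ _)); rewrite -[leRHS]mul1r ler_wpM2r ?hn_ge0 //.
by case: hphi => _ _ h; rewrite -(cnorm1 A); apply: h; exact: (csub1 hS).
Qed.

(* For each degree k the row (X_al) with deg al = k is a coisometry. *)
Lemma row_coisometry (k : 'I_N) (u : 'I_K.+1 -> V) :
  hq (\sum_(al | deg al == k) r (X al) (u al)) <= \sum_(al | deg al == k) hq (u al).
Proof.
set w := \sum_(al | _) _.
(* Expanding these squares gives the sum of the [hq (u al)], minus [2 hq w], plus [hq (r 1 w)]. *)
have : 0 <= \sum_(al | deg al == k) hq (u al - r (star (X al)) w).
  by apply: sumr_ge0 => al _; exact: hq_ge0.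
under eq_bigr do rewrite hqB.
rewrite big_split sumrB /= -mulr_sumr.
have -> : \sum_(al | deg al == k) rip (u al) (r (star (X al)) w) = hq w.
  rewrite {2}/w /hq rip_suml; apply: eq_bigr => al _.
  by rewrite crep_rip.
have -> : \sum_(al | deg al == k) hq (r (star (X al)) w) = hq (r 1 w).
  rewrite -crep_1rip -(hXX k) crep_suml rip_suml; apply: eq_bigr => al _.
  by rewrite crep_hq starK.
have := crep_1le r w; lra.
Qed.

(** By [entry_degree] the matrix of entries of 1 is block diagonal in the degree, and the form of
    each block is the squared norm of a row applied to [u]. *)
Lemma entry_one_le (u : 'I_K.+1 -> V) :
  \sum_al \sum_be rip (r (entry al be 1) (u be)) (u al) <= \sum_al hq (u al).
Proof.
have one0 : spectral gamma 0%:Z 1 by exact: (csub1 hS).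
rewrite [leRHS](partition_big deg xpredT) //= [leLHS](partition_big deg xpredT) //=.
apply: ler_sum => k _; apply: le_trans (row_coisometry k u).
rewrite {1}/hq rip_sumr le_eqVlt; apply/orP; left; apply/eqP; apply: eq_bigr => al /eqP alk.
rewrite rip_suml [RHS]big_mkcond; apply: eq_bigr => be _.
rewrite (entry_degree al be one0) add0n -val_eqE /= -alk eq_sym.
by case: ifP => _; rewrite ?crep0l /rip ?ip0l // mulr1 crepM crep_adj starK.
Qed.

(** [entry_one_le] makes the matrix [Z], identity minus entries of 1, positive over [A^0]. Applying
    [phi] bounds the form of [compress 1] by that of the diagonal matrix [phi 1], and [phi] is
    contractive. *)
Lemma compress_one_le (f : ph_pow (reg_preHilbert B) K.+1) :
  rip (mxrep (regrep B) K (compress 1) f) f <= hq f.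
Proof.
pose Z (al be : 'I_K.+1) : A := (if al == be then 1 else 0) - entry al be 1.
have Zphi al be : phi (Z al be) = (if al == be then phi 1 else 0) - phi (entry al be 1).
  rewrite /Z addrC -scaleN1r phi_lin; last first.
  - by case: ifP => _ //; exact: (csub1 hS).
  - exact: entry_spectral.
  by rewrite scaleN1r addrC; case: ifP => // _; rewrite phi0.
have SZ al be : S (Z al be).
  rewrite /Z addrC -scaleN1r; apply: (csub_lin hS); first exact: entry_spectral.
  by case: ifP => _ //; exact: (csub1 hS).
have h := cp_family (r := r) hS SZ (T := fun b => regrep B (phi b)) _ phi_pos.
have {h} : 0 <= \sum_al \sum_be ip (regrep B (phi (Z al be)) (f be)) (f al).
  apply: h => u; apply: family_form_ge0 => [al be|].
    rewrite /Z starB eq_sym (fun_if star) star1 star0 /entry -expectation_star.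
    by rewrite !starM starK star1 mulrA.
  have sZ al : \sum_be rip (r (Z al be) (u be)) (u al) =
      hq (r 1 (u al)) - \sum_be rip (r (entry al be 1) (r 1 (u be))) (r 1 (u al)).
    rewrite -crep_1rip (bigD1 al) //= [X in _ - X](bigD1 al) //= opprD addrA.
    (* [r 1] may be a proper projection; replacing [u] by its image under it does not change the
       form of the entries, and [entry_one_le] is then used at the projected vectors. *)
    have cut be : rip (r (entry al be 1) (r 1 (u be))) (r 1 (u al)) =
        rip (r (entry al be 1) (u be)) (u al).
      by rewrite -crepM mulr1 ripC crep_rip star1 -crepM mul1r ripC.
    rewrite cut; congr (_ + _).
      by rewrite /Z eqxx crepBl ripDl ripNl.
    rewrite -sumrN; apply: eq_bigr => be ne.
    by rewrite cut /Z eq_sym (negPf ne) sub0r crepNl ripNl.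
  under eq_bigr do rewrite sZ.
  by rewrite sumrB subr_ge0; exact: entry_one_le.
move/Re_ge0; rewrite Re_sum; under eq_bigr do rewrite Re_sum.
have -> : \sum_al \sum_be complex.Re (ip (regrep B (phi (Z al be)) (f be)) (f al)) =
    \sum_al rip (regrep B (phi 1) (f al)) (f al) -
    \sum_al rip (\sum_be regrep B (phi (entry al be 1)) (f be)) (f al).
  rewrite -sumrB; apply: eq_bigr => al _; rewrite rip_suml.
  rewrite (bigD1 al) //= [X in _ - X](bigD1 al) //= opprD addrA; congr (_ + _).
    rewrite -[LHS]/(@rip R (reg_preHilbert B) (phi (Z al al) * f al) (f al)).
    by rewrite Zphi eqxx mulrBl ripDl ripNl.
  rewrite -sumrN; apply: eq_bigr => be ne.
  rewrite -[LHS]/(@rip R (reg_preHilbert B) (phi (Z al be) * f be) (f al)).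
  by rewrite Zphi eq_sym (negPf ne) sub0r mulNr ripNl.
rewrite subr_ge0 rip_pow => h.
apply: (@le_trans _ _ (\sum_al rip (regrep B (phi 1) (f al)) (f al))).
  apply: le_trans h; rewrite le_eqVlt; apply/orP; left; apply/eqP; apply: eq_bigr => al _.
  by rewrite ffunE; congr rip; apply: eq_bigr => be _; rewrite mxE.
by rewrite hq_pow; apply: ler_sum => al _; exact: hq_phi1.
Qed.

Lemma compress_contractive_cp : contractive_cp setT compress.
Proof.
split.
- by move=> c a b _ _; exact: compress_lin.
- move=> n M pM; apply: (oppos_positive_mx (r := mxrep (regrep B) K)) => //.
  exact: compress_oppos.
- move=> a _; apply: mxnorm_le; first exact: cnorm_ge0.
  apply: (cp_contractive (T := fun a => mxrep (regrep B) K (compress a))).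
  + by move=> c a1 b u; rewrite compress_lin crep_linl.
  + by move=> a1 c u; rewrite crepZr.
  + move=> M /compress_oppos pM u; have := pM u.
    by congr (_ <= _); apply: eq_bigr => i _; apply: eq_bigr => j _; rewrite mxE.
  + exact: compress_one_le.
Qed.

End Compression.

(** * From matrices over [B] back to operators *)

Section Decompression.
Variables (R : realType) (A : cstarAlgType R) (H : hilbertType R) (pi : A -> bop H).
Hypothesis hpi : faithful_rep setT pi.
Local Notation V := (hilbert_ph H).
Local Notation r := (hilbert_rep hpi).
Variables (B : fdCstarAlgType R) (psi : B -> bop H).
Hypothesis hpsi : contractive_cp_op psi.
Variables (K N : nat) (X : 'I_K.+1 -> A).
Hypothesis N_gt0 : (0 < N)%N.
Hypothesis hXN : \sum_al X al * star (X al) = (N%:R : R)%:C *: 1.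
Local Notation C := (mxalg (regrep B) K : fdCstarAlgType R).

Let psi_lin c a b (u : V) : psi (c *: a + b) u = c *: (psi a u : V) + psi b u.
Proof. by case: hpsi => h _ _; exact: h. Qed.

Let psi_linr a c (u v : V) : psi a (c *: u + v) = c *: (psi a u : V) + psi a v.
Proof. exact: linearP. Qed.

Let psi0 (u : V) : psi 0 u = 0 :> V.
Proof. by have := psi_lin (-1) 0 0 u; rewrite scaler0 addr0 scaleN1r addNr. Qed.

Let psi_bound a : obound (psi a : V -> V) (cnorm a).
Proof. by apply: opnorm_bound => [k u|]; [exact: linearZ | case: hpsi]. Qed.

Definition decompress_fun (M : C) (u : V) : V :=
  (N%:R^-1 : R)%:C *: \sum_al \sum_be
    r (X al) (psi ((M : 'M[B]_K.+1) al be) (r (star (X be)) u)).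

Lemma decompress_linl c (M M' : C) u :
  decompress_fun (c *: M + M') u = c *: decompress_fun M u + decompress_fun M' u.
Proof.
rewrite /decompress_fun scalerA mulrC -scalerA -scalerDr; congr (_ *: _).
rewrite scaler_sumr -big_split; apply: eq_bigr => al _ /=.
rewrite scaler_sumr -big_split; apply: eq_bigr => be _ /=.
by rewrite mxE mxalg_scaleE psi_lin crep_linr.
Qed.

Lemma decompress_linr (M : C) : linear (decompress_fun M).
Proof.
move=> c u v; rewrite /decompress_fun [RHS]addrC scalerA mulrC -scalerA addrC -scalerDr; congr (_ *: _).
rewrite scaler_sumr -big_split; apply: eq_bigr => al _ /=.
rewrite scaler_sumr -big_split; apply: eq_bigr => be _ /=.
by rewrite crep_linr psi_linr crep_linr.
Qed.

Lemma ip_decompress (M : C) (u w : V) :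
  ip (decompress_fun M u) w = (N%:R^-1 : R)%:C * \sum_al \sum_be
    ip (psi ((M : 'M[B]_K.+1) al be) (r (star (X be)) u) : V) (r (star (X al)) w).
Proof.
rewrite ipZl ip_suml; congr (_ * _); apply: eq_bigr => al _.
by rewrite ip_suml; apply: eq_bigr => be _; rewrite crep_adj.
Qed.

Lemma rip_decompress (M : C) (u w : V) :
  rip (decompress_fun M u) w = N%:R^-1 * \sum_al \sum_be
    rip (psi ((M : 'M[B]_K.+1) al be) (r (star (X be)) u) : V) (r (star (X al)) w).
Proof.
rewrite ripZl rip_suml; congr (_ * _); apply: eq_bigr => al _.
by rewrite rip_suml; apply: eq_bigr => be _; rewrite crep_rip.
Qed.

Lemma sum_hq_star (u : V) : \sum_al hq (r (star (X al)) u) <= N%:R * hq u.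
Proof.
have -> : \sum_al hq (r (star (X al)) u) = N%:R * hq (r 1 u).
  rewrite -crep_1rip -ripZl -crepZl -hXN crep_suml rip_suml; apply: eq_bigr => al _.
  by rewrite crep_hq starK.
by rewrite ler_wpM2l ?ler0n // crep_1le.
Qed.

(** Cauchy-Schwarz over the [K.+1] indices, proved from [2 s t <= s^2 + t^2]. *)
Lemma sum_hn_star (u : V) :
  (\sum_al hn (r (star (X al)) u)) ^+ 2 <= K.+1%:R * (N%:R * hq u).
Proof.
apply: (@le_trans _ _ (K.+1%:R * \sum_al hq (r (star (X al)) u))); last first.
  by rewrite ler_wpM2l ?ler0n // sum_hq_star.
set f := fun al => hn (r (star (X al)) u).
have -> : \sum_al hq (r (star (X al)) u) = \sum_al f al ^+ 2.
  by apply: eq_bigr => al _; rewrite hn2.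
rewrite -/(f _) -[X in (X ^+ 2 <= _)]/(\sum_al f al).
rewrite expr2 mulr_suml.
apply: (@le_trans _ _ (\sum_al \sum_be (f al ^+ 2 + f be ^+ 2) / 2)).
  apply: ler_sum => al _; rewrite mulr_sumr; apply: ler_sum => be _.
  by have := sqr_ge0 (f al - f be); rewrite ler_pdivlMr //; nra.
under eq_bigr do rewrite -mulr_suml big_split sumr_const card_ord /=.
rewrite -mulr_suml big_split /= sumr_const card_ord -mulr_natl sumrMnl -mulr_natl.
rewrite ler_pdivrMr //; lra.
Qed.

Lemma decompress_bop (M : C) : {b : bop H | forall u, b u = decompress_fun M u}.
Proof.
pose c := `|(N%:R^-1 : R)| * \sum_al \sum_be
  (cnorm (X al) * (cnorm ((M : 'M[B]_K.+1) al be) * cnorm (star (X be)))).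
apply: (@bop_of _ _ (decompress_fun M) c); first exact: decompress_linr.
move=> u; rewrite -lecR hnZ normc_real -rmorphM lecR -mulrA ler_wpM2l ?normr_ge0 //.
apply: (le_trans (hn_sum _ _ _)); rewrite mulr_suml; apply: ler_sum => al _.
apply: (le_trans (hn_sum _ _ _)); rewrite mulr_suml; apply: ler_sum => be _.
apply: (le_trans (crep_contr _ _ _)); rewrite -!mulrA ler_wpM2l ?cnorm_ge0 //.
apply: (le_trans (psi_bound _ _)); rewrite ler_wpM2l ?cnorm_ge0 //.
exact: crep_contr.
Qed.

Definition decompress (M : C) : bop H := sval (decompress_bop M).

Lemma decompressE M u : decompress M u = decompress_fun M u.
Proof. exact: (svalP (decompress_bop M)). Qed.

Let psi_pos n (M : 'M[B]_n) : positive_mx setT M -> forall u : 'I_n -> V,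
  0 <= \sum_i \sum_j ip (psi (M i j) (u j) : V) (u i).
Proof. by case: hpsi => _ h _; exact: h. Qed.

Lemma decompress_pos n (M : 'M[C]_n) : positive_mx setT M -> forall u : 'I_n -> V,
  0 <= \sum_i \sum_j ip (decompress_fun (M i j) (u j)) (u i).
Proof.
move=> pM u; have oM := positive_mx_oppos (mxrep (regrep B) K) pM.
pose Z (p q : 'I_n * 'I_K.+1) : B := (M p.1 q.1 : 'M[B]_K.+1) p.2 q.2.
have h := cp_family (r := regrep B) (@closed_subalgT _ _) (Z := Z)
  (T := fun b => (psi b : V -> V)) (fun p q => I) _ psi_pos.
suff /h /(_ (fun p => r (star (X p.2)) (u p.1))) : forall w : 'I_n * 'I_K.+1 -> reg_preHilbert B,
    0 <= \sum_p \sum_q ip (regrep B (Z p q) (w q)) (w p).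
  move=> hp; have -> : \sum_i \sum_j ip (decompress_fun (M i j) (u j)) (u i) =
     (N%:R^-1 : R)%:C * \sum_p \sum_q
       ip (psi (Z p q) (r (star (X q.2)) (u q.1)) : V) (r (star (X p.2)) (u p.1)).
    rewrite -(pair_bigA _ (fun i al => \sum_q
      ip (psi (Z (i, al) q) (r (star (X q.2)) (u q.1)) : V) (r (star (X al)) (u i)))).
    rewrite mulr_sumr; apply: eq_bigr => i _.
    under [in RHS]eq_bigr => al _ do rewrite -(pair_bigA _ (fun j be =>
      ip (psi (Z (i, al) (j, be)) (r (star (X be)) (u j)) : V) (r (star (X al)) (u i)))).
    rewrite [in RHS]exchange_big mulr_sumr; apply: eq_bigr => j _ /=.
    exact: ip_decompress.
  by rewrite mulr_ge0 // ler0c invr_ge0 ler0n.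
move=> w {h}.
have := oM (fun i => [ffun al => w (i, al)]); rewrite mxrep_form.
congr (_ <= _); apply: eq_bigr => -[i al] _; apply: eq_bigr => -[j be] _ /=.
by rewrite !ffunE.
Qed.

Lemma decompress_contractive_cp : contractive_cp_op decompress.
Proof.
split.
- by move=> c M M' u; rewrite !decompressE decompress_linl.
- move=> n M pM u; have := decompress_pos pM u.
  by congr (_ <= _); apply: eq_bigr => i _; apply: eq_bigr => j _; rewrite decompressE.
move=> M; apply: opnorm_le; first exact: cnorm_ge0.
move=> u; rewrite decompressE.
apply: (cp_contractive (T := decompress_fun)).
- by move=> c M1 M' v; rewrite decompress_linl.
- move=> M1 c v; have h := @decompress_linr M1.
  have h0 : decompress_fun M1 0 = 0.
    by have := h (-1) 0 0; rewrite scaler0 addr0 scaleN1r addNr.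
  by have := h c v 0; rewrite h0 !addr0.
- by move=> M1; exact: decompress_pos.
move=> v; rewrite rip_decompress ler_pdivrMl ?ltr0n //.
apply: le_trans (sum_hq_star v); apply: ler_sum => al _.
rewrite (bigD1 al) //= big1 => [|be ne]; last first.
  by rewrite mxE eq_sym (negPf ne) mulr0n psi0 /rip ip0l.
rewrite mxE eqxx addr0; apply: (le_trans (rip_le _ _)).
rewrite -hn2 expr2 ler_wpM2r ?hn_ge0 //.
by have := psi_bound 1 (r (star (X al)) v); rewrite cnorm1 mul1r.
Qed.

(** Entrywise errors cost the factor [K.+1]: pairing with [w] leaves [eta / N] times a product of
    two sums of norms, each bounded through [sum_hn_star] by the root of [K.+1 * N], so [N]
    cancels. *)
Lemma decompress_close (M : C) (e : 'I_K.+1 -> 'I_K.+1 -> A) (eta : R) :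
  0 <= eta ->
  (forall al be (u : V), hn ((psi ((M : 'M[B]_K.+1) al be) u : V) - r (e al be) u) <= eta * hn u) ->
  forall u : V, hn (decompress_fun M u -
    r ((N%:R^-1 : R)%:C *: \sum_al \sum_be X al * e al be * star (X be)) u)
    <= eta * K.+1%:R * hn u.
Proof.
move=> eta0 h u; apply: hn_le_dual; first by rewrite !mulr_ge0 ?hn_ge0 ?ler0n.
move=> w; rewrite ripDl ripNl rip_decompress crepZl ripZl -mulrBr.
rewrite crep_suml rip_suml -sumrB ler_pdivrMl ?ltr0n //.
set v := fun al => r (star (X al)) u; set z := fun al => r (star (X al)) w.
apply: (@le_trans _ _ (eta * ((\sum_be hn (v be)) * \sum_al hn (z al)))).
  rewrite mulrA mulr_sumr; apply: ler_sum => al _.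
  rewrite crep_suml rip_suml -sumrB mulr_sumr mulr_suml; apply: ler_sum => be _.
  rewrite 2!crepM crep_rip -ripNl -ripDl.
  by apply: (le_trans (rip_le _ _)); rewrite ler_wpM2r ?hn_ge0.
rewrite [leRHS](_ : _ = eta * (K.+1%:R * (N%:R * (hn u * hn w)))); last by ring.
rewrite ler_wpM2l //.
have a0 : 0 <= \sum_be hn (v be) by apply: sumr_ge0 => be _; exact: hn_ge0.
have b0 : 0 <= \sum_al hn (z al) by apply: sumr_ge0 => be _; exact: hn_ge0.
have c0 : 0 <= K.+1%:R * (N%:R * (hn u * hn w)) :> R by rewrite !mulr_ge0 ?ler0n ?hn_ge0.
rewrite -(@ler_pXn2r _ 2) ?nnegrE ?mulr_ge0 ?hn_ge0 //.
rewrite exprMn [leRHS](_ : _ = (K.+1%:R * (N%:R * hq u)) * (K.+1%:R * (N%:R * hq w))).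
  by apply: ler_pM; rewrite ?exprn_ge0 ?sum_hn_star.
by rewrite -!hn2; ring.
Qed.

End Decompression.

(** * Fejer means and the resulting approximation *)

Section CompressionApprox.
Variables (R : realType) (A : cstarAlgType R) (gamma : R[i] -> A -> A).
Hypothesis hg : circle_action gamma.
Variables (H : hilbertType R) (pi : A -> bop H).
Hypothesis hpi : faithful_rep setT pi.
Local Notation V := (hilbert_ph H).
Local Notation r := (hilbert_rep hpi).
Variables (K N M0 : nat) (X : 'I_K.+1 -> A) (deg : 'I_K.+1 -> 'I_N).
Hypothesis hX : forall al, spectral gamma (M0 + deg al)%:Z (X al).
Hypothesis hXX : forall k : 'I_N, \sum_(al | deg al == k) X al * star (X al) = 1.
Local Notation entry := (entry hg hpi X).

(* Summing over the degrees gives a Fejer mean: [a] of degree [g] is met [N - g] times. *)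
Lemma fejer_mean (g : nat) (a : A) : spectral gamma g%:Z a ->
  \sum_al \sum_be X al * entry al be a * star (X be) = ((N - g)%:R : R)%:C *: a.
Proof.
move=> ha; rewrite exchange_big /=.
(* For fixed [be] only the [al] of degree [g + deg be] contribute. If this is below [N] they form a
   whole row, whose [X_al X_al^*] sum to 1; otherwise there are none. *)
have -> : \sum_be \sum_al X al * entry al be a * star (X be) =
    \sum_(be | (g + deg be < N)%N) a * (X be * star (X be)).
  rewrite [RHS]big_mkcond; apply: eq_bigr => be _.
  under eq_bigr => al _ do rewrite (entry_degree hg hpi hX al be ha).
  case: ifP => lt.
    rewrite -[RHS]mul1r -(hXX (Ordinal lt)) mulr_suml [RHS]big_mkcond.
    apply: eq_bigr => al _; rewrite -val_eqE /=.
    by case: ifP => _; rewrite ?mulr0 ?mul0r // !mulrA.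
  rewrite big1 // => al _; case: eqP => [e|_]; last by rewrite mulr0 mul0r.
  by move: (ltn_ord (deg al)); rewrite e lt.
rewrite -mulr_sumr (partition_big deg (fun k : 'I_N => (g + k < N)%N)) //=.
rewrite (eq_bigr (fun=> 1)) => [|k lt]; last first.
  rewrite -(hXX k); apply: eq_bigl => be.
  by case: eqP => [->|]; rewrite ?lt ?andbF.
have -> : \sum_(k < N | (g + k < N)%N) 1 = ((N - g)%:R : R)%:C *: (1 : A).
  rewrite (eq_bigl (fun k : 'I_N => (k < N - g)%N)) => [|k]; last by rewrite ltn_subRL.
  rewrite -(big_ord_widen N (fun=> 1)) ?leq_subr // sumr_const card_ord.
  by rewrite rmorph_nat scaler_nat.
by rewrite -scalerAr mulr1.
Qed.

Variables (B : fdCstarAlgType R) (phi : A -> B) (psi : B -> bop H) (D : {aspace B}).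
Hypothesis hphi : contractive_cp (spectral gamma 0) phi.
Hypothesis hpsi : contractive_cp_op psi.
Hypothesis hD : maximal_abelian D.

(** The two summands of the error are the entrywise approximation through [decompress_close] and the
    defect [g / N] of the Fejer coefficient. *)
Lemma cp_approx_compress (Omega : set A) (delta eta : R) : 0 <= eta ->
  (forall a, Omega a -> exists g : nat, [/\ (g <= N)%N, spectral gamma g%:Z a,
    (forall al be, (opnorm (fun u => psi (phi (entry al be a)) u - pi (entry al be a) u)%R
      <= eta%:E)%E)
    & eta * K.+1%:R + g%:R / N%:R * cnorm a < delta]) ->
  cp_approx setT pi Omega delta (K.+1 * \dim D).
Proof.
move=> eta0 hO.
have N0 : (0 < N)%N by exact: leq_ltn_trans (leq0n _) (ltn_ord (deg ord0)).
have NR : N%:R != 0 :> R by rewrite pnatr_eq0 -lt0n.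
have hXN := sum_XX hXX.
exists (mxalg (regrep B) K : fdCstarAlgType R), (diag_masa (regrep B) K hD),
  (compress hg hpi phi X), (decompress hpi hpsi N X).
split.
- exact: diag_masa_maximal.
- exact: dim_diag_space.
- exact: (compress_contractive_cp hg hpi hphi hX hXX).
- exact: decompress_contractive_cp.
move=> a /hO[g [gN ha happ hlt]].
apply: le_lt_trans (_ : ((eta * K.+1%:R + g%:R / N%:R * cnorm a)%:E < _)%E); last by rewrite lte_fin.
have c1 : 0 <= eta * K.+1%:R by rewrite mulr_ge0 ?ler0n.
have c2 : 0 <= g%:R / N%:R * cnorm a by rewrite mulr_ge0 ?divr_ge0 ?ler0n ?cnorm_ge0.
apply: opnorm_le; first exact: addr_ge0.
move=> u; rewrite decompressE -(hilbert_repE hpi) mulrDl.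
have hclose := decompress_close (hpi := hpi) N0 hXN (psi := psi) (M := compress hg hpi phi X a)
  (e := fun al be => entry al be a) eta0.
set b := (N%:R^-1 : R)%:C *: \sum_al \sum_be X al * entry al be a * star (X be).
have -> : (decompress_fun hpi psi N X (compress hg hpi phi X a) u : V) - r a u =
    (decompress_fun hpi psi N X (compress hg hpi phi X a) u - r b u) + r (b - a) u.
  by rewrite crepBl addrA subrK.
apply: (le_trans (hnD _ _)); apply: lerD.
  apply: hclose => al be w; rewrite mxE.
  rewrite hilbert_repE; apply: (opnorm_bound _ (happ al be)).
  have bopZ (T : bop H) k v : T (k *: v) = k *: T v by exact: linearZ.
  by move=> k v; rewrite !bopZ [in RHS]scalerBr.
apply: (le_trans (crep_contr _ _ _)); rewrite ler_wpM2r ?hn_ge0 //.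
have -> : b - a = (- (g%:R / N%:R) : R)%:C *: a.
  rewrite /b (fejer_mean ha) scalerA -rmorphM -[X in _ - X]scale1r -(rmorph1 (real_complex R)).
  rewrite -scalerBl -rmorphB; congr (_%:C *: _).
  by rewrite natrB //; field.
by rewrite cnormZr normrN ger0_norm ?divr_ge0 ?ler0n.
Qed.

End CompressionApprox.

(** * Words and the subshift *)

Section Words.
Variables (R : realType) (A : cstarAlgType R) (d : nat) (x : 'I_d -> A).
Hypothesis hx : \sum_i x i * star (x i) = 1.
Implicit Types (w u v : seq 'I_d).

Lemma xw_cat u v : xw x (u ++ v) = xw x u * xw x v.
Proof. exact: big_cat. Qed.

Lemma xw_cons i w : xw x (i :: w) = x i * xw x w.
Proof. exact: big_cons. Qed.

Lemma xw_rcons w i : xw x (rcons w i) = xw x w * x i.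
Proof. by rewrite -cats1 xw_cat {2}/xw big_seq1. Qed.

Lemma xw_nil : xw x [::] = 1. Proof. exact: big_nil. Qed.

Lemma xw_catl u v : xw x (u ++ v) != 0 -> xw x u != 0.
Proof. by rewrite xw_cat; apply: contraNneq => ->; rewrite mul0r. Qed.

Lemma xw_catr u v : xw x (u ++ v) != 0 -> xw x v != 0.
Proof. by rewrite xw_cat; apply: contraNneq => ->; rewrite mulr0. Qed.

Lemma xw_extend w : xw x w != 0 -> exists i, xw x (rcons w i) != 0.
Proof.
move=> w0; apply/existsP; apply: contraNT w0; rewrite negb_exists => /forallP h.
rewrite -[xw x w]mulr1 -hx mulr_sumr big1 // => i _.
by rewrite mulrA -xw_rcons; move: (h i); rewrite negbK => /eqP ->; rewrite mul0r.
Qed.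

Lemma xw_mkseq (l : nat -> 'I_d) (r : nat) :
  xw x (mkseq l r) = \prod_(0 <= i < r) x (l i).
Proof. by rewrite /xw big_map /index_iota subn0. Qed.

Lemma xw_infinite_extension w : xw x w != 0 ->
  exists l : nat -> 'I_d, subshift x l /\ w = mkseq l (size w).
Proof.
move=> w0; have [i0 _] := xw_extend w0.
pose next u := odflt i0 [pick i | xw x (rcons u i) != 0].
pose W := fix W n := if n is m.+1 then rcons (W m) (next (W m)) else w.
have W0 n : xw x (W n) != 0.
  elim: n => [//|n ih] /=; rewrite /next; case: pickP => [//|no].
  by have [i hi] := xw_extend ih; move: hi; rewrite no.
have sW n : size (W n) = (size w + n)%N.
  by elim: n => [|n ih]; rewrite ?addn0 //= size_rcons ih addnS.
have Wpre n m : exists v, W (n + m)%N = W n ++ v.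
  elim: m => [|m [v ih]]; first by exists [::]; rewrite addn0 cats0.
  by rewrite addnS /= ih; eexists; rewrite rcons_cat.
(* The words [W n] are nested and [W j.+1] has more than [j] letters, so the default [i0] is never
   read and any sufficiently long [W n] gives the same letter. *)
pose l j := nth i0 (W j.+1) j.
have lE n j : (j < size w + n)%N -> l j = nth i0 (W n) j.
  move=> jn; rewrite /l; have [le|/ltnW le] := leqP n j.+1.
    by have [v] := Wpre n (j.+1 - n)%N; rewrite subnKC // => ->; rewrite nth_cat sW jn.
  have [v] := Wpre j.+1 (n - j.+1)%N; rewrite subnKC // => ->.
  by rewrite nth_cat sW ifT // addnS ltnS leq_addl.
have mkE n r : (r <= size w + n)%N -> mkseq l r = take r (W n).
  move=> rn; apply: (@eq_from_nth _ i0); first by rewrite size_mkseq size_takel ?sW.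
  rewrite size_mkseq => j jr; rewrite nth_mkseq // nth_take //; apply: lE.
  exact: leq_trans jr rn.
exists l; split; last by rewrite (mkE 0%N) ?addn0 // take_size.
move=> r; rewrite -xw_mkseq (mkE r) ?leq_addl //.
by apply: (@xw_catl _ (drop r (W r))); rewrite cat_take_drop.
Qed.

(** A factor of a nonzero product is nonzero. Conversely [hx] lets every nonzero word grow to the
    right forever, so it occurs at position 0 of a point of the subshift. *)
Lemma in_languageE w : in_language x w <-> xw x w != 0.
Proof.
split=> [[l [k [hl ->]]]|/xw_infinite_extension[l [hl we]]]; last by exists l, 0%N.
have := hl (k + size w)%N; rewrite -xw_mkseq /mkseq iotaD map_cat => /xw_catr.
rewrite (_ : map l (iota (0 + k) _) = mkseq (fun j => l (k + j)%N) (size w)) //.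
by rewrite add0n -{1}[k]addn0 iotaDl -map_comp.
Qed.

Fixpoint all_words (r : nat) : seq (seq 'I_d) :=
  if r is s.+1 then [seq i :: w | i <- enum 'I_d, w <- all_words s] else [:: [::]].

Lemma mem_all_words r w : (w \in all_words r) = (size w == r).
Proof.
elim: r w => [|r ih] w /=; first by rewrite inE; case: w.
apply/allpairsP/eqP => [[[i v] /= [_ vr ->]]|]; first by rewrite /= (eqP (etrans (esym (ih v)) vr)).
by case: w => //= i v [e]; exists (i, v); rewrite mem_enum ih e eqxx.
Qed.

Lemma uniq_all_words r : uniq (all_words r).
Proof.
elim: r => [//|r ih] /=; apply: allpairs_uniq => //; first exact: enum_uniq.
by move=> [i u] [j v] _ _ [-> ->].
Qed.

Definition words (r : nat) : seq (seq 'I_d) := [seq w <- all_words r | xw x w != 0].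

Lemma mem_words r w : (w \in words r) = (xw x w != 0) && (size w == r).
Proof. by rewrite mem_filter mem_all_words. Qed.

Lemma uniq_words r : uniq (words r).
Proof. exact/filter_uniq/uniq_all_words. Qed.

Lemma card_wordsE r : card_words x r = size (words r).
Proof.
rewrite /card_words cardE -(size_map val); apply/perm_size/uniq_perm.
- by rewrite map_inj_uniq ?enum_uniq //; exact: val_inj.
- exact: uniq_words.
move=> w; rewrite mem_words; apply/mapP/andP => [[t]|[w0 /eqP sw]].
  rewrite mem_enum inE => /asboolP h ->.
  by split; [exact: (in_languageE _).1 (asboolW h) | rewrite size_tuple].
have wr : size w == r by rewrite sw.
exists (Tuple wr) => //; rewrite mem_enum inE; apply/asboolP.
by apply/asboolP/in_languageE.
Qed.

Lemma card_words_gt0 r : (0 < card_words x r)%N.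
Proof.
rewrite card_wordsE; elim: r => [|r ih]; first by rewrite /words /= xw_nil oner_neq0.
case: (words r) (mem_words r) ih => // w s h _.
have : w \in w :: s by rewrite mem_head.
rewrite h => /andP[/xw_extend[i wi] sw].
rewrite lt0n size_eq0; apply/eqP => e.
have : rcons w i \in words r.+1 by rewrite mem_words wi size_rcons eqSS.
by rewrite e.
Qed.

Lemma card_words_leS r : (card_words x r <= card_words x r.+1)%N.
Proof.
rewrite !card_wordsE.
rewrite -(size_map (take r) (words r.+1)); apply: uniq_leq_size; first exact: uniq_words.
move=> w; rewrite mem_words => /andP[/xw_extend[i wi] /eqP sw].
apply/mapP; exists (rcons w i); last by rewrite -cats1 -sw take_size_cat.
by rewrite mem_words wi size_rcons sw eqxx.
Qed.

Lemma card_words_mono r s : (r <= s)%N -> (card_words x r <= card_words x s)%N.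
Proof.
move=> /subnK <-; elim: (s - r)%N => [//|k ih].
exact: leq_trans ih (card_words_leS _).
Qed.

(** Expand over all words; those with [xw x w = 0] drop out, which leaves [theta_k] terms. *)
Lemma iter_sum_map k T :
  iter k (sum_map x) T = \sum_(w <- words k) xw x w * T * star (xw x w).
Proof.
have -> : \sum_(w <- words k) xw x w * T * star (xw x w) =
    \sum_(w <- all_words k) xw x w * T * star (xw x w).
  rewrite big_filter [RHS](bigID (fun w => xw x w != 0)) /= [X in _ + X]big1 ?addr0 //.
  by move=> w; rewrite negbK => /eqP ->; rewrite star0 mulr0.
elim: k => [|k ih]; first by rewrite /= big_seq1 xw_nil star1 mulr1 mul1r.
rewrite iterS ih /= big_allpairs_dep big_enum /=; apply: eq_bigr => i _.
rewrite mulr_sumr mulr_suml; apply: eq_bigr => w _.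
by rewrite xw_cons starM !mulrA.
Qed.

Lemma sum_words r : \sum_(w <- words r) xw x w * star (xw x w) = 1.
Proof.
rewrite (eq_bigr (fun w => xw x w * 1 * star (xw x w))) => [|w _]; last by rewrite mulr1.
rewrite -iter_sum_map; elim: r => [//|r ih]; rewrite iterS ih /sum_map -[RHS]hx.
by apply: eq_bigr => i _; rewrite mulr1.
Qed.

Definition word_range (M N : nat) : seq (seq 'I_d) := flatten [seq words (M + i) | i <- iota 0 N].

Lemma mem_word_range M N w : w \in word_range M N ->
  xw x w != 0 /\ (M <= size w < M + N)%N.
Proof.
case/flatten_mapP => i; rewrite mem_iota /= add0n mem_words => iN /andP[w0 /eqP ->].
by rewrite leq_addr ltn_add2l.
Qed.

Lemma sum_word_range M N (W : nmodType) (F : seq 'I_d -> W) (k : nat) : (k < N)%N ->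
  \sum_(w <- word_range M N | size w == (M + k)%N) F w = \sum_(w <- words (M + k)) F w.
Proof.
move=> kN; rewrite /word_range big_flatten big_map (bigD1_seq k) ?iota_uniq ?mem_iota //=.
rewrite [X in _ + X]big1 ?addr0 => [|i ik].
  by rewrite big_seq_cond [RHS]big_seq; apply: eq_bigl => w; rewrite mem_words -andbA andbb.
rewrite big_seq_cond big1 // => w; rewrite mem_words => /andP[/andP[_ /eqP ->]].
by rewrite eqn_add2l (negPf ik).
Qed.

Lemma size_word_range M N :
  (size (word_range M N) <= N * card_words x (M + N).-1)%N.
Proof.
rewrite /word_range size_flatten /shape -map_comp sumnE big_map.
rewrite -[in X in (_ <= X * _)%N](size_iota 0 N) -sum1_size big_distrl big_seq [leqRHS]big_seq.
apply: leq_sum => i; rewrite mem_iota add0n /= mul1n -card_wordsE => iN.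
by apply: card_words_mono; lia.
Qed.

Lemma word_range_gt0 M N : (0 < N)%N -> (0 < size (word_range M N))%N.
Proof.
case: N => // N _; rewrite /word_range /= size_cat addn0 -card_wordsE.
by rewrite ltn_addr // card_words_gt0.
Qed.

End Words.

(** * Approximating the iterates on F(omega, n0) *)

Section WordApproximation.
Variables (R : realType) (A : cstarAlgType R) (gamma : R[i] -> A -> A).
Hypothesis hg : circle_action gamma.
Variables (d : nat) (x : 'I_d -> A).
Hypothesis hx1 : forall i, spectral gamma 1 (x i).
Hypothesis hx : \sum_i x i * star (x i) = 1.
Variables (H : hilbertType R) (pi : A -> bop H).
Hypothesis hpi : faithful_rep setT pi.
Variable omega : set A.
Hypothesis homega : omega `<=` spectral gamma 0.
Local Notation V := (hilbert_ph H).
Local Notation r := (hilbert_rep hpi).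
Local Notation S := (spectral gamma 0).

Let hS : closed_subalg S := spectral0_closed hg r.

Let S0 : S 0.
Proof. by have := csub_lin hS (-1) (csub1 hS) (csub1 hS); rewrite scaleN1r addNr. Qed.

Lemma xw_spectral w : spectral gamma (size w)%:Z (xw x w).
Proof.
elim: w => [|i w ih]; first by rewrite xw_nil; exact: (csub1 hS).
by rewrite xw_cons /= -add1n PoszD; apply: (spectralM hg).
Qed.

Lemma omega_upto_spectral n : omega_upto x omega n `<=` S.
Proof.
move=> _ [T [mu [nu [de [de' [ep [ep' [/homega hT [_ _ e1 _] [_ _ e2 _] [_ _ e3 _] ->]]]]]]]].
have sw w := xw_spectral w; have sv w := spectral_star hg (sw w).
have := spectralM hg (spectralM hg (spectralM hg (spectralM hg (sv mu)
  (spectralM hg (sv de) (sw de'))) hT) (spectralM hg (sv ep) (sw ep'))) (sw nu).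
by rewrite e1 e2 e3 addNr !addr0 addNr addr0 addNr.
Qed.

(** In the representation [sum_map x T] is the diagonal operator [T] on [V^d], compressed by the
    contraction [st] with components [x_i^* w]. *)
Lemma sum_map_norm T : cnorm (sum_map x T) <= cnorm T.
Proof.
apply: (crep_iso (r := r)) => [|u]; first exact: cnorm_ge0.
apply: hn_le_dual => [|w]; first by rewrite mulr_ge0 ?cnorm_ge0 ?hn_ge0.
pose st (w : V) : ph_pow V d := [ffun i => r (star (x i)) w].
have hst v : hn (st v) <= hn v.
  rewrite ler_wsqrtr // hq_pow; apply: le_trans (crep_1le r v).
  rewrite -crep_1rip -hx crep_suml rip_suml; apply: ler_sum => i _.
  by rewrite ffunE crep_hq starK.
have -> : rip (r (sum_map x T) u) w =
    rip ([ffun i => r T (st u i)] : ph_pow V d) (st w).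
  rewrite rip_pow /sum_map crep_suml rip_suml; apply: eq_bigr => i _.
  by rewrite !ffunE !crepM crep_rip.
apply: (le_trans (rip_le _ _)); apply: ler_pM; rewrite ?hn_ge0 //.
apply: (@le_trans _ _ (cnorm T * hn (st u))); last by rewrite ler_wpM2l ?cnorm_ge0.
apply: hn_le_sq; first by rewrite mulr_ge0 ?cnorm_ge0 ?hn_ge0.
rewrite exprMn hn2 !hq_pow mulr_sumr; apply: ler_sum => i _.
rewrite ffunE -!hn2 -exprMn ler_pXn2r ?nnegrE ?mulr_ge0 ?cnorm_ge0 ?hn_ge0 //.
exact: crep_contr.
Qed.

Lemma cnorm_x i : cnorm (x i) <= 1.
Proof.
rewrite -cnorm_star; apply: (crep_iso (r := r)) => // u; rewrite mul1r ler_wsqrtr //.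
apply: le_trans (crep_1le r u).
rewrite -crep_1rip -hx crep_suml rip_suml (bigD1 i) //= {1}crep_hq starK lerDl.
by apply: sumr_ge0 => j _; rewrite -{1}[x j]starK -crep_hq hq_ge0.
Qed.

Lemma cnorm_xw w : cnorm (xw x w) <= 1.
Proof.
elim: w => [|i w ih]; first by rewrite xw_nil cnorm1.
rewrite xw_cons (le_trans (ler_cnormM _ _)) // -[leRHS]mulr1.
by apply: ler_pM; rewrite ?cnorm_ge0 ?cnorm_x.
Qed.

Lemma cnorm_iter_F k w T : cnorm (iter k (sum_map x) (xw x w * T)) <= cnorm T.
Proof.
elim: k => [|k ih]; last exact: le_trans (sum_map_norm _) ih.
rewrite /= (le_trans (ler_cnormM _ _)) // -[leRHS]mul1r.
by apply: ler_pM; rewrite ?cnorm_ge0 ?cnorm_xw.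
Qed.

Lemma iter_F_spectral k w T : S T ->
  spectral gamma (size w)%:Z (iter k (sum_map x) (xw x w * T)).
Proof.
move=> hT; rewrite iter_sum_map //.
elim/big_rec: _ => [|v y _ hy]; first by move=> z z1; rewrite (act0 hg) // scaler0.
rewrite -[_ * star _]scale1r; apply: (spectral_lin hg) => //.
have := spectralM hg (spectralM hg (xw_spectral v) (spectralM hg (xw_spectral w) hT))
  (spectral_star hg (xw_spectral v)).
by rewrite addr0 addrAC subrr add0r.
Qed.

(** The product [x_al^* x_mu x_ga T x_mu^* x_be] regrouped. Cutting [al] after [|mu| + |ga|] letters
    and [be] after [|mu|] pairs words of equal length, so two elements [q] of [A^0] surround [T];
    when [|al| = |ga| + |be|] the remainders have equal length too. *)
Definition q_term (al be ga mu : seq 'I_d) (T : A) : A :=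
  star (xw x (drop (size mu + size ga) al)) * qel x (take (size mu + size ga) al) (mu ++ ga) * T *
  qel x mu (take (size mu) be) * xw x (drop (size mu) be).

Lemma entry_q_terms k al be ga T :
  star (xw x al) * iter k (sum_map x) (xw x ga * T) * xw x be =
  \sum_(mu <- words x k) q_term al be ga mu T.
Proof.
rewrite iter_sum_map // mulr_sumr mulr_suml big_seq [RHS]big_seq; apply: eq_bigr => mu _.
rewrite /q_term /qel xw_cat -{1}[al](cat_take_drop (size mu + size ga)).
by rewrite -{1}[be](cat_take_drop (size mu)) !xw_cat starM !mulrA.
Qed.

Lemma q_term_omega n al be ga mu T : omega T -> xw x al != 0 -> xw x be != 0 -> xw x mu != 0 ->
  xw x (mu ++ ga) != 0 -> size al = (size ga + size be)%N -> (size mu <= size be)%N ->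
  (size al <= n.-1)%N -> omega_upto x omega n (q_term al be ga mu T).
Proof.
move=> oT a0 b0 m0 mg0 sab smb san.
have lang w : xw x w != 0 -> in_language x w by move=> /(in_languageE hx).
have sub u v : xw x (u ++ v) != 0 -> in_language x u /\ in_language x v.
  by move=> uv; split; apply: lang; [exact: xw_catl uv | exact: xw_catr uv].
have [a1 a2] : in_language x (take (size mu + size ga) al) /\
    in_language x (drop (size mu + size ga) al) by apply: sub; rewrite cat_take_drop.
have [b1 b2] : in_language x (take (size mu) be) /\ in_language x (drop (size mu) be).
  by apply: sub; rewrite cat_take_drop.
exists T, (drop (size mu + size ga) al), (drop (size mu) be), (take (size mu + size ga) al),
  (mu ++ ga), mu, (take (size mu) be); split => //; split => //; rewrite ?size_drop ?size_takel ?size_cat //.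
- lia.
- lia.
- exact: lang.
- lia.
- lia.
- lia.
- exact: lang.
- lia.
Qed.

Section PerMap.
Variables (B : fdCstarAlgType R) (phi : A -> B) (psi : B -> bop H).
Hypothesis hphi : contractive_cp S phi.
Hypothesis hpsi : contractive_cp_op psi.
Variable eta : R.

Definition near_id (c : R) (a : A) : Prop :=
  obound (fun u : V => (psi (phi a) u : V) - r a u) c.

Let philin c a b : S a -> S b -> phi (c *: a + b) = c *: phi a + phi b.
Proof. by case: hphi => h _ _; exact: h. Qed.

Let psilin c a b u : psi (c *: a + b) u = c *: (psi a u : V) + psi b u.
Proof. by case: hpsi => h _ _; exact: h. Qed.

Let psi_phi0 u : psi (phi 0) u = 0 :> V.
Proof.
have -> : phi 0 = 0 by have := philin (-1) S0 S0; rewrite scaler0 addr0 scaleN1r addNr.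
by have := psilin (-1) 0 0 u; rewrite scaler0 addr0 scaleN1r addNr.
Qed.

Lemma near_id0 c : 0 <= c -> near_id c 0.
Proof. by move=> c0 u; rewrite psi_phi0 crep0l subr0 hn0 mulr_ge0 ?hn_ge0. Qed.

Lemma near_id_sum (I : Type) (s : seq I) (t : I -> A) :
  (forall i, S (t i)) -> (forall i, near_id eta (t i)) ->
  near_id ((size s)%:R * eta) (\sum_(i <- s) t i).
Proof.
move=> St nt.
have Ss s' : S (\sum_(i <- s') t i).
  elim: s' => [|i s' ih]; first by rewrite big_nil.
  by rewrite big_cons -[t i]scale1r; apply: (csub_lin hS).
elim: s => [|i s ih] u.
  by rewrite big_nil psi_phi0 crep0l subr0 hn0 !mul0r.
rewrite big_cons -[t i]scale1r philin // psilin !scale1r crepDl opprD addrACA.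
apply: (le_trans (hnD _ _)); rewrite -[size _]/(size s).+1 -natr1 mulrDl mulrDl mul1r [leRHS]addrC.
by apply: lerD; [exact: nt | exact: ih].
Qed.

Lemma near_id_entry n k al be ga T : 0 <= eta ->
  (forall a, omega_upto x omega n a -> near_id eta a) ->
  omega T -> xw x al != 0 -> xw x be != 0 ->
  size al = (size ga + size be)%N -> (k <= size be)%N -> (size al <= n.-1)%N ->
  near_id ((card_words x k)%:R * eta) (star (xw x al) * iter k (sum_map x) (xw x ga * T) * xw x be).
Proof.
move=> eta0 hO oT a0 b0 sab kb san; rewrite entry_q_terms card_wordsE //.
(* The concatenation [mu ++ ga] may leave the language; its product is then 0 and so is the term. *)
have q0 mu : mu \in words x k -> q_term al be ga mu T = 0 \/ omega_upto x omega n (q_term al be ga mu T).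
  rewrite mem_words => /andP[m0 /eqP smu].
  have [e|ne] := eqVneq (xw x (mu ++ ga)) 0.
    by left; rewrite /q_term /qel e !(mulr0, mul0r).
  by right; apply: q_term_omega => //; rewrite smu.
(* [near_id_sum] asks its hypotheses of every index, so the terms are set to 0 off [words x k]. *)
pose t mu := if mu \in words x k then q_term al be ga mu T else 0.
rewrite (eq_big_seq t) => [|mu hmu]; last by rewrite /t hmu.
have tP mu : t mu = 0 \/ omega_upto x omega n (t mu).
  by rewrite /t; case: ifP => [/q0|_] //; left.
apply: near_id_sum => mu; case: (tP mu) => [->|h].
- exact: S0.
- exact: omega_upto_spectral h.
- exact: near_id0.
- exact: hO.
Qed.

End PerMap.

(** Error budget: an entry is a sum of at most [th] approximated terms, hence [th * eta]; the matrix
    has size at most [N * th]; and degrees up to [n0] lose at most [n0 / N] in the Fejer mean. *)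
Lemma cp_approx_words (n n0 N : nat) (c eta delta : R) (r0 : nat) :
  let m := (n + n0 + N)%N in let th := card_words x m.-1 in
  (0 < N)%N -> (n0 <= N)%N -> (forall T, omega T -> cnorm T <= c) -> 0 <= c -> 0 <= eta ->
  th%:R * eta * (N * th)%:R + n0%:R / N%:R * c < delta ->
  cp_approx S pi (omega_upto x omega m) eta r0 ->
  exists2 K : nat, (K <= N * th)%N &
    cp_approx setT pi (\bigcup_(k in `I_n) (iter k (sum_map x) @` F_set x omega n0)) delta (K * r0).
Proof.
(* From here on [N.+1] stands for the former [N], so that degrees live in ['I_N.+1] and [inord]
   applies. *)
case: N => // N m th _ n0N hc c0 eta0 hlt [B [D [phi [psi [hD <- hphi hpsi happ]]]]].
pose M := (n + n0)%N; pose J := word_range x M N.+1.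
have sJ : (0 < size J)%N by exact: word_range_gt0.
pose K := (size J).-1; have eK : size J = K.+1 by rewrite prednK.
pose wd (al : 'I_K.+1) := nth [::] J al.
have wdJ al : wd al \in J by rewrite mem_nth // eK.
have wdP al : xw x (wd al) != 0 /\ (M <= size (wd al) < M + N.+1)%N.
  by apply: mem_word_range; exact: wdJ.
pose X al := xw x (wd al).
pose deg (al : 'I_K.+1) : 'I_N.+1 := inord (size (wd al) - M).
have degE al : (M + deg al)%N = size (wd al).
  by have [_ /andP[h1 h2]] := wdP al; rewrite inordK; lia.
have hX al : spectral gamma (M + deg al)%:Z (X al) by rewrite degE; exact: xw_spectral.
have hXX (k : 'I_N.+1) : \sum_(al | deg al == k) X al * star (X al) = 1.
  rewrite -(sum_words hx (M + k)) -(sum_word_range x M _ (ltn_ord k)) -/J.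
  rewrite (big_nth [::]) eK big_mkord; apply: eq_bigl => al.
  by rewrite -/(wd al) -degE eqn_add2l.
exists K.+1; first by rewrite -eK; exact: size_word_range.
apply: (cp_approx_compress (hg := hg) (hpi := hpi) hX hXX hphi hpsi hD (eta := th%:R * eta)).
  by rewrite mulr_ge0 ?ler0n.
move=> _ [k /= kn [_ [ga [T [_ gn oT ->]] <-]]].
have hF : spectral gamma (size ga)%:Z (iter k (sum_map x) (xw x ga * T)).
  by apply: iter_F_spectral; exact: homega.
exists (size ga); split => //.
- exact: leq_trans gn n0N.
- move=> al be; rewrite (entry_degree hg hpi hX al be hF).
  have near c' a : 0 <= c' -> near_id phi psi c' a ->
      (opnorm (fun u => psi (phi a) u - pi a u)%R <= c'%:E)%E.
    move=> c'0 h; apply: opnorm_le => // u; have := h u.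
    by rewrite hilbert_repE.
  apply: near; first by rewrite mulr_ge0 ?ler0n.
  case: eqP => [e|_]; last by apply: (near_id0 hphi hpsi); rewrite mulr_ge0 ?ler0n.
  have hO a : omega_upto x omega m a -> near_id phi psi eta a.
    move=> /happ /ltW h u; rewrite hilbert_repE; apply: (opnorm_bound _ h).
    have bopZ (T' : bop H) k' v : T' (k' *: v) = k' *: T' v by exact: linearZ.
    by move=> k' v; rewrite !bopZ [in RHS]scalerBr.
  have [al0 /andP[al1 al2]] := wdP al; have [be0 /andP[be1 be2]] := wdP be.
  have h : near_id phi psi ((card_words x k)%:R * eta)
      (star (X al) * iter k (sum_map x) (xw x ga * T) * X be).
    apply: (near_id_entry hphi hpsi eta0 hO) => //.
    + by have := degE al; have := degE be; lia.
    + by lia.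
    + by rewrite /m; lia.
  move=> u; apply: (le_trans (h u)); rewrite ler_wpM2r ?hn_ge0 // ler_wpM2r //.
  by rewrite ler_nat; apply: card_words_mono => //; rewrite /m; lia.
apply: le_lt_trans hlt; apply: lerD.
  rewrite ler_wpM2l ?mulr_ge0 ?ler0n // ler_nat -eK; exact: size_word_range.
apply: ler_pM; rewrite ?divr_ge0 ?ler0n ?cnorm_ge0 //.
  by rewrite ler_wpM2r ?invr_ge0 ?ler0n // ler_nat.
exact: le_trans (cnorm_iter_F _ _ _) (hc _ oT).
Qed.

End WordApproximation.

(** * Entropy estimates *)

Section LimsupEstimates.
Variable R : realType.
Implicit Types (u : nat -> \bar R) (L : \bar R).

Lemma limn_esup_le_near u L : (\forall n \near \oo, (u n <= L)%E) -> (limn_esup u <= L)%E.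
Proof.
move=> h; apply: (@le_trans _ _ (ereal_sup (u @` [set n | (u n <= L)%E]))).
  by apply: ereal_inf_lbound; exists [set n | (u n <= L)%E].
by apply: ge_ereal_sup => _ [n hn <-].
Qed.

Lemma limn_esup_lt_near u L : (limn_esup u < L)%E -> \forall n \near \oo, (u n < L)%E.
Proof.
move=> /ereal_inf_lt[_ [P hP <-] hL]; apply: filterS hP => n Pn.
by apply: le_lt_trans hL; apply: ereal_sup_ubound; exists n.
Qed.

Lemma limn_esup_ge0 u : (forall n, 0 <= u n)%E -> (0 <= limn_esup u)%E.
Proof.
move=> h; apply: le_ereal_inf_tmp => _ [P [N _ hP] <-].
apply: (le_trans (h N)); apply: ereal_sup_ubound; exists N => //.
by apply: hP => /=.
Qed.

Lemma lt_expR_of_lne (n : nat) (c y : R) (z : \bar R) : (0 < n)%N -> (y%:E <= z)%E ->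
  ((n%:R^-1 : R)%:E * lne z < c%:E)%E -> y < expR (n%:R * c).
Proof.
move=> n0 yz; apply: contraTT; rewrite -!leNgt => hy.
have n0R : 0 < n%:R :> R by rewrite ltr0n.
have y0 : 0 < y by apply: lt_le_trans hy; exact: expR_gt0.
have : ((n%:R * c)%:E <= lne z)%E.
  apply: (@le_trans _ _ (lne y%:E)).
    by rewrite lne_EFin // lee_fin -ler_expR lnK.
  by rewrite lee_lne // in_itv /= leey ?lee_fin ?(ltW y0) //= (le_trans _ yz) // lee_fin ltW.
move=> h; rewrite -(@lee_pmul2l _ n%:R%:E) //.
by rewrite muleA -!EFinM mulfV ?gt_eqF // mul1e.
Qed.

End LimsupEstimates.

(** * Growth of the language and topological entropy *)

Section TopologicalBound.
Variables (R : realType) (A : cstarAlgType R) (d : nat) (x : 'I_d -> A).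
Hypothesis hx : \sum_i x i * star (x i) = 1.
Local Notation X := (full_shift d).

Definition cylinder (i : 'I_d) : set X := [set l | l 0%N = i].
(** The generating partition of the shift: its [n]-fold join separates points by their first [n]
    letters. *)
Definition cylinder_cover : set (set X) := [set cylinder i | i in setT].

Lemma cylinder_cover_open : open_cover_of (subshift x) cylinder_cover.
Proof.
split=> [_ [i _ <-]|l _]; last by exists (cylinder (l 0%N)) => //; exists (l 0%N).
have hc : continuous ((fun l => l 0%N) : X -> discrete_topology 'I_d).
  exact: (@proj_continuous nat (fun=> discrete_topology 'I_d) 0%N).
exact: ((continuousP _).1 hc [set i] (discrete_open _)).
Qed.

Lemma iter_left_shift k (l : X) j : iter k (@left_shift d) l j = l (k + j)%N.
Proof. by elim: k j => [//|k ih] j; rewrite iterS /left_shift ih addnS. Qed.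

Lemma dynamical_join_cylinder n (W : set X) :
  dynamical_join (@left_shift d) cylinder_cover n W ->
  exists v : seq 'I_d, forall l, W l -> mkseq l n = v.
Proof.
move=> [V hV <-]; have [c hc] : exists c : nat -> 'I_d, forall k, V k = cylinder (c k).
  have h k : exists i, V k = cylinder i by have [i _ <-] := hV k; exists i.
  by exists (fun k => sval (cid (h k))) => k; exact: svalP (cid (h k)).
exists (mkseq c n) => l hl; apply/eq_in_map => k; rewrite mem_iota => /andP[_ kn].
have := hl k kn; rewrite hc /preimage /= /cylinder /=.
by rewrite iter_left_shift addn0.
Qed.

(** Each member of the join fixes the first [n] letters, and every word of the language is the
    beginning of a point of the subshift, so distinct words need distinct members. *)
Lemma card_words_le_cover n :
  ((card_words x n)%:R%:E <= cover_number R (subshift x) (dynamical_join (@left_shift d) cylinder_cover n))%E.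
Proof.
apply: le_ereal_inf_tmp => _ [m [W [hW cov]] <-]; rewrite lee_fin ler_nat.
have [v hv] : exists v : 'I_m -> seq 'I_d, forall i l, W i l -> mkseq l n = v i.
  have h i := dynamical_join_cylinder (hW i).
  by exists (fun i => sval (cid (h i))) => i; exact: svalP (cid (h i)).
rewrite card_wordsE // -[leqRHS]card_ord cardE -(size_map v).
apply: uniq_leq_size; first exact: uniq_words.
move=> w; rewrite mem_words => /andP[/(xw_infinite_extension hx)[l [hl we]] /eqP sw].
have [i _ Wi] := cov l hl; apply/mapP; exists i; first by rewrite mem_enum.
by rewrite -(hv i l Wi) -sw.
Qed.

Let entropy_term n : \bar R := ((n%:R^-1 : R)%:E *
  lne (cover_number R (subshift x) (dynamical_join (@left_shift d) cylinder_cover n)))%E.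

Let cover_le_htop : (limn_esup entropy_term <= htop R (@left_shift d) (subshift x))%E.
Proof. by apply: ereal_sup_ubound; exists cylinder_cover => //; exact: cylinder_cover_open. Qed.

Lemma htop_ge0 : (0 <= htop R (@left_shift d) (subshift x))%E.
Proof.
apply: le_trans cover_le_htop; apply: limn_esup_ge0 => n.
apply: mule_ge0; first by rewrite lee_fin invr_ge0 ler0n.
rewrite lne_ge0; apply: le_trans (card_words_le_cover n).
by rewrite lee_fin ler1n; exact: card_words_gt0.
Qed.

Lemma card_words_growth (h : R) : (htop R (@left_shift d) (subshift x) < h%:E)%E ->
  \forall n \near \oo, ((card_words x n)%:R : R) < expR (n%:R * h).
Proof.
move=> hh; have := limn_esup_lt_near (le_lt_trans cover_le_htop hh).
move=> near_h; near=> n.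
apply: (lt_expR_of_lne _ (card_words_le_cover n)); first by near: n; exists 1%N.
by near: n.
Unshelve. all: by end_near.
Qed.

End TopologicalBound.

Section RcpBounds.
Variables (R : realType) (A : cstarAlgType R) (S : set A) (H : hilbertType R) (pi : A -> bop H).

(** A maximal abelian subalgebra contains 1, hence is nonzero. This keeps the logarithms
    nonnegative. *)
Lemma rcp_ge1 (Omega : set A) (delta : R) : (1 <= rcp S pi Omega delta)%E.
Proof.
apply: le_ereal_inf_tmp => _ [r [B [D [phi [psi [hD <- _ _ _]]]]] <-].
rewrite lee_fin ler1n lt0n dimv_eq0; apply/eqP => D0.
by have := maximal_abelian_1 hD; rewrite D0 memv0 oner_eq0.
Qed.

Lemma rcp_le (Omega : set A) (delta : R) r :
  cp_approx S pi Omega delta r -> (rcp S pi Omega delta <= (r%:R : R)%:E)%E.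
Proof. by move=> h; apply: ereal_inf_lbound; exists r. Qed.

Lemma rcp_lt (Omega : set A) (delta y : R) :
  (rcp S pi Omega delta < y%:E)%E -> exists2 r : nat, cp_approx S pi Omega delta r & r%:R < y.
Proof. by move=> /ereal_inf_lt[_ [r hr <-]]; rewrite lte_fin; exists r. Qed.

End RcpBounds.

Lemma affine_average_near (R : realType) (a b e : R) : 0 < e ->
  \forall n \near \oo, (a + n%:R * b) / n%:R <= b + e.
Proof.
move=> e0; exists (Num.truncn (`|a| / e)).+1 => // n /= hn.
have n0 : 0 < n%:R :> R by rewrite ltr0n; exact: leq_trans hn.
rewrite ler_pdivrMr //; have : `|a| / e < n%:R.
  by apply: (lt_le_trans (truncnS_gt _)); rewrite ler_nat.
rewrite ltr_pdivrMr //; have := ler_norm a; nra.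
Qed.

Lemma finite_cnorm_bound (R : realType) (A : cstarAlgType R) (omega : set A) :
  finite_set omega -> exists2 c : R, 0 <= c & forall T, omega T -> cnorm T <= c.
Proof.
move=> /finite_seqP[s ->]; exists (\sum_(T <- s) cnorm T).
  by apply: sumr_ge0 => T _; exact: cnorm_ge0.
move=> T /= Ts; rewrite (big_rem T) //= lerDl; apply: sumr_ge0 => U _.
exact: cnorm_ge0.
Qed.

(** * Growth of [rcp] and the entropy inequality *)

Section EntropyBound.
Variables (R : realType) (A : cstarAlgType R) (gamma : R[i] -> A -> A).
Hypothesis hg : circle_action gamma.
Variables (d : nat) (x : 'I_d -> A).
Hypothesis hx1 : forall i, spectral gamma 1 (x i).
Hypothesis hx : \sum_i x i * star (x i) = 1.
Variables (H : hilbertType R) (pi : A -> bop H).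
Hypothesis hpi : faithful_rep setT pi.
Variable omega : set A.
Hypothesis homega_fin : finite_set omega.
Hypothesis homega : omega `<=` spectral gamma 0.
Local Notation S := (spectral gamma 0).
Local Notation iterated n n0 :=
  (\bigcup_(k in `I_n) (iter k (sum_map x) @` F_set x omega n0)).

Let term (delta : R) (n : nat) : \bar R :=
  ((n%:R^-1 : R)%:E * lne (rcp S pi (omega_upto x omega n)
     (delta / (card_words x n.-1)%:R `^ 2)))%E.

Let term_ge0 delta n : (0 <= term delta n)%E.
Proof.
apply: mule_ge0; first by rewrite lee_fin invr_ge0 ler0n.
by rewrite lne_ge0; exact: rcp_ge1.
Qed.

Lemma ht_phi_ge0 : (0 <= ht_phi pi S x 2 omega)%E.
Proof.
apply: (@le_trans _ _ (limn_esup (term 1))); first exact: limn_esup_ge0.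
by apply: ereal_sup_ubound; exists 1 => //=.
Qed.

Lemma rcp_growth (n0 : nat) (delta h g : R) : 0 < delta -> 0 <= h -> 0 <= g ->
  (htop R (@left_shift d) (subshift x) < h%:E)%E -> (ht_phi pi S x 2 omega < g%:E)%E ->
  exists N C : nat, (0 < N)%N /\ \forall n \near \oo,
    (rcp setT pi (iterated n n0) delta <= (N%:R * expR ((n + C)%:R * (h + g)))%:E)%E.
Proof.
move=> delta0 h0 g0 hh hg'.
have [c c0 hc] := finite_cnorm_bound homega_fin.
(* Chosen independently of [n], so that the Fejer loss [n0 / N * c] stays below half of [delta]. *)
pose N := (maxn n0 (Num.truncn (n0%:R * c / (delta / 2))).+1).
have N0 : (0 < N)%N by rewrite leq_max orbT.
have n0N : (n0 <= N)%N by rewrite leq_maxl.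
have NR : 0 < N%:R :> R by rewrite ltr0n.
have hN : n0%:R / N%:R * c < delta / 2.
  have : n0%:R * c / (delta / 2) < N%:R.
    by apply: (lt_le_trans (truncnS_gt _)); rewrite ler_nat leq_maxr.
  rewrite ltr_pdivrMr ?divr_gt0 // => hlt.
  by rewrite mulrAC ltr_pdivrMr // [ltRHS]mulrC.
clearbody N.
(* The other half of [delta], divided by the factor [N] of the matrix size; the factors [theta] are
   absorbed by the exponent 2. *)
pose delta0' := delta / 2 / N%:R.
have d0 : 0 < delta0' by rewrite !divr_gt0.
exists N, (n0 + N)%N; split => //.
have ht0 : (limn_esup (term delta0') < g%:E)%E.
  by apply: le_lt_trans hg'; apply: ereal_sup_ubound; exists delta0'.
have := limn_esup_lt_near ht0; have := card_words_growth hx hh.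
move=> [N1 _ hN1] [N2 _ hN2]; exists (N1 + N2).+1 => // n /= hn.
rewrite addnA; set m := (n + n0 + N)%N.
have m0 : (0 < m)%N by rewrite /m addn_gt0 N0 orbT.
have [hm1 hm2] : (N1 <= m.-1)%N /\ (N2 <= m)%N.
  by rewrite /m; move: hn N0; clear; lia.
have th_lt : ((card_words x m.-1)%:R : R) < expR (m.-1%:R * h) by exact: hN1.
set th := card_words x m.-1 in th_lt *.
have th0 : 0 < th%:R :> R by rewrite ltr0n; exact: card_words_gt0.
have hterm : (term delta0' m < g%:E)%E by exact: hN2.
have hrcp : (rcp S pi (omega_upto x omega m) (delta0' / th%:R ^+ 2) < (expR (m%:R * g))%:E)%E.
  rewrite ltNge; apply/negP => hle.
  have : expR (m%:R * g) < expR (m%:R * g).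
    apply: (lt_expR_of_lne m0 hle); move: hterm.
    by rewrite /term (powR_mulrn 2) ?ler0n.
  by rewrite ltxx.
have [r0 hr r0lt] := rcp_lt hrcp.
have eta0 : 0 <= delta0' / th%:R ^+ 2 by rewrite divr_ge0 ?sqr_ge0 ?ltW.
have [K KN hK] : exists2 K : nat, (K <= N * th)%N &
    cp_approx setT pi (iterated n n0) delta (K * r0).
  apply: (cp_approx_words hg hx1 hx hpi homega N0 n0N hc c0 eta0) hr.
  rewrite -/m -/th natrM.
  (* Both powers of [theta] are spent here: one for the terms of an entry, one for the size of the
     matrix. *)
  have -> : th%:R * (delta0' / th%:R ^+ 2) * (N%:R * th%:R) = delta / 2.
    by rewrite /delta0'; field; rewrite !gt_eqF.
  lra.
apply: (le_trans (rcp_le hK)); rewrite lee_fin natrM.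
have KR : K%:R <= N%:R * th%:R :> R by rewrite -natrM ler_nat.
apply: (@le_trans _ _ (N%:R * th%:R * expR (m%:R * g))).
  by apply: ler_pM; rewrite ?ler0n // ltW.
rewrite -mulrA ler_wpM2l ?ler0n // mulrDr expRD ler_wpM2r ?expR_ge0 //.
apply: (le_trans (ltW th_lt)).
by rewrite ler_expR ler_wpM2r // ler_nat leq_pred.
Qed.

Lemma ht_le_htop_add_ht_phi (n0 : nat) :
  (ht pi (sum_map x) (F_set x omega n0)
     <= htop R (@left_shift d) (subshift x) + ht_phi pi S x 2 omega)%E.
Proof.
have hp := htop_ge0 hx; have gp := ht_phi_ge0.
(* Nonnegativity excludes [-oo], so an infinite summand makes the right side [+oo] and the bound
   trivial. *)
case eh : (htop R (@left_shift d) (subshift x)) hp => [h| |] // hp; last first.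
  by rewrite addye ?leey // -ltNye (lt_le_trans _ gp).
case eg : (ht_phi pi S x 2 omega) gp => [g| |] // gp; last by rewrite addey ?leey.
rewrite lee_fin in hp; rewrite lee_fin in gp.
rewrite -EFinD; apply/lee_addgt0Pr => e e0; rewrite -EFinD.
(* Two thirds make the bounds on the two entropies strict; the last absorbs the shift [C] and the
   factor [N] after division by [n]. *)
have e3 : 0 < e / 3 by lra.
apply: ge_ereal_sup => _ [delta /= delta0 <-]; apply: limn_esup_le_near.
have [||||N [C [N0 growth]]] := @rcp_growth n0 delta (h + e / 3) (g + e / 3) delta0.
- lra.
- lra.
- by rewrite eh lte_fin; lra.
- by rewrite eg lte_fin; lra.
pose b := h + g + 2 * (e / 3).
have avg := affine_average_near (ln N%:R + C%:R * b) b e3.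
near=> n.
have n0R : 0 < n%:R :> R by rewrite ltr0n; near: n; exists 1%N.
have NR : 0 < N%:R :> R by rewrite ltr0n.
apply: (@le_trans _ _ ((n%:R^-1 : R)%:E * (ln N%:R + (n + C)%:R * b)%:E)%E).
  rewrite lee_pmul2l ?lte_fin ?invr_gt0 //.
  have Q0 : 0 < N%:R * expR ((n + C)%:R * b) by rewrite mulr_gt0 ?expR_gt0.
  have <- : lne (N%:R * expR ((n + C)%:R * b))%:E = (ln N%:R + (n + C)%:R * b)%:E.
    by rewrite lne_EFin // lnM ?posrE ?expR_gt0 // expRK.
  rewrite lee_lne ?in_itv /= ?leey ?andbT ?lee_fin ?(ltW Q0) //; last first.
    by apply: le_trans (rcp_ge1 _ _ _ _); rewrite lee_fin.
  have -> : b = h + e / 3 + (g + e / 3) by rewrite /b; lra.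
  by near: n.
rewrite -EFinM lee_fin; apply: (@le_trans _ _ (b + e / 3)); last by rewrite /b; lra.
have -> : n%:R^-1 * (ln N%:R + (n + C)%:R * b) = (ln N%:R + C%:R * b + n%:R * b) / n%:R.
  by rewrite natrD; ring.
by near: n.
Unshelve. all: by end_near.
Qed.

End EntropyBound.

Theorem theorem7p4 (R : realType) (A : cstarAlgType R)
    (gamma : R[i] -> A -> A) (hgamma : circle_action gamma)
    (hfull : full_action gamma) (hexact : exact_cstar (spectral gamma 0))
    (d : nat) (x : 'I_d -> A) (hx1 : forall i, spectral gamma 1 (x i))
    (hx : \sum_i x i * star (x i) = 1)
    (H : hilbertType R) (pi : A -> bop H) (hpi : faithful_rep setT pi)
    (omega : set A) (homega_fin : finite_set omega)
    (homega : omega `<=` spectral gamma 0) (n0 : nat) :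
  (ht pi (sum_map x) (F_set x omega n0)
     <= htop R (@left_shift d) (subshift x) + ht_phi pi (spectral gamma 0) x 2 omega)%E.
Proof. exact: ht_le_htop_add_ht_phi. Qed.
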